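(* Let $0<q<1$ and consider the representations of $\mathcal{A}(S^4_q)$ on $\mathcal{H}_\pm$ described in the context. Let $\mathcal{H}:=\mathcal{H}_+\oplus\mathcal{H}_-$, let $\gamma$ be the natural grading ($\gamma=\pm1$ on $\mathcal{H}_\pm$), and let $F\in\mathcal{B}(\mathcal{H})$ be defined by $$F|l,m_1,m_2;j\rangle_\pm:=|l,m_1,m_2;j\rangle_\mp.$$ Then $(\mathcal{A}(S^4_q),\mathcal{H},F,\gamma)$ is a $1$-summable even Fredholm module. This Fredholm module is non-trivial. In particular, $$\mathrm{ch}^F([e]):=\tfrac12\mathrm{Tr}_{\mathcal{H}\otimes\mathbb{C}^4}(\gamma F[F,e])=1,$$ where $e\in\mathrm{Mat}_4(\mathcal{A}(S^4_q))$ is the idempotent $$e:=\frac12\begin{pmatrix}1+x_0 & q^3x_2 & -qx_1 & 0\\ q^{-3}x_2^* & 1-q^2x_0 & 0 & q^3x_1\\ -q^{-1}x_1^* & 0 & 1-q^2x_0 & q^3x_2\\ 0 & qx_1^* & q^{-3}x_2^* & 1+q^4x_0\end{pmatrix}.$$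
   Context: Notation: $\mathbb{N}=\{0,1,2,\dots\}$, $[z]:=(q^z-q^{-z})/(q-q^{-1})$. The algebra: $\mathcal{A}(S^4_q)$ is the unital $*$-algebra generated by $x_0=x_0^*$, $x_1,x_2,x_1^*,x_2^*$ with relations $x_ix_j=q^2x_jx_i$ for $0\le i<j\le 2$; $x_i^*x_j=q^2x_jx_i^*$ for $i\neq j$; $[x_1^*,x_1]=(1-q^4)x_0^2$; $[x_2^*,x_2]=x_1^*x_1-q^4x_1x_1^*$; $x_0^2+x_1x_1^*+x_2x_2^*=1$. Fredholm modules: $(\mathcal{A},\mathcal{H},F,\gamma)$ is an even Fredholm module if $\mathcal{A}$ is $*$-represented by bounded operators on $\mathcal{H}$, $F=F^*$, $F^2=1$, $[F,a]$ is compact for all $a\in\mathcal{A}$, $\gamma=\gamma^*$, $\gamma^2=1$, $\gamma F+F\gamma=0$ and $\gamma a=a\gamma$ for all $a\in\mathcal{A}$. It is $1$-summable if $[F,a]$ is trace class for all $a\in\mathcal{A}$. In the trace formula $\gamma$ and $F$ are extended as $\gamma\otimes1$ and $F\otimes 1$; non-trivial means that the pairing $\mathrm{ch}^F:K_0(\mathcal{A})\to\mathbb{Z}$ is non-zero. Chiral spinor representations: $\mathcal{H}_\pm$ has orthonormal basis $|l,m_1,m_2;j\rangle_\pm$ with $l\in\mathbb{N}+\frac12$, $j=\frac12,\frac32,\ldots,l$, $j-|m_1|\in\mathbb{N}$, $l+\frac12-j-|m_2|\in\mathbb{N}$. Kets with inadmissible labels are $0$. In each coefficient with indices $(l,j,m_2)$,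 $\epsilon=\frac12(-1)^{l+\frac12-j-m_2}$ is computed from those same indices. The bounded $*$-representation on $\mathcal{H}_\pm$ is \begin{align*} x_0|l,m_1,m_2;j\rangle_\pm &=A^+_{j,m_1}C^+_{l,j,m_2}|l+1,m_1,m_2;j+1\rangle_\pm \mp A^+_{j,m_1}C^0_{l,j,m_2}|l,m_1,m_2;j+1\rangle_\pm +A^+_{j,m_1}C^-_{l,j,m_2}|l-1,m_1,m_2;j+1\rangle_\pm \\ &\quad +A^0_{j,m_1}H^+_{l,j,m_2}|l+1,m_1,m_2;j\rangle_\pm \pm A^0_{j,m_1}H^0_{l,j,m_2}|l,m_1,m_2;j\rangle_\pm +A^0_{j,m_1}H^+_{l-1,j,m_2}|l-1,m_1,m_2;j\rangle_\pm \\ &\quad +A^+_{j-1,m_1}C^-_{l+1,j-1,m_2}|l+1,m_1,m_2;j-1\rangle_\pm \mp A^+_{j-1,m_1}C^0_{l,j-1,m_2}|l,m_1,m_2;j-1\rangle_\pm +A^+_{j-1,m_1}C^+_{l-1,j-1,m_2}|l-1,m_1,m_2;j-1\rangle_\pm,\\ x_1|l,m_1,m_2;j\rangle_\pm &=B^+_{j,m_1}C^+_{l,j,m_2}|l+1,m_1+1,m_2;j+1\rangle_\pm \mp B^+_{j,m_1}C^0_{l,j,m_2}|l,m_1+1,m_2;j+1\rangle_\pm +B^+_{j,m_1}C^-_{l,j,m_2}|l-1,m_1+1,m_2;j+1\rangle_\pm \\ &\quad +B^0_{j,m_1}H^+_{l,j,m_2}|l+1,m_1+1,m_2;j\rangle_\pm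 \pm B^0_{j,m_1}H^0_{l,j,m_2}|l,m_1+1,m_2;j\rangle_\pm +B^0_{j,m_1}H^+_{l-1,j,m_2}|l-1,m_1+1,m_2;j\rangle_\pm \\ &\quad +B^-_{j,m_1}C^-_{l+1,j-1,m_2}|l+1,m_1+1,m_2;j-1\rangle_\pm \mp B^-_{j,m_1}C^0_{l,j-1,m_2}|l,m_1+1,m_2;j-1\rangle_\pm +B^-_{j,m_1}C^+_{l-1,j-1,m_2}|l-1,m_1+1,m_2;j-1\rangle_\pm,\\ x_2|l,m_1,m_2;j\rangle_\pm &=D^+_{l,j,m_2}|l+1,m_1,m_2+1;j\rangle_\pm \pm D^0_{l,j,m_2}|l,m_1,m_2+1;j\rangle_\pm +D^-_{l,j,m_2}|l-1,m_1,m_2+1;j\rangle_\pm, \end{align*} with \begin{align*} A^+_{j,m_1} &=q^{m_1-1}\frac{\sqrt{[j+m_1+1][j-m_1+1]}}{[2j+2]},\qquad A^0_{j,m_1} =q^{-2}\frac{q^{j+m_1+1}[2][j-m_1]-[2j]}{[2j][2j+2]},\\ B^+_{j,m_1} &=q^{-j+m_1-1/2}\frac{\sqrt{[j+m_1+1][j+m_1+2]}}{[2j+2]},\qquad B^0_{j,m_1} =(1+q^2)q^{m_1-1/2}\frac{\sqrt{[j-m_1][j+m_1+1]}}{[2j][2j+2]},\\ B^-_{j,m_1} &=-q^{j+m_1+1/2}\frac{\sqrt{[j-m_1][j-m_1-1]}}{[2j]},\\ C^+_{l,j,m_2} &=-q^{m_2-1-\epsilon}\frac{\sqrt{[l+j+m_2+3+\epsilon][l+j-m_2+3-\epsilon]}}{[2l+4]},\\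 C^0_{l,j,m_2} &=[4\epsilon]\,q^{2\epsilon l+m_2-1+3\epsilon}\frac{\sqrt{[l+\frac12+j-2\epsilon m_2+2][l+\frac12-j-2\epsilon m_2]}}{[2l+2][2l+4]},\\ C^-_{l,j,m_2} &=-q^{m_2-1+\epsilon}\frac{\sqrt{[l-j+m_2-\epsilon][l-j-m_2+\epsilon]}}{[2l+2]},\\ H^+_{l,j,m_2} &=q^{m_2-1+\epsilon(2j+1)}\frac{\sqrt{[l+2\epsilon j-m_2+2+\epsilon][l-2\epsilon j+m_2+2-\epsilon]}}{[2l+4]},\\ H^0_{l,j,m_2} &=\frac{[l-\epsilon(2j+1)-m_2+1][l-\epsilon(2j+1)+m_2+2]-q^{-2}[l+\epsilon(2j+1)-m_2+2][l+\epsilon(2j+1)+m_2+1]}{[2l+2][2l+4]},\\ D^+_{l,j,m_2} &=q^{-l+m_2-3/2}\frac{\sqrt{[l+j+m_2+3+\epsilon][l-j+m_2+2-\epsilon]}}{[2l+4]},\\ D^0_{l,j,m_2} &=[2]q^{m_2+1/2}\frac{\sqrt{[l-2\epsilon j-m_2+1-\epsilon][l-2\epsilon j+m_2+2-\epsilon]}}{[2l+2][2l+4]},\\ D^-_{l,j,m_2} &=-q^{l+m_2+3/2}\frac{\sqrt{[l-j-m_2+\epsilon][l+j-m_2+1-\epsilon]}}{[2l+2]}. \end{align*} *)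

(* Defs.v *)
From HB Require Import structures.
From mathcomp Require Import all_boot all_order all_algebra generic_quotient.
From mathcomp Require Import all_classical all_reals all_analysis.
From mathcomp Require Import complex.
From mathcomp Require summability.

Set Implicit Arguments.
Unset Strict Implicit.
Unset Printing Implicit Defensive.
Import Order.TTheory GRing.Theory Num.Theory.
Import numFieldNormedType.Exports.

Local Open Scope classical_set_scope.
Local Open Scope ring_scope.
Local Open Scope complex_scope.
Local Open Scope quotient_scope.

(** The inner product is linear in its second argument; the norm [`|x|] takes
    its values in [R[i]]. *)
HB.mixin Record CompleteNormedModule_isHilbert (R : realType) H
    of CompleteNormedModule R[i] H := {
  dot : H -> H -> R[i];
  dotDr : forall x y z : H, dot x (y + z) = dot x y + dot x z;
  dotZr : forall (a : R[i]) (x y : H), dot x (a *: y) = a * dot x y;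
  dot_conj : forall x y : H, dot y x = Num.conj (dot x y);
  dot_norm : forall x : H, dot x x = `|x| ^+ 2
}.

#[short(type="hilbertType")]
HB.structure Definition Hilbert (R : realType) :=
  {H of CompleteNormedModule_isHilbert R H & CompleteNormedModule R[i] H}.

Definition orthonormal_basis (R : realType) (H : hilbertType R) (I : choiceType)
    (b : I -> H) : Prop :=
  (forall i j, dot (b i) (b j) = (i == j)%:R) /\
  closure [set x | exists (s : seq I) (c : I -> R[i]),
                     x = \sum_(i <- s) c i *: b i] = [set: H].

Section BoundedOperators.
Variables (R : realType) (H : hilbertType R).

Record bop := Bop {
  bop_fun :> H -> H;
  bop_linear : linear bop_fun;
  bop_bounded : exists M : R, forall x : H, `|bop_fun x| <= M%:C * `|x|
}.

HB.instance Definition _ := gen_eqMixin bop.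
HB.instance Definition _ := gen_choiceMixin bop.

Lemma bopP (S T : bop) : (forall x, S x = T x) -> S = T.
Proof.
case: S T => [f lf bf] [g lg bg] /= fg.
have E : f = g by apply/funext.
rewrite -E in lg bg *.
by rewrite (Prop_irrelevance lf lg) (Prop_irrelevance bf bg).
Qed.

Lemma bop_bound_ge0 (T : bop) :
  exists M : R, 0 <= M /\ forall x : H, `|T x| <= M%:C * `|x|.
Proof.
have [M hM] := bop_bounded T; exists `|M|; split=> // x.
apply: (le_trans (hM x)); apply: ler_wpM2r => //.
by rewrite lecR ler_norm.
Qed.

Fact bop_zero_linear : linear (fun _ : H => 0 : H).
Proof. by move=> a x y; rewrite scaler0 addr0. Qed.
Fact bop_zero_bounded :
  exists M : R, forall x : H, `|0 : H| <= M%:C * `|x|.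
Proof. by exists 0 => x; rewrite normr0 mul0r. Qed.
Definition bop_zero := Bop bop_zero_linear bop_zero_bounded.

Fact bop_one_linear : linear (fun x : H => x).
Proof. by []. Qed.
Fact bop_one_bounded : exists M : R, forall x : H, `|x| <= M%:C * `|x|.
Proof. by exists 1 => x; rewrite mul1r. Qed.
Definition bop_one := Bop bop_one_linear bop_one_bounded.

Fact bop_add_linear (S T : bop) : linear (fun x => S x + T x).
Proof.
by move=> a x y; rewrite !bop_linear scalerDr addrACA.
Qed.
Fact bop_add_bounded (S T : bop) :
  exists M : R, forall x : H, `|S x + T x| <= M%:C * `|x|.
Proof.
have [M hM] := bop_bounded S; have [N hN] := bop_bounded T.
exists (M + N) => x; rewrite rmorphD mulrDl.
by apply: (le_trans (ler_normD _ _)); apply: lerD.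
Qed.
Definition bop_add S T := Bop (bop_add_linear S T) (bop_add_bounded S T).

Fact bop_scale_linear (a : R[i]) (T : bop) : linear (fun x => a *: T x).
Proof.
by move=> c x y; rewrite bop_linear scalerDr !scalerA (mulrC a c).
Qed.
Fact bop_scale_bounded (a : R[i]) (T : bop) :
  exists M : R, forall x : H, `|a *: T x| <= M%:C * `|x|.
Proof.
have [M hM] := bop_bounded T; exists (complex.Re `|a| * M) => x.
rewrite normrZ rmorphM /= -mulrA.
have -> : (complex.Re `|a|)%:C = `|a|.
  by rewrite RRe_real // ger0_real.
by apply: ler_wpM2l.
Qed.
Definition bop_scale a T := Bop (bop_scale_linear a T) (bop_scale_bounded a T).

Fact bop_mul_linear (S T : bop) : linear (fun x => S (T x)).
Proof. by move=> a x y; rewrite !bop_linear. Qed.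
Fact bop_mul_bounded (S T : bop) :
  exists M : R, forall x : H, `|S (T x)| <= M%:C * `|x|.
Proof.
have [M [M0 hM]] := bop_bound_ge0 S; have [N hN] := bop_bounded T.
exists (M * N) => x; rewrite rmorphM /= -mulrA.
by apply: (le_trans (hM _)); apply: ler_wpM2l; rewrite // ler0c.
Qed.
Definition bop_mul S T := Bop (bop_mul_linear S T) (bop_mul_bounded S T).

Definition bop_opp T := bop_scale (-1) T.

Fact bop_addA : associative bop_add.
Proof. by move=> S T U; apply: bopP => x /=; rewrite addrA. Qed.
Fact bop_addC : commutative bop_add.
Proof. by move=> S T; apply: bopP => x /=; rewrite addrC. Qed.
Fact bop_add0 : left_id bop_zero bop_add.
Proof. by move=> T; apply: bopP => x /=; rewrite add0r. Qed.
Fact bop_addN : left_inverse bop_zero bop_opp bop_add.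
Proof. by move=> T; apply: bopP => x /=; rewrite scaleN1r addNr. Qed.
HB.instance Definition _ :=
  GRing.isZmodule.Build bop bop_addA bop_addC bop_add0 bop_addN.

Lemma bop_fun0 (T : bop) : T 0 = 0.
Proof.
by have := bop_linear T (-1) 0 0; rewrite scaleN1r oppr0 add0r scaleN1r addNr.
Qed.
Lemma bop_funD (T : bop) x y : T (x + y) = T x + T y.
Proof. by have := bop_linear T 1 x y; rewrite !scale1r. Qed.

Fact bop_mulA : associative bop_mul.
Proof. by move=> S T U; apply: bopP. Qed.
Fact bop_mul1 : left_id bop_one bop_mul.
Proof. by move=> T; apply: bopP. Qed.
Fact bop_mulr1 : right_id bop_one bop_mul.
Proof. by move=> T; apply: bopP. Qed.
Fact bop_mulDl : left_distributive bop_mul +%R.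
Proof. by move=> S T U; apply: bopP. Qed.
Fact bop_mulDr : right_distributive bop_mul +%R.
Proof. by move=> S T U; apply: bopP => x /=; rewrite bop_funD. Qed.
HB.instance Definition _ := GRing.Zmodule_isPzRing.Build bop
  bop_mulA bop_mul1 bop_mulr1 bop_mulDl bop_mulDr.

Fact bop_scaleA (a c : R[i]) T :
  bop_scale a (bop_scale c T) = bop_scale (a * c) T.
Proof. by apply: bopP => x /=; rewrite scalerA. Qed.
Fact bop_scale1 : left_id 1 bop_scale.
Proof. by move=> T; apply: bopP => x /=; rewrite scale1r. Qed.
Fact bop_scaleDr : right_distributive bop_scale +%R.
Proof. by move=> a S T; apply: bopP => x /=; rewrite scalerDr. Qed.
Fact bop_scaleDl T : {morph bop_scale^~ T : a c / a + c}.
Proof. by move=> a c; apply: bopP => x /=; rewrite scalerDl. Qed.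
HB.instance Definition _ := GRing.Zmodule_isLmodule.Build R[i] bop
  bop_scaleA bop_scale1 bop_scaleDr bop_scaleDl.

Definition adjoint (T S : bop) : Prop :=
  forall x y : H, dot (T x) y = dot x (S y).

Definition self_adjoint (T : bop) : Prop := adjoint T T.

Definition compact_op (T : bop) : Prop :=
  compact (closure (T @` [set x : H | `|x| <= 1])).

Definition positive_op (T : bop) : Prop := forall x : H, 0 <= dot x (T x).

(** [P] is [(T^* T)^(1/2)]. *)
Definition is_abs_op (T P : bop) : Prop :=
  positive_op P /\ exists2 T', adjoint T T' & P * P = T' * T.

Definition trace_class (T : bop) : Prop :=
  exists2 P, is_abs_op T P &
    exists (I : choiceType) (b : I -> H), orthonormal_basis b /\
      (\esum_(i in [set: I]) (complex.Re (dot (b i) (P (b i))))%:E < +oo)%E.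

(** The sum is the limit of the partial sums over finite sets of indices; it
    is meant for trace-class [T], where it exists and does not depend on [b]. *)
Definition trace (I : choiceType) (b : I -> H) (T : bop) : R[i] :=
  summability.sum (fun i => dot (b i) (T (b i)) : R[i]^o).

(** ['M[bop H]_n] is the algebra of bounded operators on H (x) C^n, with
    orthonormal basis [b i (x) e_k]. *)
Definition trace_mx (I : choiceType) (b : I -> H) n (T : 'M[bop]_n) : R[i] :=
  \sum_(k < n) trace b (T k k).

End BoundedOperators.

Definition commutator (A : pzRingType) (x y : A) : A := x * y - y * x.

HB.mixin Record Algebra_hasStar (R : realType) A
    of GRing.Algebra R[i] A := {
  star : A -> A;
  starK : involutive star;
  starD : forall x y : A, star (x + y) = star x + star y;
  starM : forall x y : A, star (x * y) = star y * star x;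
  starZ : forall (c : R[i]) (x : A), star (c *: x) = Num.conj c *: star x
}.

#[short(type="starAlgType")]
HB.structure Definition StarAlgebra (R : realType) :=
  {A of Algebra_hasStar R A & GRing.Algebra R[i] A}.

Section KTheory.
Variable A : pzRingType.

Definition idempotent_mx n (e : 'M[A]_n) : Prop := e *m e = e.

Definition mvn_equiv m n (e : 'M[A]_m) (f : 'M[A]_n) : Prop :=
  exists (u : 'M[A]_(m, n)) (v : 'M[A]_(n, m)), e = u *m v /\ f = v *m u.

(** K_0 is the abelian group generated by the classes of idempotent matrices,
    subject to [e] = [f] for equivalent e and f, and to
    [e (+) f] = [e] + [f]; this is the Grothendieck group of the semigroup of
    equivalence classes of idempotents. *)
Inductive K0_expr :=
| K0_gen n (e : 'M[A]_n) of idempotent_mx e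
| K0_zero
| K0_plus of K0_expr & K0_expr
| K0_minus of K0_expr.

Inductive K0_eq : K0_expr -> K0_expr -> Prop :=
| K0_refl x : K0_eq x x
| K0_sym x y : K0_eq x y -> K0_eq y x
| K0_trans x y z : K0_eq x y -> K0_eq y z -> K0_eq x z
| K0_plus_cong x x' y y' :
    K0_eq x x' -> K0_eq y y' -> K0_eq (K0_plus x y) (K0_plus x' y')
| K0_minus_cong x x' : K0_eq x x' -> K0_eq (K0_minus x) (K0_minus x')
| K0_plusA x y z :
    K0_eq (K0_plus x (K0_plus y z)) (K0_plus (K0_plus x y) z)
| K0_plusC x y : K0_eq (K0_plus x y) (K0_plus y x)
| K0_plus0 x : K0_eq (K0_plus K0_zero x) x
| K0_plusN x : K0_eq (K0_plus (K0_minus x) x) K0_zero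
| K0_mvn m n (e : 'M[A]_m) (f : 'M[A]_n) (he : idempotent_mx e)
    (hf : idempotent_mx f) :
    mvn_equiv e f -> K0_eq (K0_gen he) (K0_gen hf)
| K0_dsum m n (e : 'M[A]_m) (f : 'M[A]_n) (he : idempotent_mx e)
    (hf : idempotent_mx f) (hef : idempotent_mx (block_mx e 0 0 f)) :
    K0_eq (K0_gen hef) (K0_plus (K0_gen he) (K0_gen hf)).

HB.instance Definition _ := gen_eqMixin K0_expr.
HB.instance Definition _ := gen_choiceMixin K0_expr.

Definition K0_eqb (x y : K0_expr) : bool := `[< K0_eq x y >].

Fact K0_eqb_equiv : equiv_class_of K0_eqb.
Proof.
split=> [x|x y|y x z]; rewrite /K0_eqb.
- by apply/asboolP; apply: K0_refl.
- by apply/asboolP/asboolP => /K0_sym.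
- by move=> /asboolP xy /asboolP yz; apply/asboolP; apply: K0_trans yz.
Qed.
Canonical K0_equiv := EquivRelPack K0_eqb_equiv.

Definition K0 := {eq_quot K0_equiv}.
HB.instance Definition _ := Choice.on K0.

Definition to_K0 (x : K0_expr) : K0 := \pi_{eq_quot K0_equiv} x.
Definition of_K0 (x : K0) : K0_expr := @repr _ {eq_quot K0_equiv} x.

Lemma of_K0K x : to_K0 (of_K0 x) = x. Proof. exact: reprK. Qed.

Lemma to_K0P x y : to_K0 x = to_K0 y <-> K0_eq x y.
Proof.
split=> [|xy]; first by move/eqmodP/asboolP.
by apply/eqmodP/asboolP.
Qed.

Lemma to_K0K x : K0_eq (of_K0 (to_K0 x)) x.
Proof. by apply/to_K0P; rewrite of_K0K. Qed.

Definition K0_add (x y : K0) : K0 := to_K0 (K0_plus (of_K0 x) (of_K0 y)).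
Definition K0_opp (x : K0) : K0 := to_K0 (K0_minus (of_K0 x)).

Lemma K0_addE x y : K0_add (to_K0 x) (to_K0 y) = to_K0 (K0_plus x y).
Proof. by apply/to_K0P; apply: K0_plus_cong; apply: to_K0K. Qed.
Lemma K0_oppE x : K0_opp (to_K0 x) = to_K0 (K0_minus x).
Proof. by apply/to_K0P; apply: K0_minus_cong; apply: to_K0K. Qed.

Fact K0_addA : associative K0_add.
Proof.
move=> x y z; rewrite -(of_K0K x) -(of_K0K y) -(of_K0K z) !K0_addE.
by apply/to_K0P; apply: K0_plusA.
Qed.
Fact K0_addC : commutative K0_add.
Proof. by move=> x y; apply/to_K0P; apply: K0_plusC. Qed.
Fact K0_add0 : left_id (to_K0 K0_zero) K0_add.
Proof.
by move=> x; rewrite -(of_K0K x) K0_addE; apply/to_K0P; apply: K0_plus0.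
Qed.
Fact K0_addN : left_inverse (to_K0 K0_zero) K0_opp K0_add.
Proof.
move=> x; rewrite -(of_K0K x) K0_oppE K0_addE.
by apply/to_K0P; apply: K0_plusN.
Qed.
HB.instance Definition _ :=
  GRing.isZmodule.Build K0 K0_addA K0_addC K0_add0 K0_addN.

Definition K0_class n (e : 'M[A]_n) (he : idempotent_mx e) : K0 :=
  to_K0 (K0_gen he).

End KTheory.

Section FredholmModules.
Variables (R : realType) (A : starAlgType R) (H : hilbertType R).
Implicit Types (pi : A -> bop H) (F gamma : bop H).

Definition star_representation pi : Prop :=
  [/\ linear pi, pi 1 = 1, (forall x y, pi (x * y) = pi x * pi y) &
      forall x, adjoint (pi x) (pi (star x))].

Record even_fredholm_module pi F gamma : Prop := EvenFredholmModule {
  fredholm_rep : star_representation pi;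
  fredholm_F_adjoint : self_adjoint F;
  fredholm_F_square : F * F = 1;
  fredholm_compact : forall x, compact_op (commutator F (pi x));
  fredholm_gamma_adjoint : self_adjoint gamma;
  fredholm_gamma_square : gamma * gamma = 1;
  fredholm_gamma_F : gamma * F + F * gamma = 0;
  fredholm_gamma_pi : forall x, gamma * pi x = pi x * gamma
}.

Definition one_summable pi F : Prop :=
  forall x, trace_class (commutator F (pi x)).

(** The matrices [gamma%:M] and [F%:M] are gamma (x) 1 and F (x) 1 on
    H (x) C^n. *)
Definition half_trace (I : choiceType) (b : I -> H) pi F gamma n
    (e : 'M[A]_n) : R[i] :=
  2^-1 * trace_mx b
    (gamma%:M *m F%:M *m (F%:M *m map_mx pi e - map_mx pi e *m F%:M)).

(** The pairing sends [e] - [f] to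
    1/2 Tr (gamma F [F, e]) - 1/2 Tr (gamma F [F, f]), which is an integer when
    (pi, F, gamma) is a 1-summable even Fredholm module. *)
Definition chF (I : choiceType) (b : I -> H) pi F gamma (x : K0 A) : int :=
  xget 0 [set k : int | exists m n (e : 'M[A]_m) (f : 'M[A]_n)
    (he : idempotent_mx e) (hf : idempotent_mx f),
    x = K0_class he - K0_class hf /\
    k%:~R = half_trace b pi F gamma e - half_trace b pi F gamma f].

Definition nontrivial_fredholm (I : choiceType) (b : I -> H) pi F gamma :=
  exists x : K0 A, chF b pi F gamma x <> 0.

End FredholmModules.

Section QuantumSphere.
Variables (R : realType) (q : R).
Local Notation C := R[i].

Inductive s4_expr :=
| s4_gen of 'I_3
| s4_zero
| s4_one
| s4_plus of s4_expr & s4_expr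
| s4_minus of s4_expr
| s4_times of s4_expr & s4_expr
| s4_scal of C & s4_expr
| s4_star of s4_expr.

Local Notation "x #+ y" := (s4_plus x y) (at level 50, left associativity).
Local Notation "x #* y" := (s4_times x y) (at level 40, left associativity).
Local Notation "c #: x" := (s4_scal c x) (at level 40, left associativity).
Local Notation "x ^s" := (s4_star x) (at level 2, format "x ^s").
Local Notation X := s4_gen.
Let o0 : 'I_3 := inord 0.
Let o1 : 'I_3 := inord 1.
Let o2 : 'I_3 := inord 2.

(** The smallest congruence that makes the quotient a unital *-algebra in which
    the defining relations hold. *)
Inductive s4_eq : s4_expr -> s4_expr -> Prop :=
| s4_refl x : s4_eq x x
| s4_sym x y : s4_eq x y -> s4_eq y x
| s4_trans x y z : s4_eq x y -> s4_eq y z -> s4_eq x z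
| s4_plus_cong x x' y y' :
    s4_eq x x' -> s4_eq y y' -> s4_eq (x #+ y) (x' #+ y')
| s4_minus_cong x x' : s4_eq x x' -> s4_eq (s4_minus x) (s4_minus x')
| s4_times_cong x x' y y' :
    s4_eq x x' -> s4_eq y y' -> s4_eq (x #* y) (x' #* y')
| s4_scal_cong c x x' : s4_eq x x' -> s4_eq (c #: x) (c #: x')
| s4_star_cong x x' : s4_eq x x' -> s4_eq x^s x'^s
| s4_plusA x y z : s4_eq (x #+ (y #+ z)) (x #+ y #+ z)
| s4_plusC x y : s4_eq (x #+ y) (y #+ x)
| s4_plus0 x : s4_eq (s4_zero #+ x) x
| s4_plusN x : s4_eq (s4_minus x #+ x) s4_zero
| s4_timesA x y z : s4_eq (x #* (y #* z)) (x #* y #* z)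
| s4_times1l x : s4_eq (s4_one #* x) x
| s4_times1r x : s4_eq (x #* s4_one) x
| s4_timesDl x y z : s4_eq ((x #+ y) #* z) (x #* z #+ y #* z)
| s4_timesDr x y z : s4_eq (x #* (y #+ z)) (x #* y #+ x #* z)
| s4_scalA c d x : s4_eq (c #: (d #: x)) ((c * d) #: x)
| s4_scal1 x : s4_eq (1 #: x) x
| s4_scalDr c x y : s4_eq (c #: (x #+ y)) (c #: x #+ c #: y)
| s4_scalDl c d x : s4_eq ((c + d) #: x) (c #: x #+ d #: x)
| s4_scalAl c x y : s4_eq (c #: (x #* y)) ((c #: x) #* y)
| s4_scalAr c x y : s4_eq (c #: (x #* y)) (x #* (c #: y))
| s4_starK x : s4_eq x^s^s x
| s4_starD x y : s4_eq (x #+ y)^s (x^s #+ y^s)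
| s4_starM x y : s4_eq (x #* y)^s (y^s #* x^s)
| s4_starZ c x : s4_eq (c #: x)^s (Num.conj c #: x^s)
| s4_x0_star : s4_eq (X o0)^s (X o0)
| s4_rel (i j : 'I_3) : (i < j)%N ->
    s4_eq (X i #* X j) ((q ^+ 2)%:C #: (X j #* X i))
| s4_rel_star (i j : 'I_3) : i != j ->
    s4_eq ((X i)^s #* X j) ((q ^+ 2)%:C #: (X j #* (X i)^s))
| s4_comm1 :
    s4_eq ((X o1)^s #* X o1 #+ s4_minus (X o1 #* (X o1)^s))
          ((1 - q ^+ 4)%:C #: (X o0 #* X o0))
| s4_comm2 :
    s4_eq ((X o2)^s #* X o2 #+ s4_minus (X o2 #* (X o2)^s))
          ((X o1)^s #* X o1 #+ s4_minus ((q ^+ 4)%:C #: (X o1 #* (X o1)^s)))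
| s4_sphere :
    s4_eq (X o0 #* X o0 #+ X o1 #* (X o1)^s #+ X o2 #* (X o2)^s) s4_one.

HB.instance Definition _ := gen_eqMixin s4_expr.
HB.instance Definition _ := gen_choiceMixin s4_expr.

Definition s4_eqb (x y : s4_expr) : bool := `[< s4_eq x y >].

Fact s4_eqb_equiv : equiv_class_of s4_eqb.
Proof.
split=> [x|x y|y x z]; rewrite /s4_eqb.
- by apply/asboolP; apply: s4_refl.
- by apply/asboolP/asboolP => /s4_sym.
- by move=> /asboolP xy /asboolP yz; apply/asboolP; apply: s4_trans yz.
Qed.
Canonical s4_equiv := EquivRelPack s4_eqb_equiv.

Definition s4q := {eq_quot s4_equiv}.
HB.instance Definition _ := Choice.on s4q.

Definition to_s4q (x : s4_expr) : s4q := \pi_{eq_quot s4_equiv} x.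
Definition of_s4q (x : s4q) : s4_expr := @repr _ {eq_quot s4_equiv} x.

Lemma of_s4qK x : to_s4q (of_s4q x) = x. Proof. exact: reprK. Qed.

Lemma to_s4qP x y : to_s4q x = to_s4q y <-> s4_eq x y.
Proof.
split=> [|xy]; first by move/eqmodP/asboolP.
by apply/eqmodP/asboolP.
Qed.

Lemma to_s4qK x : s4_eq (of_s4q (to_s4q x)) x.
Proof. by apply/to_s4qP; rewrite of_s4qK. Qed.

Lemma s4q_ind (P : s4q -> Prop) : (forall x, P (to_s4q x)) -> forall x, P x.
Proof. by move=> h x; rewrite -(of_s4qK x). Qed.

Definition s4q_add (x y : s4q) := to_s4q (of_s4q x #+ of_s4q y).
Definition s4q_opp (x : s4q) := to_s4q (s4_minus (of_s4q x)).
Definition s4q_mul (x y : s4q) := to_s4q (of_s4q x #* of_s4q y).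
Definition s4q_scale (c : C) (x : s4q) := to_s4q (c #: of_s4q x).
Definition s4q_star (x : s4q) := to_s4q (of_s4q x)^s.

Lemma s4q_addE x y : s4q_add (to_s4q x) (to_s4q y) = to_s4q (x #+ y).
Proof. by apply/to_s4qP; apply: s4_plus_cong; apply: to_s4qK. Qed.
Lemma s4q_oppE x : s4q_opp (to_s4q x) = to_s4q (s4_minus x).
Proof. by apply/to_s4qP; apply: s4_minus_cong; apply: to_s4qK. Qed.
Lemma s4q_mulE x y : s4q_mul (to_s4q x) (to_s4q y) = to_s4q (x #* y).
Proof. by apply/to_s4qP; apply: s4_times_cong; apply: to_s4qK. Qed.
Lemma s4q_scaleE c x : s4q_scale c (to_s4q x) = to_s4q (c #: x).
Proof. by apply/to_s4qP; apply: s4_scal_cong; apply: to_s4qK. Qed.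
Lemma s4q_starE x : s4q_star (to_s4q x) = to_s4q x^s.
Proof. by apply/to_s4qP; apply: s4_star_cong; apply: to_s4qK. Qed.

Let s4qE := (s4q_addE, s4q_oppE, s4q_mulE, s4q_scaleE, s4q_starE).

Fact s4q_addA : associative s4q_add.
Proof.
elim/s4q_ind=> x; elim/s4q_ind=> y; elim/s4q_ind=> z; rewrite !s4qE.
by apply/to_s4qP; constructor.
Qed.
Fact s4q_addC : commutative s4q_add.
Proof.
elim/s4q_ind=> x; elim/s4q_ind=> y; rewrite !s4qE.
by apply/to_s4qP; apply: s4_plusC.
Qed.
Fact s4q_add0 : left_id (to_s4q s4_zero) s4q_add.
Proof.
by elim/s4q_ind=> x; rewrite !s4qE; apply/to_s4qP; apply: s4_plus0.
Qed.
Fact s4q_addN : left_inverse (to_s4q s4_zero) s4q_opp s4q_add.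
Proof.
by elim/s4q_ind=> x; rewrite !s4qE; apply/to_s4qP; apply: s4_plusN.
Qed.
HB.instance Definition _ :=
  GRing.isZmodule.Build s4q s4q_addA s4q_addC s4q_add0 s4q_addN.

(** The character x_0, x_1 |-> 0, x_2 |-> 1 shows that 1 <> 0 in the algebra. *)
Fixpoint s4_eval (x : s4_expr) : C :=
  match x with
  | s4_gen i => (i == o2)%:R
  | s4_zero => 0
  | s4_one => 1
  | x #+ y => s4_eval x + s4_eval y
  | s4_minus x => - s4_eval x
  | x #* y => s4_eval x * s4_eval y
  | c #: x => c * s4_eval x
  | x^s => Num.conj (s4_eval x)
  end.

Lemma s4_eval_eq x y : s4_eq x y -> s4_eval x = s4_eval y.
Proof.
have o02 : (o0 == o2) = false by rewrite -val_eqE /= !inordK.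
have o12 : (o1 == o2) = false by rewrite -val_eqE /= !inordK.
elim=> {x y} //=.
- by move=> x y z _ -> _ ->.
- by move=> x x' y y' _ -> _ ->.
- by move=> x x' _ ->.
- by move=> x x' y y' _ -> _ ->.
- by move=> c x x' _ ->.
- by move=> x x' _ ->.
- by move=> x y z; rewrite addrA.
- by move=> x y; rewrite addrC.
- by move=> x; rewrite add0r.
- by move=> x; rewrite addNr.
- by move=> x y z; rewrite mulrA.
- by move=> x; rewrite mul1r.
- by move=> x; rewrite mulr1.
- by move=> x y z; rewrite mulrDl.
- by move=> x y z; rewrite mulrDr.
- by move=> c d x; rewrite mulrA.
- by move=> x; rewrite mul1r.
- by move=> c x y; rewrite mulrDr.
- by move=> c d x; rewrite mulrDl.
- by move=> c x y; rewrite mulrA.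
- by move=> c x y; rewrite mulrCA.
- by move=> x; rewrite conjCK.
- by move=> x y; rewrite rmorphD.
- by move=> x y; rewrite rmorphM mulrC.
- by move=> c x; rewrite rmorphM.
- by rewrite o02 rmorph0.
- move=> i j ij; have -> : (i == o2) = false.
    apply/eqP=> io2; move: ij; rewrite io2 inordK //.
    by case: j => [[|[|[|]]]].
  by rewrite mul0r !mulr0.
- move=> i j ij; case: (eqVneq i o2) => io2.
    have -> : (j == o2) = false.
      by apply/negbTE; rewrite eq_sym -io2.
    by rewrite mulr0 mul0r mulr0.
  by rewrite rmorph0 mul0r !mulr0.
- by rewrite o02 o12 rmorph0 !mulr0 subrr.
- by rewrite eqxx o12 mul1r mulr1 subrr mulr0 mul0r mulr0 subrr.
- by rewrite eqxx o02 o12 !mul0r !add0r mul1r rmorph1.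
Qed.

Fact s4q_mulA : associative s4q_mul.
Proof.
elim/s4q_ind=> x; elim/s4q_ind=> y; elim/s4q_ind=> z; rewrite !s4qE.
by apply/to_s4qP; apply: s4_timesA.
Qed.
Fact s4q_mul1 : left_id (to_s4q s4_one) s4q_mul.
Proof.
by elim/s4q_ind=> x; rewrite !s4qE; apply/to_s4qP; apply: s4_times1l.
Qed.
Fact s4q_mulr1 : right_id (to_s4q s4_one) s4q_mul.
Proof.
by elim/s4q_ind=> x; rewrite !s4qE; apply/to_s4qP; apply: s4_times1r.
Qed.
Fact s4q_mulDl : left_distributive s4q_mul +%R.
Proof.
elim/s4q_ind=> x; elim/s4q_ind=> y; elim/s4q_ind=> z.
rewrite /+%R /= !s4qE.
by apply/to_s4qP; apply: s4_timesDl.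
Qed.
Fact s4q_mulDr : right_distributive s4q_mul +%R.
Proof.
elim/s4q_ind=> x; elim/s4q_ind=> y; elim/s4q_ind=> z.
rewrite /+%R /= !s4qE.
by apply/to_s4qP; apply: s4_timesDr.
Qed.
Fact s4q_one_neq0 : to_s4q s4_one != 0.
Proof.
by apply/eqP => /to_s4qP /s4_eval_eq /= /eqP; rewrite oner_eq0.
Qed.
HB.instance Definition _ := GRing.Zmodule_isNzRing.Build s4q
  s4q_mulA s4q_mul1 s4q_mulr1 s4q_mulDl s4q_mulDr s4q_one_neq0.

Fact s4q_scaleA (c d : C) x :
  s4q_scale c (s4q_scale d x) = s4q_scale (c * d) x.
Proof.
by elim/s4q_ind: x => x; rewrite !s4qE; apply/to_s4qP; apply: s4_scalA.
Qed.
Fact s4q_scale1 : left_id 1 s4q_scale.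
Proof.
by elim/s4q_ind=> x; rewrite !s4qE; apply/to_s4qP; apply: s4_scal1.
Qed.
Fact s4q_scaleDr : right_distributive s4q_scale +%R.
Proof.
move=> c; elim/s4q_ind=> x; elim/s4q_ind=> y.
rewrite /+%R /= !s4qE.
by apply/to_s4qP; apply: s4_scalDr.
Qed.
Fact s4q_scaleDl x : {morph s4q_scale^~ x : c d / c + d}.
Proof.
elim/s4q_ind: x => x c d; rewrite [RHS]/+%R /= !s4qE.
by apply/to_s4qP; apply: s4_scalDl.
Qed.
HB.instance Definition _ := GRing.Zmodule_isLmodule.Build C s4q
  s4q_scaleA s4q_scale1 s4q_scaleDr s4q_scaleDl.

Fact s4q_scaleAl (c : C) (x y : s4q) : c *: (x * y) = (c *: x) * y.
Proof.
elim/s4q_ind: x => x; elim/s4q_ind: y => y.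
rewrite /*:%R /*%R /= !s4qE.
by apply/to_s4qP; apply: s4_scalAl.
Qed.
HB.instance Definition _ := GRing.Lmodule_isLalgebra.Build C s4q s4q_scaleAl.

Fact s4q_scaleAr (c : C) (x y : s4q) : c *: (x * y) = x * (c *: y).
Proof.
elim/s4q_ind: x => x; elim/s4q_ind: y => y.
rewrite /*:%R /*%R /= !s4qE.
by apply/to_s4qP; apply: s4_scalAr.
Qed.
HB.instance Definition _ := GRing.Lalgebra_isAlgebra.Build C s4q s4q_scaleAr.

Fact s4q_starK : involutive s4q_star.
Proof.
by elim/s4q_ind=> x; rewrite !s4qE; apply/to_s4qP; apply: s4_starK.
Qed.
Fact s4q_starD (x y : s4q) : s4q_star (x + y) = s4q_star x + s4q_star y.
Proof.
elim/s4q_ind: x => x; elim/s4q_ind: y => y.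
rewrite /+%R /= !s4qE.
by apply/to_s4qP; apply: s4_starD.
Qed.
Fact s4q_starM (x y : s4q) : s4q_star (x * y) = s4q_star y * s4q_star x.
Proof.
elim/s4q_ind: x => x; elim/s4q_ind: y => y.
rewrite /*%R /= !s4qE.
by apply/to_s4qP; apply: s4_starM.
Qed.
Fact s4q_starZ (c : C) (x : s4q) :
  s4q_star (c *: x) = Num.conj c *: s4q_star x.
Proof.
elim/s4q_ind: x => x.
rewrite /*:%R /= !s4qE.
by apply/to_s4qP; apply: s4_starZ.
Qed.
HB.instance Definition _ := Algebra_hasStar.Build R s4q
  s4q_starK s4q_starD s4q_starM s4q_starZ.

Definition x0 : s4q := to_s4q (X o0).
Definition x1 : s4q := to_s4q (X o1).
Definition x2 : s4q := to_s4q (X o2).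

Definition s4_idem : 'M[s4q]_4 :=
  let r (n : nat) := (q ^+ n)%:C in
  let e : seq (seq s4q) := [::
    [:: 1 + x0; r 3 *: x2; - (r 1 *: x1); 0];
    [:: (r 3)^-1 *: star x2; 1 - r 2 *: x0; 0; r 3 *: x1];
    [:: - ((r 1)^-1 *: star x1); 0; 1 - r 2 *: x0; r 3 *: x2];
    [:: 0; r 1 *: star x1; (r 3)^-1 *: star x2; 1 + r 4 *: x0]] in
  \matrix_(i < 4, j < 4) ((2^-1 : C) *: nth 0 (nth [::] e i) j).

End QuantumSphere.

Section Coefficients.
Variables (R : realType) (q : R).

Definition qnum (z : R) : R := (q `^ z - q `^ (- z)) / (q - q^-1).
Local Notation "[ z ]_q" := (qnum z) (at level 0, format "[ z ]_q").
Local Notation sqrt := Num.sqrt.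
Local Notation h := (2^-1 : R).

Definition coefAp (j m1 : R) : R :=
  q `^ (m1 - 1) * sqrt ([j + m1 + 1]_q * [j - m1 + 1]_q) / [2 * j + 2]_q.
Definition coefA0 (j m1 : R) : R :=
  q `^ (-2) * (q `^ (j + m1 + 1) * [2]_q * [j - m1]_q - [2 * j]_q)
  / ([2 * j]_q * [2 * j + 2]_q).
Definition coefBp (j m1 : R) : R :=
  q `^ (- j + m1 - h) * sqrt ([j + m1 + 1]_q * [j + m1 + 2]_q)
  / [2 * j + 2]_q.
Definition coefB0 (j m1 : R) : R :=
  (1 + q ^+ 2) * q `^ (m1 - h) * sqrt ([j - m1]_q * [j + m1 + 1]_q)
  / ([2 * j]_q * [2 * j + 2]_q).
Definition coefBm (j m1 : R) : R :=
  - q `^ (j + m1 + h) * sqrt ([j - m1]_q * [j - m1 - 1]_q) / [2 * j]_q.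

(** The exponent is an integer for all the labels that occur. *)
Definition eps (l j m2 : R) : R := h * (-1) ^ Num.floor (l + h - j - m2).

Definition coefCp (l j m2 : R) : R := let e := eps l j m2 in
  - q `^ (m2 - 1 - e)
  * sqrt ([l + j + m2 + 3 + e]_q * [l + j - m2 + 3 - e]_q) / [2 * l + 4]_q.
Definition coefC0 (l j m2 : R) : R := let e := eps l j m2 in
  [4 * e]_q * q `^ (2 * e * l + m2 - 1 + 3 * e)
  * sqrt ([l + h + j - 2 * e * m2 + 2]_q * [l + h - j - 2 * e * m2]_q)
  / ([2 * l + 2]_q * [2 * l + 4]_q).
Definition coefCm (l j m2 : R) : R := let e := eps l j m2 in
  - q `^ (m2 - 1 + e)
  * sqrt ([l - j + m2 - e]_q * [l - j - m2 + e]_q) / [2 * l + 2]_q.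
Definition coefHp (l j m2 : R) : R := let e := eps l j m2 in
  q `^ (m2 - 1 + e * (2 * j + 1))
  * sqrt ([l + 2 * e * j - m2 + 2 + e]_q * [l - 2 * e * j + m2 + 2 - e]_q)
  / [2 * l + 4]_q.
Definition coefH0 (l j m2 : R) : R := let e := eps l j m2 in
  ([l - e * (2 * j + 1) - m2 + 1]_q * [l - e * (2 * j + 1) + m2 + 2]_q
   - q `^ (-2) * [l + e * (2 * j + 1) - m2 + 2]_q
               * [l + e * (2 * j + 1) + m2 + 1]_q)
  / ([2 * l + 2]_q * [2 * l + 4]_q).
Definition coefDp (l j m2 : R) : R := let e := eps l j m2 in
  q `^ (- l + m2 - 3 / 2)
  * sqrt ([l + j + m2 + 3 + e]_q * [l - j + m2 + 2 - e]_q) / [2 * l + 4]_q.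
Definition coefD0 (l j m2 : R) : R := let e := eps l j m2 in
  [2]_q * q `^ (m2 + h)
  * sqrt ([l - 2 * e * j - m2 + 1 - e]_q * [l - 2 * e * j + m2 + 2 - e]_q)
  / ([2 * l + 2]_q * [2 * l + 4]_q).
Definition coefDm (l j m2 : R) : R := let e := eps l j m2 in
  - q `^ (l + m2 + 3 / 2)
  * sqrt ([l - j - m2 + e]_q * [l + j - m2 + 1 - e]_q) / [2 * l + 2]_q.

End Coefficients.

Section SpinorRepresentation.
Variables (R : realType) (q : R).

Definition admissible (v : R * R * R * R) : bool :=
  let: (l, m1, m2, j) := v in
  [&& l - 2^-1 \is a Num.nat, j - 2^-1 \is a Num.nat, l - j \is a Num.nat,
      j - `|m1| \is a Num.nat & l + 2^-1 - j - `|m2| \is a Num.nat].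

Definition label := {v : R * R * R * R | admissible v}.
HB.instance Definition _ := Choice.on label.

(** The chirality: [true] for H_+, [false] for H_-. *)
Definition chi (s : bool) : R := if s then 1 else -1.

Variable H : hilbertType R.

(** The ket |l, m1, m2; j>_s, zero if the labels are not admissible; [b] is the
    orthonormal basis of H = H_+ (+) H_-. *)
Definition ket (b : bool * label -> H) (s : bool) (l m1 m2 j : R) : H :=
  if (insub (l, m1, m2, j) : option label) is Some v then b (s, v) else 0.

Variables (b : bool * label -> H) (pi : s4q q -> bop H).

Local Notation K := (ket b).
Local Notation Ap := (coefAp q).
Local Notation A0 := (coefA0 q).
Local Notation Bp := (coefBp q).
Local Notation B0 := (coefB0 q).
Local Notation Bm := (coefBm q).
Local Notation Cp := (coefCp q).
Local Notation C0 := (coefC0 q).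
Local Notation Cm := (coefCm q).
Local Notation Hp := (coefHp q).
Local Notation H0 := (coefH0 q).
Local Notation Dp := (coefDp q).
Local Notation D0 := (coefD0 q).
Local Notation Dm := (coefDm q).
Local Notation "a '**' v" := (a%:C *: v) (at level 40, left associativity).

Definition x0_action : Prop := forall s l m1 m2 j, admissible (l, m1, m2, j) ->
  pi (x0 q) (K s l m1 m2 j) =
    (Ap j m1 * Cp l j m2) ** K s (l + 1) m1 m2 (j + 1)
  + (- chi s * Ap j m1 * C0 l j m2) ** K s l m1 m2 (j + 1)
  + (Ap j m1 * Cm l j m2) ** K s (l - 1) m1 m2 (j + 1)
  + (A0 j m1 * Hp l j m2) ** K s (l + 1) m1 m2 j
  + (chi s * A0 j m1 * H0 l j m2) ** K s l m1 m2 j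
  + (A0 j m1 * Hp (l - 1) j m2) ** K s (l - 1) m1 m2 j
  + (Ap (j - 1) m1 * Cm (l + 1) (j - 1) m2) ** K s (l + 1) m1 m2 (j - 1)
  + (- chi s * Ap (j - 1) m1 * C0 l (j - 1) m2) ** K s l m1 m2 (j - 1)
  + (Ap (j - 1) m1 * Cp (l - 1) (j - 1) m2) ** K s (l - 1) m1 m2 (j - 1).

Definition x1_action : Prop := forall s l m1 m2 j, admissible (l, m1, m2, j) ->
  pi (x1 q) (K s l m1 m2 j) =
    (Bp j m1 * Cp l j m2) ** K s (l + 1) (m1 + 1) m2 (j + 1)
  + (- chi s * Bp j m1 * C0 l j m2) ** K s l (m1 + 1) m2 (j + 1)
  + (Bp j m1 * Cm l j m2) ** K s (l - 1) (m1 + 1) m2 (j + 1)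
  + (B0 j m1 * Hp l j m2) ** K s (l + 1) (m1 + 1) m2 j
  + (chi s * B0 j m1 * H0 l j m2) ** K s l (m1 + 1) m2 j
  + (B0 j m1 * Hp (l - 1) j m2) ** K s (l - 1) (m1 + 1) m2 j
  + (Bm j m1 * Cm (l + 1) (j - 1) m2) ** K s (l + 1) (m1 + 1) m2 (j - 1)
  + (- chi s * Bm j m1 * C0 l (j - 1) m2) ** K s l (m1 + 1) m2 (j - 1)
  + (Bm j m1 * Cp (l - 1) (j - 1) m2) ** K s (l - 1) (m1 + 1) m2 (j - 1).

Definition x2_action : Prop := forall s l m1 m2 j, admissible (l, m1, m2, j) ->
  pi (x2 q) (K s l m1 m2 j) =
    Dp l j m2 ** K s (l + 1) m1 (m2 + 1) j
  + (chi s * D0 l j m2) ** K s l m1 (m2 + 1) j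
  + Dm l j m2 ** K s (l - 1) m1 (m2 + 1) j.

Definition chiral_spinor_representation : Prop :=
  [/\ star_representation pi, x0_action, x1_action & x2_action].

End SpinorRepresentation.

(* Main.v *)
(** The generators move the labels [(l, m1, m2, j)] by at most one step, and F
    commutes with all their terms except those that carry the chirality sign;
    the coefficients of the latter are O(q^(2l)).  Since [w = q^(2l)] is summable
    over the labels and varies by a bounded factor between neighbouring labels,
    the operators T with |T b_i| <= C w_i form a left ideal that is stable under
    right multiplication by the image of the algebra, which gives [[F, a]] in it
    for all a.  Such an operator is compact, and it is of trace class because
    <b_i, |T| b_i> <= ||T| b_i| = |T b_i|.

    For the pairing, [phi a = Tr (gamma F [F, a]) = Tr (gamma (a - F a F))] is a
    trace on the algebra, so [e |-> 1/2 sum_k phi (e k k)] descends to K_0.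
    Finally phi(1) = 0 and phi(x_0) = 4 sum A^0_{j,m1} H^0_{l,j,m2}.  The sums over
    m1 and over m2 telescope in j and in l respectively, and each of the two
    resulting series has absolute value 1 / (1 - q^2), so that phi(x_0) =
    4 / (1 - q^2)^2 and ch([e]) = (1 - 2 q^2 + q^4) / 4 * phi(x_0) = 1. *)

Require Import Defs.
From mathcomp Require Import all_boot all_order all_algebra.
From mathcomp Require Import all_classical all_reals all_analysis.
From mathcomp Require Import complex ring lra zify finmap.
From mathcomp Require summability.
Import Order.TTheory GRing.Theory Num.Theory.
Import numFieldNormedType.Exports.
Set Implicit Arguments.
Unset Strict Implicit.
Unset Printing Implicit Defensive.
Local Open Scope classical_set_scope.
Local Open Scope ring_scope.
Local Open Scope complex_scope.

(** * Hilbert spaces and bounded operators *)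

(** The formulas prescribe [pi] only on the x_i, so everything about their stars is drawn from
    adjointness. Smallness only controls the images of basis vectors; passing to adjoints or
    multiplying on the right is possible because the matrices involved are supported in
    neighbourhoods of bounded size. This is checked for [F] and the generators, and then replaced by
    [traceable], which survives products. As trace class refers to an absolute value, |T| is
    constructed first, by an iteration for the square root. The rate q^(2l) is a joint effect for
    some terms: H^0 is only estimated by q^(2l - 2j), and A^0 and B^0 supply the factor q^(2j),
    whereas C^0 decays like q^(2l) on its own. In the double series the sum over m2 depends on j,
    but its primitive [qU a] equals 1 at l = j whatever j is. So for each j the sum over l tends to
    -1/(1 - q^2), which is why the limit is a product. The bound on [qU a] is not uniform in j,
    hence the cut-off in j is fixed before the cut-off in l - j. *)

Section HilbertBasics.
Variables (R : realType) (H : hilbertType R).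
Implicit Types (x y z : H) (a c : R[i]).

(** The norm takes values in [R[i]]. Its real part carries the same information and puts all
    estimates in the ordered field [R], within reach of [lra] and [nra]. *)
Definition nrm (V : normedZmodType R[i]) (x : V) : R := complex.Re `|x|.

Lemma nrmE (V : normedZmodType R[i]) (x : V) : (nrm x)%:C = `|x|.
Proof. by rewrite /nrm RRe_real // ger0_real. Qed.

Lemma nrm_ge0 (V : normedZmodType R[i]) (x : V) : 0 <= nrm x.
Proof. by rewrite -ler0c nrmE. Qed.

Lemma nrm0 (V : normedZmodType R[i]) : nrm (0 : V) = 0.
Proof. by rewrite /nrm normr0. Qed.

Lemma nrm0P (V : normedZmodType R[i]) (x : V) : nrm x = 0 -> x = 0.
Proof. by move=> x0; apply: normr0_eq0; rewrite -nrmE x0. Qed.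

Lemma nrmN (V : normedZmodType R[i]) (x : V) : nrm (- x) = nrm x.
Proof. by rewrite /nrm normrN. Qed.

Lemma nrmD (V : normedZmodType R[i]) (x y : V) : nrm (x + y) <= nrm x + nrm y.
Proof. by rewrite -lecR rmorphD /= !nrmE ler_normD. Qed.

Lemma nrmB (V : normedZmodType R[i]) (x y : V) : nrm (x - y) <= nrm x + nrm y.
Proof. by rewrite -(nrmN y) nrmD. Qed.

Lemma nrm_sum (V : normedZmodType R[i]) I (s : seq I) (P : pred I) (f : I -> V) :
  nrm (\sum_(i <- s | P i) f i) <= \sum_(i <- s | P i) nrm (f i).
Proof.
elim/big_rec2 : _ => [|i x y _ h]; first by rewrite nrm0.
by apply: le_trans (nrmD _ _) _; rewrite lerD2l.
Qed.

Lemma nrmM a c : nrm (a * c) = nrm a * nrm c.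
Proof. by apply: complexI; rewrite rmorphM /= !nrmE normrM. Qed.

Lemma nrmZ a x : nrm (a *: x) = nrm a * nrm x.
Proof. by apply: complexI; rewrite rmorphM /= !nrmE normrZ. Qed.

Lemma nrmR (r : R) : nrm (r%:C : R[i]) = `|r|.
Proof. by rewrite /nrm normc_def /= expr0n addr0 sqrtr_sqr. Qed.

Lemma nrm_conj a : nrm (Num.conj a) = nrm a.
Proof. by rewrite /nrm norm_conjC. Qed.

Lemma conjR (r : R) : Num.conj (r%:C : R[i]) = r%:C.
Proof. by rewrite conj_Creal //; apply/complex_realP; exists r. Qed.

Lemma Re_le_nrm a : complex.Re a <= nrm a.
Proof.
apply: le_trans (ler_norm _) _; rewrite /nrm normc_def /= -sqrtr_sqr.
by apply: ler_wsqrtr; rewrite lerDl sqr_ge0.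
Qed.

Lemma dot0r x : dot x 0 = 0.
Proof. by have := dotZr 0 x 0; rewrite scale0r mul0r. Qed.
Lemma dotNr x y : dot x (- y) = - dot x y.
Proof. by rewrite -scaleN1r dotZr mulN1r. Qed.
Lemma dotBr x y z : dot x (y - z) = dot x y - dot x z.
Proof. by rewrite dotDr dotNr. Qed.
Lemma dotDl x y z : dot (x + y) z = dot x z + dot y z.
Proof. by rewrite dot_conj dotDr rmorphD /= -!dot_conj. Qed.
Lemma dotZl a x y : dot (a *: x) y = Num.conj a * dot x y.
Proof. by rewrite dot_conj dotZr rmorphM /= -dot_conj. Qed.
Lemma dotBl x y z : dot (x - y) z = dot x z - dot y z.
Proof. by rewrite dot_conj dotBr rmorphB /= -!dot_conj. Qed.
Lemma dot_sumr I (s : seq I) (P : pred I) (f : I -> H) x :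
  dot x (\sum_(i <- s | P i) f i) = \sum_(i <- s | P i) dot x (f i).
Proof. by elim/big_rec2 : _ => [|i y z _ <-]; rewrite ?dot0r ?dotDr. Qed.

Lemma dot_nrm x : dot x x = (nrm x ^+ 2)%:C.
Proof. by rewrite rmorphXn /= nrmE dot_norm. Qed.

(** Cauchy-Schwarz: with n = |y| and d = <y, x>, the vector n^2 x - d y has squared norm n^2 (n^2
    |x|^2 - |d|^2). The factor n^2, in place of a normalised y, keeps the computation polynomial. *)
Lemma dot_le x y : nrm (dot x y) <= nrm x * nrm y.
Proof.
have [/nrm0P->|y0] := eqVneq (nrm y) 0; first by rewrite dot0r !nrm0 mulr0.
have yp : 0 < nrm y by rewrite lt_def y0 nrm_ge0.
set n := nrm y in y0 yp *.
pose d := dot y x.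
have := dot_nrm (n%:C ^+ 2 *: x - d *: y).
rewrite dotBr !dotBl !dotZr !dotZl -/d (dot_conj y x) -/d !dot_nrm -/n.
have -> : Num.conj (n%:C ^+ 2 : R[i]) = n%:C ^+ 2.
  by rewrite rmorphXn /= conjR.
have E : Num.conj d * d = (nrm d ^+ 2)%:C.
  by rewrite rmorphXn /= nrmE normCKC.
move=> K.
have : ((n ^+ 4 * nrm x ^+ 2 - n ^+ 2 * nrm d ^+ 2)%:C : R[i]) =
  (nrm (n%:C ^+ 2 *: x - d *: y) ^+ 2)%:C.
  rewrite -K; move: (nrm d ^+ 2) (nrm x ^+ 2) E => D X E.
  rewrite rmorphB !rmorphM /= -E; ring.
move=> /complexI EE.
have : 0 <= n ^+ 2 * ((n * nrm x) ^+ 2 - nrm d ^+ 2).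
  have -> : n ^+ 2 * ((n * nrm x) ^+ 2 - nrm d ^+ 2) = 
    n ^+ 4 * nrm x ^+ 2 - n ^+ 2 * nrm d ^+ 2 by ring.
  by rewrite EE sqr_ge0.
rewrite pmulr_rge0 ?exprn_gt0 // subr_ge0 ler_sqr ?nnegrE ?mulr_ge0 ?nrm_ge0 //.
by rewrite /d (dot_conj x y) !nrm_conj mulrC.
Qed.

End HilbertBasics.

Section Operators.
Variables (R : realType) (H : hilbertType R).
Implicit Types (S T U : bop H) (x y : H).

Lemma bopZ T a x : T (a *: x) = a *: T x.
Proof.
by rewrite -[a *: x]addr0 bop_linear bop_fun0 addr0.
Qed.
Lemma bopN T x : T (- x) = - T x.
Proof. by rewrite -scaleN1r bopZ scaleN1r. Qed.
Lemma bopB T x y : T (x - y) = T x - T y.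
Proof. by rewrite bop_funD bopN. Qed.
Lemma bop_sum T I (s : seq I) (P : pred I) (f : I -> H) :
  T (\sum_(i <- s | P i) f i) = \sum_(i <- s | P i) T (f i).
Proof. by elim/big_rec2 : _ => [|i y z _ <-]; rewrite ?bop_fun0 ?bop_funD. Qed.

Lemma bop_addE S T x : (S + T) x = S x + T x. Proof. by []. Qed.
Lemma bop_oppE T x : (- T) x = - T x. Proof. exact: scaleN1r. Qed.
Lemma bop_subE S T x : (S - T) x = S x - T x.
Proof. by rewrite bop_addE bop_oppE. Qed.
Lemma bop_mulE S T x : (S * T) x = S (T x). Proof. by []. Qed.
Lemma bop_scaleE a T x : (a *: T) x = a *: T x. Proof. by []. Qed.
Lemma bop_oneE x : (1 : bop H) x = x. Proof. by []. Qed.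
Lemma bop_zeroE x : (0 : bop H) x = 0. Proof. by []. Qed.

Lemma bop_bnd T : exists M : R, 0 < M /\ forall x, nrm (T x) <= M * nrm x.
Proof.
have [M [M0 h]] := bop_bound_ge0 T; exists (M + 1).
split=> [|x]; first by rewrite ltr_wpDl.
have := h x; rewrite -!nrmE -rmorphM /= lecR => /le_trans; apply.
by rewrite ler_wpM2r ?nrm_ge0 // lerDl.
Qed.

Lemma adjoint_sym S T : adjoint S T -> adjoint T S.
Proof. by move=> h x y; rewrite dot_conj -h -dot_conj. Qed.

Lemma adjointB S S' T T' : adjoint S S' -> adjoint T T' ->
  adjoint (S - T) (S' - T').
Proof. by move=> h k x y; rewrite !bop_subE dotBl dotBr h k. Qed.
Lemma adjointM S S' T T' : adjoint S S' -> adjoint T T' ->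
  adjoint (S * T) (T' * S').
Proof. by move=> h k x y; rewrite !bop_mulE h k. Qed.

Lemma adjoint_uniq T S S' : adjoint T S -> adjoint T S' -> S = S'.
Proof.
move=> h k; apply: bopP => y; apply/eqP; rewrite -subr_eq0; apply/eqP.
apply: nrm0P; apply/eqP; rewrite -(sqrf_eq0 (nrm _)); apply/eqP; apply: complexI.
by rewrite -dot_nrm dotBr -h -k subrr.
Qed.

End Operators.

(** * Square roots and absolute values of operators *)

Section Completeness.
Variables (R : realType) (H : hilbertType R).

Lemma complex_gt0P (e : R[i]) : 0 < e -> exists2 r : R, 0 < r & e = r%:C.
Proof.
move=> e0; have /complex_realP[r er] : e \is Num.real by rewrite gtr0_real.
by exists r => //; move: e0; rewrite er ltcR.
Qed.

Lemma ball_nrm (x y : H) (r : R) : nrm (x - y) < r -> ball x r%:C y.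
Proof. by move=> h; rewrite -ball_normE /ball_ /= -nrmE ltcR. Qed.

Lemma cvg_nrmP (T : Type) (G : set_system T) (GF : Filter G) (f : T -> H) (l : H) :
  f @ G --> l <-> forall e : R, 0 < e -> G [set a | nrm (l - f a) <= e].
Proof.
split=> [Fl e e0|h].
  have /cvgrPdist_le/(_ e%:C) := Fl; rewrite ltcR => /(_ e0) K.
  by apply: filterS K => y /=; rewrite -nrmE lecR.
apply/cvgrPdist_le => e /complex_gt0P[r r0 ->].
by apply: filterS (h r r0) => y /=; rewrite -nrmE lecR.
Qed.

(** Completeness along an arbitrary proper filter, since it is applied to a sequence, to the finite
    subsets of an index type and to an ultrafilter. *)
Lemma complete_nrm (T : Type) (G : set_system T) (GF : ProperFilter G) (f : T -> H) :
  (forall e : R, 0 < e -> exists x : H, G [set a | nrm (x - f a) <= e]) ->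
  exists l, forall e : R, 0 < e -> G [set a | nrm (l - f a) <= e].
Proof.
move=> h; have : cauchy (f @ G).
  apply: cauchy_exP => e /complex_gt0P[r r0 ->].
  have r2 : 0 < r / 2 by rewrite divr_gt0.
  have [x Gx] := h _ r2.
  exists x; apply: (@filterS _ G _ _ _ _ Gx) => a /= xa; apply: ball_nrm.
  by apply: le_lt_trans xa _; lra.
move=> /cauchy_cvgP fc; move: fc => /cvg_ex[l hl].
by exists l; apply/cvg_nrmP.
Qed.

End Completeness.

Section AbsoluteValue.
Variables (R : realType) (H : hilbertType R).

Section Iteration.
Variable A : bop H.
Hypothesis A_sa : self_adjoint A.
Hypothesis A_le1 : forall x, nrm (A x) <= nrm x.

(* The iteration [y <- (A + y^2) / 2] converges to [1 - (1 - A)^(1/2)]; its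
   steps are dominated by those of the scalar iteration started at [A = 1]. *)
Fixpoint sqiter (n : nat) : bop H :=
  if n is m.+1 then 2^-1 *: (A + sqiter m * sqiter m) else 0.

Fixpoint sqbnd (n : nat) : R :=
  if n is m.+1 then (1 + sqbnd m ^+ 2) / 2 else 0.

Lemma sqiterS n x :
  sqiter n.+1 x = 2^-1 *: (A x + sqiter n (sqiter n x)).
Proof. by []. Qed.
Lemma sqiter0 x : sqiter 0 x = 0. Proof. by []. Qed.

Lemma sqbnd_itv n : 0 <= sqbnd n <= 1.
Proof.
elim: n => [|n /andP[h0 h1]] /=; first by rewrite lexx ler01.
by apply/andP; split; nra.
Qed.

Lemma sqbnd_le n : sqbnd n <= sqbnd n.+1.
Proof. by have /andP[h0 h1] := sqbnd_itv n; rewrite /=; nra. Qed.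

Lemma nrm_half : nrm (2^-1 : R[i]) = 2^-1 :> R.
Proof.
have -> : (2^-1 : R[i]) = (2^-1 : R)%:C by rewrite fmorphV /= rmorph_nat.
by rewrite nrmR ger0_norm // invr_ge0.
Qed.

Lemma sqiter_le n x : nrm (sqiter n x) <= sqbnd n * nrm x.
Proof.
elim: n x => [|n IH] x; first by rewrite sqiter0 nrm0 mul0r.
rewrite sqiterS nrmZ nrm_half /=.
have := nrmD (A x) (sqiter n (sqiter n x)).
have := A_le1 x; have := IH (sqiter n x); have := IH x.
have /andP[h0 h1] := sqbnd_itv n; have := nrm_ge0 x.
move=> b0 c1 d1 a1 e1.
have : sqbnd n * nrm (sqiter n x) <= sqbnd n * (sqbnd n * nrm x).
  by rewrite ler_wpM2l.
by move=> K; lra.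
Qed.

Lemma sqiter_step n x :
  nrm (sqiter n.+1 x - sqiter n x) <= (sqbnd n.+1 - sqbnd n) * nrm x.
Proof.
elim: n x => [|n IH] x.
  rewrite sqiterS !sqiter0 subr0 addr0 nrmZ nrm_half /=.
  by have := A_le1 x; lra.
set y := sqiter n.+1; set z := sqiter n.
(* The identity y^2 - z^2 = (y - z) y + z (y - z) holds without commutation, and s^2 - r^2 = (s - r)
   s + r (s - r) is its scalar counterpart. *)
have -> : sqiter n.+2 x - y x =
    2^-1 *: ((y (y x) - z (y x)) + z (y x - z x)).
  rewrite sqiterS /y [in X in _ - X]sqiterS -/y -/z -scalerBr.
  by congr (_ *: _); rewrite bopB addrA subrK opprD addrACA subrr add0r.
rewrite nrmZ nrm_half.
have := nrmD (y (y x) - z (y x)) (z (y x - z x)).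
have := IH (y x); have := IH x; rewrite -/y -/z.
have := sqiter_le n (y x - z x); rewrite -/z; have := sqiter_le n.+1 x; rewrite -/y.
have /andP[h0 h1] := sqbnd_itv n; have /andP[k0 k1] := sqbnd_itv n.+1.
have t := sqbnd_le n; have := nrm_ge0 x.
have -> : sqbnd n.+2 = (1 + sqbnd n.+1 ^+ 2) / 2 by [].
have -> : (1 + sqbnd n.+1 ^+ 2) / 2 - sqbnd n.+1 =
    (sqbnd n.+1 ^+ 2 - sqbnd n ^+ 2) / 2 by rewrite {2}/sqbnd -/sqbnd; lra.
clear IH; move: (sqbnd n.+1) (sqbnd n) h0 h1 k0 k1 t => s r h0 h1 k0 k1 t.
move=> a0 b1 d1 c1 e1 f1.
have : (s - r) * nrm (y x) <= (s - r) * (s * nrm x).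
  by rewrite ler_wpM2l ?subr_ge0.
have : r * nrm (y x - z x) <= r * ((s - r) * nrm x) by rewrite ler_wpM2l.
by move=> K1 K2; lra.
Qed.

Lemma sqiter_dist m n x : (m <= n)%N ->
  nrm (sqiter n x - sqiter m x) <= (sqbnd n - sqbnd m) * nrm x.
Proof.
elim: n => [|n IH]; first by rewrite leqn0 => /eqP->; rewrite !subrr nrm0 mul0r.
rewrite leq_eqVlt => /orP[/eqP->|]; first by rewrite !subrr nrm0 mul0r.
rewrite ltnS => /IH h; have := sqiter_step n x.
have := nrmD (sqiter n.+1 x - sqiter n x) (sqiter n x - sqiter m x).
rewrite addrA subrK; move: h; move: (sqiter n.+1 x) (sqbnd n.+1) => u v.
by lra.
Qed.

(** N is chosen with [sqbnd N] within e of the supremum of the sequence, which exists because 1 is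
    an upper bound. *)
Lemma sqbnd_cauchy (e : R) : 0 < e ->
  exists N, forall n, (N <= n)%N -> sqbnd n - sqbnd N <= e.
Proof.
move=> e0; have [N _ hN] : exists2 N, True & sup (range sqbnd) - e < sqbnd N.
  have hs : has_sup (range sqbnd).
    split; first by exists (sqbnd 0); exists 0%N.
    by exists 1 => _ [n _ <-]; have /andP[] := sqbnd_itv n.
  by have [_ [N _ <-] h] := sup_adherent e0 hs; exists N.
exists N => n _; have : sqbnd n <= sup (range sqbnd).
  apply: ub_le_sup; last by exists n.
  by exists 1 => _ [k _ <-]; have /andP[] := sqbnd_itv k.
by move: (sqbnd N) hN => r; lra.
Qed.

Lemma sqiter_lim x : exists l : H, forall e : R, 0 < e ->
  exists N, forall n, (N <= n)%N -> nrm (l - sqiter n x) <= e.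
Proof.
have [l hl] : exists l, forall e : R, 0 < e ->
    \oo [set n | nrm (l - sqiter n x) <= e].
  apply: complete_nrm => e e0.
  have x1 : 0 < nrm x + 1 by rewrite ltr_wpDl ?nrm_ge0.
  have [N hN] := sqbnd_cauchy (divr_gt0 e0 x1).
  exists (sqiter N x); exists N => // n /= Nn.
  rewrite -nrmN opprB; apply: le_trans (sqiter_dist x Nn) _.
  apply: (@le_trans _ _ (e / (nrm x + 1) * nrm x)).
    by rewrite ler_wpM2r ?nrm_ge0 // hN.
  rewrite mulrAC ler_pdivrMr // ler_wpM2l ?(ltW e0) // lerDl //.
by exists l => e /hl[N _ hN]; exists N.
Qed.

Definition sqlim_fun x : H := projT1 (cid (sqiter_lim x)).

Lemma sqlim_near x (e : R) : 0 < e ->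
  exists N, forall n, (N <= n)%N -> nrm (sqlim_fun x - sqiter n x) <= e.
Proof. by rewrite /sqlim_fun; case: cid => l hl /= /hl. Qed.

Lemma le_of_eps (a c : R) : (forall e, 0 < e -> a <= c + e) -> a <= c.
Proof. by move=> h; apply/ler_addgt0Pr. Qed.

Lemma sqlim_linear : linear sqlim_fun.
Proof.
move=> a x y; apply/eqP; rewrite -subr_eq0; apply/eqP; apply: nrm0P.
apply: le_anti; rewrite nrm_ge0 andbT; apply: le_of_eps => e e0; rewrite add0r.
pose d := e / (nrm a + 2).
have a2 : 0 < nrm a + 2 by rewrite ltr_wpDl ?nrm_ge0.
have d0 : 0 < d by rewrite divr_gt0.
have [N1 h1] := sqlim_near (a *: x + y) d0.
have [N2 h2] := sqlim_near x d0.
have [N3 h3] := sqlim_near y d0.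
pose n := maxn N1 (maxn N2 N3).
have {}h1 := h1 n (leq_maxl _ _).
have {}h2 := h2 n (leq_trans (leq_maxl _ _) (leq_maxr _ _)).
have {}h3 := h3 n (leq_trans (leq_maxr _ _) (leq_maxr _ _)).
have -> : sqlim_fun (a *: x + y) - (a *: sqlim_fun x + sqlim_fun y) =
  (sqlim_fun (a *: x + y) - sqiter n (a *: x + y)) -
  (a *: (sqlim_fun x - sqiter n x) + (sqlim_fun y - sqiter n y)).
  by rewrite bop_linear scalerBr [_ - _ + (_ - _)]addrACA -opprD opprB addrA subrK.
apply: le_trans (nrmB _ _) _.
apply: le_trans (lerD h1 (nrmD _ _)) _.
rewrite nrmZ; have : nrm a * nrm (sqlim_fun x - sqiter n x) <= nrm a * d.
  by rewrite ler_wpM2l ?nrm_ge0.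
have : e = d * (nrm a + 2) by rewrite /d divfK // gt_eqF.
by move: h3; lra.
Qed.

Lemma sqlim_le x : nrm (sqlim_fun x) <= nrm x.
Proof.
apply: le_of_eps => e /(sqlim_near x)[N /(_ N (leqnn _)) h].
rewrite -[sqlim_fun x](subrK (sqiter N x)); apply: le_trans (nrmD _ _) _.
have := sqiter_le N x; have /andP[h0 h1] := sqbnd_itv N; have := nrm_ge0 x.
move: (sqbnd N) h0 h1 => b b0 b1 x0 K.
have : b * nrm x <= 1 * nrm x by rewrite ler_wpM2r.
by lra.
Qed.

Lemma sqlim_bounded : exists M : R, forall x, `|sqlim_fun x| <= M%:C * `|x|.
Proof.
by exists 1 => x; rewrite -!nrmE -rmorphM /= lecR mul1r sqlim_le.
Qed.

Definition sqlim : bop H := Bop sqlim_linear sqlim_bounded.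

Lemma sqiter_sa n : self_adjoint (sqiter n).
Proof.
elim: n => [|n IH] x y; first by rewrite !sqiter0 dot0r dot_conj dot0r rmorph0.
rewrite !sqiterS dotZl dotZr dotDl dotDr A_sa !IH.
by rewrite fmorphV /= rmorph_nat.
Qed.

Lemma sqlim_sa : self_adjoint sqlim.
Proof.
move=> x y; apply/eqP; rewrite -subr_eq0; apply/eqP; apply: nrm0P.
apply: le_anti; rewrite nrm_ge0 andbT; apply: le_of_eps => e e0; rewrite add0r.
pose d := e / (nrm x + nrm y + 1).
have a2 : 0 < nrm x + nrm y + 1 by rewrite ltr_wpDl ?addr_ge0 ?nrm_ge0.
have d0 : 0 < d by rewrite divr_gt0.
have [N1 h1] := sqlim_near x d0.
have [N2 h2] := sqlim_near y d0.
pose n := maxn N1 N2.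
have {}h1 := h1 n (leq_maxl _ _).
have {}h2 := h2 n (leq_maxr _ _).
have -> : dot (sqlim x) y - dot x (sqlim y) =
  dot (sqlim x - sqiter n x) y - dot x (sqlim y - sqiter n y).
  by rewrite dotBl dotBr sqiter_sa opprB addrA subrK.
apply: le_trans (nrmB _ _) _.
have := dot_le (sqlim x - sqiter n x) y.
have := dot_le x (sqlim y - sqiter n y).
have -> : e = d * (nrm x + nrm y + 1) by rewrite /d divfK // gt_eqF.
have : nrm (sqlim x - sqiter n x) * nrm y <= d * nrm y.
  by rewrite ler_wpM2r ?nrm_ge0.
have : nrm x * nrm (sqlim y - sqiter n y) <= nrm x * d.
  by rewrite ler_wpM2l ?nrm_ge0.
by move=> K1 K2 K3 K4; move: (ltW d0); lra.
Qed.

(** Equivalently (1 - Y)^2 = 1 - A for the limit Y. It is read off from one step of the iteration,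
    with three errors of size e/4, the first of them doubled. *)
Lemma sqlim_eq : 2 *: sqlim = A + sqlim * sqlim.
Proof.
apply: bopP => x; apply/eqP; rewrite -subr_eq0; apply/eqP; apply: nrm0P.
apply: le_anti; rewrite nrm_ge0 andbT; apply: le_of_eps => e e0; rewrite add0r.
have d0 : 0 < e / 4 by rewrite divr_gt0.
have [N1 h1] := sqlim_near x d0.
have [N2 h2] := sqlim_near (sqlim x) d0.
pose n := maxn N1 N2.
have {}h1' := h1 n.+1 (leqW (leq_maxl _ _)).
have {}h1 := h1 n (leq_maxl _ _).
have {}h2 := h2 n (leq_maxr _ _).
have E : 2 *: sqiter n.+1 x = A x + sqiter n (sqiter n x).
  by rewrite sqiterS scalerA divff ?pnatr_eq0 // scale1r.
have -> : (2 *: sqlim) x - (A + sqlim * sqlim) x =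
  2 *: (sqlim x - sqiter n.+1 x) - (sqlim (sqlim x) - sqiter n (sqlim x))
   - sqiter n (sqlim x - sqiter n x).
  rewrite scalerBr E bopB bop_scaleE bop_addE bop_mulE.
  by rewrite -[RHS]addrA -opprD [_ - _ + (_ - _)]addrA subrK opprB !opprD -!addrA addKr.
apply: le_trans (nrmB _ _) _; apply: le_trans (lerD (nrmB _ _) (lexx _)) _.
rewrite nrmZ.
have -> : nrm (2 : R[i]) = 2 by rewrite -(rmorph_nat (real_complex R)) nrmR ger0_norm.
have := sqiter_le n (sqlim x - sqiter n x).
have /andP[b0 b1] := sqbnd_itv n.
move: (sqbnd n) b0 b1 => b b0 b1.
have : b * nrm (sqlim x - sqiter n x) <= 1 * nrm (sqlim x - sqiter n x).
  by rewrite ler_wpM2r ?nrm_ge0.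
by move: h1 h1' h2; rewrite /=; lra.
Qed.

End Iteration.
End AbsoluteValue.

Section AbsOp.
Variables (R : realType) (H : hilbertType R).

Lemma sqr_nrm_subZ (x y : H) (k s : R) : dot x y = s%:C ->
  nrm (x - k%:C *: y) ^+ 2 = nrm x ^+ 2 - 2 * k * s + k ^+ 2 * nrm y ^+ 2.
Proof.
move=> xy; have yx : dot y x = s%:C by rewrite dot_conj xy conjR.
apply: complexI; rewrite -dot_nrm dotBr !dotBl !dotZr !dotZl !dot_nrm xy yx conjR.
rewrite -!rmorphM -!rmorphB /=; congr (_%:C); ring.
Qed.

(** If M bounds T', then A = 1 - M^(-2) T'T satisfies |Ax|^2 <= |x|^2 - M^(-2) |Tx|^2, so the
    iteration applies to A, and P = M (1 - Y) squares to M^2 (1 - A) = T'T. Positivity of P is <x,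
    Yx> <= |x|^2 for the self-adjoint contraction Y. The equality |Px| = |Tx| later turns bounds on
    T into bounds on the trace of |T|. *)
Lemma abs_op_exists (T T' : bop H) : adjoint T T' ->
  exists2 P, is_abs_op T P & forall x, nrm (P x) = nrm (T x).
Proof.
move=> adj; have [M [M0 hM]] := bop_bnd T'.
pose A : bop H := 1 - ((M ^+ 2)^-1)%:C *: (T' * T).
have TT x : dot x (T' (T x)) = (nrm (T x) ^+ 2)%:C by rewrite -adj dot_nrm.
have AE x : A x = x - ((M ^+ 2)^-1)%:C *: T' (T x).
  by rewrite bop_subE bop_oneE bop_scaleE.
have A1 x : nrm (A x) <= nrm x.
  rewrite -ler_sqr ?nnegrE ?nrm_ge0 // AE (sqr_nrm_subZ _ (TT x)).
  have /(ler_pM (nrm_ge0 _) (nrm_ge0 _) (hM (T x))) := hM (T x).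
  rewrite -expr2; set k := M ^+ 2; have k0 : 0 < k by rewrite exprn_gt0.
  have -> : M * nrm (T x) * (M * nrm (T x)) = k * nrm (T x) ^+ 2.
    by rewrite /k; ring.
  move=> h; have : k^-1 ^+ 2 * nrm (T' (T x)) ^+ 2 <= k^-1 * nrm (T x) ^+ 2.
    rewrite expr2 -mulrA ler_wpM2l ?invr_ge0 ?(ltW k0) //.
    by rewrite ler_pdivrMl.
  have : 0 <= k^-1 * nrm (T x) ^+ 2.
    by rewrite mulr_ge0 ?invr_ge0 ?(ltW k0) ?sqr_ge0.
  by move=> h1 h2; lra.
have Asa : self_adjoint A.
  move=> x y; rewrite !AE dotBl dotBr dotZl dotZr conjR -adj.
  by rewrite -(adjoint_sym adj).
pose Y := sqlim A1.
pose P : bop H := M%:C *: (1 - Y).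
have PE z : P z = M%:C *: (z - Y z).
  by rewrite bop_scaleE bop_subE bop_oneE.
have PP : P * P = T' * T.
  apply: bopP => x; have := congr1 (fun S : bop H => S x) (sqlim_eq A1).
  rewrite -/Y !bop_scaleE bop_addE !bop_mulE AE => E.
  rewrite -/P !PE bopZ -scalerBr bopB scalerA.
  have -> : x - Y x - (Y x - Y (Y x)) = ((M ^+ 2)^-1)%:C *: T' (T x).
    transitivity (x + Y (Y x) - 2 *: Y x).
      by rewrite scaler_nat mulr2n opprB opprD addrACA.
    by rewrite E opprD opprB addrC -[_ - x - _]addrA -opprD subrK.
  by rewrite scalerA -!rmorphM -expr2 divff ?scale1r // expf_neq0 // gt_eqF.
have Psa : self_adjoint P.
  move=> x y; rewrite !bop_scaleE !bop_subE !bop_oneE dotZl dotZr conjR.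
  by rewrite dotBl dotBr (sqlim_sa Asa A1).
exists P.
  split; last by exists T'.
  move=> x; rewrite bop_scaleE bop_subE bop_oneE dotZr dotBr dot_nrm.
  rewrite mulr_ge0 ?ler0c ?(ltW M0) //.
  have : dot x (Y x) \is Num.real.
    by apply/CrealP; rewrite -dot_conj (sqlim_sa Asa A1).
  move/complex_realP => [r rE]; rewrite rE -rmorphB ler0c subr_ge0.
  have := Re_le_nrm (dot x (Y x)); rewrite rE /= -rE => /le_trans; apply.
  apply: le_trans (dot_le _ _) _; rewrite expr2 ler_wpM2l ?nrm_ge0 //.
  exact: sqlim_le.
move=> x; apply/eqP; rewrite -(eqrXn2 (_ : 0 < 2)%N) ?nrm_ge0 //; apply/eqP.
by apply: complexI; rewrite -!dot_nrm Psa -bop_mulE PP adj.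
Qed.

End AbsOp.

(** * Orthonormal bases and weighted smallness *)

Section Basis.
Variables (R : realType) (H : hilbertType R) (I : choiceType) (b : I -> H).
Hypothesis hb : orthonormal_basis b.
Implicit Types (S T U : bop H) (s : seq I) (i j k : I).

Lemma basis_dot i j : dot (b i) (b j) = (i == j)%:R.
Proof. by have [h _] := hb. Qed.

Lemma nrm_basis i : nrm (b i) = 1.
Proof.
apply/eqP; rewrite -(eqrXn2 (_ : 0 < 2)%N) ?nrm_ge0 //; apply/eqP.
by apply: complexI; rewrite -dot_nrm basis_dot eqxx expr1n.
Qed.

Lemma dot_basis_sum s (c : I -> R[i]) k : uniq s ->
  dot (b k) (\sum_(i <- s) c i *: b i) = if k \in s then c k else 0.
Proof.
move=> us; rewrite dot_sumr.
under eq_bigr do rewrite dotZr basis_dot.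
case: ifP => ks; last first.
  rewrite big_seq big1 // => i si; case: eqP => [ki|]; last by rewrite mulr0.
  by rewrite ki si in ks.
rewrite (bigD1_seq k) //= eqxx mulr1 big1 ?addr0 // => i ik.
by rewrite eq_sym (negbTE ik) mulr0.
Qed.

Lemma dot_basis_out s (c : I -> R[i]) k : k \notin s ->
  dot (b k) (\sum_(i <- s) c i *: b i) = 0.
Proof.
move=> ks; rewrite dot_sumr big_seq big1 // => i si.
by rewrite dotZr basis_dot; case: eqP => [ki|]; rewrite ?mulr0 //; rewrite ki si in ks.
Qed.

Lemma basis_dense x (e : R) : 0 < e ->
  exists (s : seq I) (c : I -> R[i]), nrm (x - \sum_(i <- s) c i *: b i) <= e.
Proof.
move=> e0; have [_ cl] := hb.
have : closure [set x | exists (s : seq I) (c : I -> R[i]),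
                     x = \sum_(i <- s) c i *: b i] x by rewrite cl.
move=> /(_ (ball x e%:C)) [|y [[s [c ->]] hy]].
  by apply: nbhsx_ballx; rewrite ltcR.
exists s, c; move: hy; rewrite -ball_normE /ball_ /= -nrmE ltcR.
exact: ltW.
Qed.

(** Such an x is orthogonal to every finite combination y of basis vectors, whence |x|^2 = <x, x -
    y> <= |x| |x - y|, and density makes the last factor small. *)
Lemma basis_eq0 x : (forall k, dot (b k) x = 0) -> x = 0.
Proof.
move=> h; apply: nrm0P; apply: le_anti; rewrite nrm_ge0 andbT.
apply: le_of_eps => e e0; rewrite add0r.
have [s [c hs]] := basis_dense x e0; set y := \sum_(i <- s) _ in hs.
have xy : dot x y = 0.
  by rewrite dot_sumr big1 // => i _; rewrite dotZr dot_conj h rmorph0 mulr0.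
have : nrm x ^+ 2 <= nrm x * nrm (x - y).
  apply: le_trans (dot_le _ _); rewrite dotBr xy subr0 dot_nrm nrmR ler_norm //.
have [->|x0] := eqVneq (nrm x) 0; first by rewrite (ltW e0).
by rewrite expr2 ler_pM2l ?lt_def ?x0 ?nrm_ge0 // => /le_trans; apply.
Qed.

Lemma basis_expand s x : uniq s -> (forall k, k \notin s -> dot (b k) x = 0) ->
  x = \sum_(i <- s) dot (b i) x *: b i.
Proof.
move=> us h; apply/eqP; rewrite -subr_eq0; apply/eqP; apply: basis_eq0 => k.
by rewrite dotBr dot_basis_sum //; case: ifPn => [_|/h ->]; rewrite subrr.
Qed.

Lemma basis_dense_uniq x (e : R) : 0 < e ->
  exists (s : seq I) y, [/\ uniq s, y = \sum_(i <- s) dot (b i) y *: b i &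
    nrm (x - y) <= e].
Proof.
move=> e0; have [s [c hs]] := basis_dense x e0.
exists (undup s); eexists; split; last exact: hs; first exact: undup_uniq.
apply: basis_expand; first exact: undup_uniq.
by move=> k; rewrite mem_undup => /dot_basis_out ->.
Qed.

Lemma bop_ext_basis S T : (forall i, S (b i) = T (b i)) -> S = T.
Proof.
move=> h; apply: bopP => x; apply/eqP; rewrite -subr_eq0; apply/eqP.
apply: nrm0P; apply: le_anti; rewrite nrm_ge0 andbT.
apply: le_of_eps => e e0; rewrite add0r -bop_subE.
have [M [M0 hM]] := bop_bnd (S - T).
have [s [c hs]] := basis_dense x (divr_gt0 e0 M0).
set y := \sum_(i <- s) _ in hs.
have y0 : (S - T) y = 0.
  rewrite bop_sum big1 // => i _.
  by rewrite bopZ bop_subE h subrr scaler0.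
rewrite -[(S - T) x]subr0 -y0 -bopB; apply: le_trans (hM _) _.
by rewrite -ler_pdivlMl // mulrC.
Qed.

Lemma adjoint_basis S T :
  (forall i j, dot (S (b i)) (b j) = dot (b i) (T (b j))) -> adjoint S T.
Proof.
move=> h.
have dot_sl s (c : I -> R[i]) (z : I -> H) :
    dot (\sum_(i <- s) c i *: z i) = fun y => \sum_(i <- s) Num.conj (c i) * dot (z i) y.
  apply/funext => y; rewrite dot_conj dot_sumr rmorph_sum; apply: eq_bigr => i _.
  by rewrite dotZr rmorphM /= -dot_conj.
have fin x y s c s' c' : x = \sum_(i <- s) c i *: b i ->
    y = \sum_(i <- s') c' i *: b i -> dot (S x) y = dot x (T y).
  move=> -> ->; rewrite !bop_sum.
  under [in LHS]eq_bigr do rewrite bopZ.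
  rewrite (dot_sl s c (fun i => S (b i))) dot_sl; apply: eq_bigr => i _.
  rewrite !dot_sumr; congr (_ * _); apply: eq_bigr => j _.
  by rewrite bopZ !dotZr h.
move=> x y; apply/eqP; rewrite -subr_eq0; apply/eqP.
apply: nrm0P; apply: le_anti; rewrite nrm_ge0 andbT.
apply: le_of_eps => e e0; rewrite add0r.
have [M [M0 hM]] := bop_bnd S.
have [N [N0 hN]] := bop_bnd T.
(* The four error terms add up to (M + N) d (|x| + |y| + d); the cap d <= 1 absorbs the quadratic
   part into the [+ 1] of the denominator. *)
pose d := Num.min 1 (e / ((M + N) * (nrm x + nrm y + 1))).
have K0 : 0 < (M + N) * (nrm x + nrm y + 1).
  apply: mulr_gt0; first exact: addr_gt0.
  by rewrite ltr_wpDl ?addr_ge0 ?nrm_ge0.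
have d0 : 0 < d by rewrite lt_min ltr01 divr_gt0.
have d1 : d <= 1 by rewrite ge_min lexx.
have de : d * ((M + N) * (nrm x + nrm y + 1)) <= e.
  by rewrite -ler_pdivlMr // ge_min lexx orbT.
have [s [c hs]] := basis_dense x d0.
have [s' [c' hs']] := basis_dense y d0.
move: hs hs'; set x' := \sum_(i <- s) _; set y' := \sum_(i <- s') _ => hx hy.
have E : dot (S x) y - dot x (T y) =
  dot (S (x - x')) y + dot (S x') (y - y') - (dot (x - x') (T y) + dot x' (T (y - y'))).
  rewrite !bopB !dotBl !dotBr !addrA !subrK.
  have -> : dot (S x') y' = dot x' (T y') by exact: fin erefl erefl.
  ring.
rewrite E; apply: le_trans (nrmB _ _) _.
apply: le_trans (lerD (nrmD _ _) (nrmD _ _)) _.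
have xx : nrm x' <= nrm x + d.
  by rewrite -[x'](subKr x); apply: le_trans (nrmB _ _) _; rewrite lerD2l.
have B1 : nrm (dot (S (x - x')) y) <= M * d * nrm y.
  apply: le_trans (dot_le _ _) _; rewrite ler_wpM2r ?nrm_ge0 //.
  by apply: le_trans (hM _) _; rewrite ler_wpM2l // ltW.
have B2 : nrm (dot (S x') (y - y')) <= M * (nrm x + d) * d.
  apply: le_trans (dot_le _ _) _; apply: ler_pM; rewrite ?nrm_ge0 //.
  by apply: le_trans (hM _) _; rewrite ler_wpM2l // ltW.
have B3 : nrm (dot (x - x') (T y)) <= d * (N * nrm y).
  by apply: le_trans (dot_le _ _) _; apply: ler_pM; rewrite ?nrm_ge0.
have B4 : nrm (dot x' (T (y - y'))) <= (nrm x + d) * (N * d).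
  apply: le_trans (dot_le _ _) _; apply: ler_pM; rewrite ?nrm_ge0 //.
  by apply: le_trans (hN _) _; rewrite ler_wpM2l // ltW.
apply: le_trans (lerD (lerD B1 B2) (lerD B3 B4)) _.
apply: le_trans de.
rewrite -subr_ge0.
have -> : d * ((M + N) * (nrm x + nrm y + 1)) - (M * d * nrm y + M * (nrm x + d) * d +
  (d * (N * nrm y) + (nrm x + d) * (N * d))) = d * ((M + N) * (1 - d)) by ring.
by rewrite !mulr_ge0 ?(ltW d0) ?subr_ge0 // addr_ge0 ?ltW.
Qed.

End Basis.

(* Operators dominated by a summable weight on a basis, and unconditional sums *)
#[local] Existing Instance summability.totally_filter.

Section Small.
Variables (R : realType) (H : hilbertType R) (I : choiceType) (b : I -> H).
Hypothesis hb : orthonormal_basis b.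
Variables (w : I -> R) (W : R).
Hypothesis w_ge0 : forall i, 0 <= w i.
Hypothesis w_sum : forall s : seq I, uniq s -> \sum_(i <- s) w i <= W.
Implicit Types (S T U : bop H) (s : seq I) (i j k : I).

(* [w] is a fixed summable weight; smallness gives [sum_i |T b_i| < oo]. *)
Definition small T := exists2 C : R, 0 <= C & forall i, nrm (T (b i)) <= C * w i.

(** The finite set [s0] has a weight within e of the supremum over all finite sets, so a finite set
    disjoint from it can add at most e. *)
Lemma weight_tail (e : R) : 0 < e ->
  exists s0, forall s, uniq s -> (forall i, i \in s -> i \notin s0) ->
    \sum_(i <- s) w i <= e.
Proof.
move=> e0; pose E := [set x | exists2 s, uniq s & x = \sum_(i <- s) w i].
have E1 : E !=set0 by exists 0; exists [::] => //; rewrite big_nil.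
have E2 : has_ubound E by exists W => _ [s us ->]; exact: w_sum.
have [_ [s0 us0 ->] h] := sup_adherent e0 (conj E1 E2).
exists s0 => s us dis.
have : \sum_(i <- s0 ++ s) w i <= sup E.
  apply: ub_le_sup => //; exists (s0 ++ s) => //.
  rewrite cat_uniq us0 us andbT /=.
  by apply/hasPn => i /dis.
rewrite big_cat /=; move: h; move: (sup E) => r.
move: (\sum_(i <- s0) _) => a; move: (\sum_(i <- s) _) => c; lra.
Qed.

Lemma sum_weight_le (C : R) s (f : I -> R) : 0 <= C -> uniq s ->
  (forall i, f i <= C * w i) -> \sum_(i <- s) f i <= C * W.
Proof.
move=> C0 us h; apply: (@le_trans _ _ (\sum_(i <- s) C * w i)).
  by apply: ler_sum.
by rewrite -mulr_sumr ler_wpM2l ?w_sum.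
Qed.

Lemma small_trace_class T T' : adjoint T T' -> small T -> trace_class T.
Proof.
move=> /abs_op_exists[P absP PT] [C C0 hC]; exists P => //.
exists I, b; split=> //; apply: le_lt_trans (ltry (C * W)).
apply: ge_ereal_sup => _ [A [fA _]] <-.
rewrite fsbig_finite //= sumEFin lee_fin.
apply: sum_weight_le => // i.
apply: le_trans (Re_le_nrm _) _; apply: le_trans (dot_le _ _) _.
by rewrite nrm_basis // mul1r PT.
Qed.

Lemma smallMl T U : small T -> small (U * T).
Proof.
move=> [C C0 hC]; have [M [M0 hM]] := bop_bnd U.
exists (M * C) => [|i]; first by rewrite mulr_ge0 // ltW.
rewrite bop_mulE; apply: le_trans (hM _) _.
by rewrite -mulrA ler_wpM2l // ltW.
Qed.

Lemma smallD S T : small S -> small T -> small (S + T).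
Proof.
move=> [C C0 hC] [D D0 hD]; exists (C + D) => [|i]; first exact: addr_ge0.
rewrite bop_addE mulrDl; apply: le_trans (nrmD _ _) _; exact: lerD.
Qed.

Lemma smallZ a T : small T -> small (a *: T).
Proof.
move=> [C C0 hC]; exists (nrm a * C) => [|i]; first by rewrite mulr_ge0 ?nrm_ge0.
by rewrite bop_scaleE nrmZ -mulrA ler_wpM2l ?nrm_ge0.
Qed.

Lemma small0 : small 0.
Proof. by exists 0 => // i; rewrite bop_zeroE nrm0 mul0r. Qed.

Lemma smallN T : small T -> small (- T).
Proof. by rewrite -scaleN1r; exact: smallZ. Qed.

(** Unconditional convergence, phrased with duplicate-free lists so that bigops over sequences can
    be used; [totally_seqP] matches it with the filter of finite sets behind [trace]. *)
Definition has_sum (f : I -> R[i]) (l : R[i]) :=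
  forall e : R, 0 < e -> exists s0 : seq I,
    forall s, uniq s -> {subset s0 <= s} -> nrm (l - \sum_(i <- s) f i) <= e.

Lemma totally_seqP (f : I -> R[i]) (P : R[i] -> Prop) :
  (exists s0 : seq I, forall s, uniq s -> {subset s0 <= s} -> P (\sum_(i <- s) f i))
  <-> summability.totally [set A : {fset I} | P (summability.partial_sum f A)].
Proof.
have E (A : {fset I}) : summability.partial_sum f A = \sum_(i <- enum_fset A) f i.
  by rewrite /summability.partial_sum [RHS]big_seq_fsetE.
split=> [[s0 h]|[A _ h]].
  exists [fset x in s0]%fset => // B sB; rewrite /= E; apply: h.
    exact: fset_uniq.
  by move=> x xs; apply: (fsubsetP sB); rewrite inE.
exists (enum_fset A) => s us ss.
have /h : [set B : {fset I} | (A `<=` B)%fset] [fset x in s]%fset.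
  by apply/fsubsetP => x /ss; rewrite inE.
rewrite /= E; congr P; apply: perm_big; apply: uniq_perm => //.
by move=> x; rewrite inE.
Qed.

Lemma has_sumE (f : I -> R[i]) (l : R[i]) : has_sum f l ->
  summability.sum (f : I -> R[i]^o) = l.
Proof.
move=> h; apply: cvg_lim; first exact: norm_hausdorff.
apply/cvgrPdist_le => e /complex_gt0P[r r0 ->].
have := (totally_seqP f (fun x => nrm (l - x) <= r)).1 (h r r0).
by apply: filterS => A /=; rewrite -lecR nrmE.
Qed.

Lemma has_sum_ex (i0 : I) (f : I -> R[i]) (C : R) : 0 <= C ->
  (forall i, nrm (f i) <= C * w i) -> exists l, has_sum f l.
Proof.
(* Scalars are moved onto the line through the unit vector [u], where completeness of [H] provides
   the limit, and recovered by pairing with [u]. This is the purpose of the index [i0]. *)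
move=> C0 hC; pose u := b i0.
have [l hl] : exists l : H, forall e : R, 0 < e ->
  summability.totally [set A : {fset I} | nrm (l - summability.partial_sum f A *: u) <= e].
  apply: complete_nrm => e e0.
  have C1 : 0 < C + 1 by rewrite ltr_wpDl.
  have [s0 hs0] := weight_tail (divr_gt0 e0 C1).
  exists ((\sum_(i <- undup s0) f i) *: u).
  apply/(totally_seqP f (fun x => nrm (_ - x *: u) <= e)).
  exists s0 => s us ss; rewrite -scalerBl nrmZ nrm_basis // mulr1.
  rewrite [\sum_(i <- s) _](perm_big (undup s0 ++ [seq i <- s | i \notin s0])) /=; last first.
    apply: uniq_perm => //.
      rewrite cat_uniq undup_uniq filter_uniq // andbT /=.
      by apply/hasPn => i; rewrite mem_filter mem_undup => /andP[].
    move=> i; rewrite mem_cat mem_filter mem_undup.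
    by have [/ss ->|] := boolP (i \in s0).
  rewrite big_cat /= opprD addrA subrr add0r nrmN.
  apply: le_trans (nrm_sum _ _ _) _.
  apply: (@le_trans _ _ (\sum_(i <- s | i \notin s0) C * w i)).
    by rewrite big_filter; apply: ler_sum => i _.
  rewrite -mulr_sumr -big_filter.
  have /hs0 K : uniq [seq i <- s | i \notin s0] by rewrite filter_uniq.
  apply: (@le_trans _ _ (C * (e / (C + 1)))).
    by rewrite ler_wpM2l // K // => i; rewrite mem_filter => /andP[].
  by rewrite mulrCA ler_piMr ?(ltW e0) // ler_pdivrMr // mul1r lerDl.
exists (dot u l) => e e0.
apply/(totally_seqP f (fun x => nrm (dot u l - x) <= e)).
apply: filterS (hl e e0) => A /= K.
have -> : dot u l - summability.partial_sum f A =
   dot u (l - summability.partial_sum f A *: u).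
  by rewrite dotBr dotZr basis_dot // eqxx mulr1.
by apply: le_trans (dot_le _ _) _; rewrite (nrm_basis hb) mul1r.
Qed.

Lemma has_sum_lin a (f g : I -> R[i]) l m : has_sum f l -> has_sum g m ->
  has_sum (fun i => a * f i + g i) (a * l + m).
Proof.
move=> hf hg e e0; pose d := e / (nrm a + 1).
have a1 : 0 < nrm a + 1 by rewrite ltr_wpDl ?nrm_ge0.
have d0 : 0 < d by rewrite divr_gt0.
have [s1 h1] := hf d d0; have [s2 h2] := hg d d0.
exists (s1 ++ s2) => s us ss.
have {}h1 : nrm (l - \sum_(i <- s) f i) <= d.
  by apply: h1 => // i i1; apply: ss; rewrite mem_cat i1.
have {}h2 : nrm (m - \sum_(i <- s) g i) <= d.
  by apply: h2 => // i i1; apply: ss; rewrite mem_cat i1 orbT.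
rewrite big_split /= -mulr_sumr opprD addrACA -mulrBr.
apply: le_trans (nrmD _ _) _; rewrite nrmM.
have -> : e = nrm a * d + d by rewrite /d; field; rewrite gt_eqF.
by apply: lerD => //; rewrite ler_wpM2l ?nrm_ge0.
Qed.

Lemma has_sum_uniq f l m : has_sum f l -> has_sum f m -> l = m.
Proof. by move=> /has_sumE <- /has_sumE <-. Qed.

End Small.

(** * Compactness *)

Section Compactness.
Variables (R : realType) (H : hilbertType R).

Definition totally_bounded (A : set H) :=
  forall e : R, 0 < e -> exists s : seq H,
    forall x, A x -> exists2 y, y \in s & nrm (x - y) <= e.

(** Pigeonhole along the list: the ultrafilter contains [Q y] or its complement, and in the latter
    case the remaining pieces still cover one of its members. *)
Lemma ultra_seq (V : Type) (K : eqType) (F : set_system V) (s : seq K) (Q : K -> set V) :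
  UltraFilter F -> F [set x | exists2 y, y \in s & Q y x] ->
  exists2 y, y \in s & F (Q y).
Proof.
move=> FU; elim: s => [|y s IH] h.
  have FF : ~ F set0 by exact: filter_not_empty.
  by exfalso; apply: FF; apply: filterS h => x [].
have [Fy|Fy] := in_ultra_setVsetC (Q y) FU; first by exists y; rewrite ?mem_head.
have [|z zs Fz] := IH; last by exists z => //; rewrite inE zs orbT.
apply: filterS (filterI h Fy) => x [[z]]; rewrite inE => /orP[/eqP->//|zs Qz] _.
by exists z.
Qed.

(** Every finite net singles out one ball that belongs to the ultrafilter, which is therefore Cauchy
    and converges to a point of the closed set. Half of e pays for the net, half for passing from
    the closure to [A]. *)
Lemma totally_bounded_compact (A : set H) : totally_bounded A -> compact (closure A).
Proof.
move=> tb; rewrite compact_ultra => F FU FA.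
have clA e x : 0 < e -> closure A x -> exists2 z, A z & nrm (x - z) <= e.
  move=> e0 /(_ (ball x e%:C)) [|z [Az hz]].
    by apply: nbhsx_ballx; rewrite ltcR.
  exists z => //; move: hz; rewrite -ball_normE /ball_ /= -nrmE ltcR.
  exact: ltW.
have [l hl] : exists l : H, forall e : R, 0 < e -> F [set x | nrm (l - x) <= e].
  apply: (@complete_nrm _ _ _ F _ id) => e e0.
  have e2 : 0 < e / 2 by rewrite divr_gt0.
  have [s hs] := tb _ e2.
  have : F [set x | exists2 y, y \in s & nrm (y - x) <= e].
    apply: filterS FA => x /(clA _ _ e2)[z /hs[y ys yz] xz].
    exists y => //; rewrite -nrmN opprB -[x](subrK z) -addrA.
    apply: le_trans (nrmD _ _) _; move: yz xz.
    by move: (nrm (z - y)) (nrm (x - z)) => u v; lra.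
  by move=> /(ultra_seq FU)[y _ Fy]; exists y.
exists l; split; last by apply/(cvg_nrmP _ id l).
have Fl : F --> l by apply/(cvg_nrmP _ id l).
apply: closed_closure => B lB; have FB : F B := Fl _ lB.
have [x Bx] := filter_ex (filterI FA FB).
by exists x.
Qed.

Lemma disc_net (e r : R) : 0 < e -> 0 <= r ->
  exists D : seq R[i], forall z, nrm z <= r -> exists2 d, d \in D & nrm (z - d) <= e.
Proof.
move=> e0 r0; have e2 : 0 < e / 2 by rewrite divr_gt0.
set h := e / 2 in e2.
have [D hD] : exists D : seq R, forall x, `|x| <= r -> exists2 d, d \in D & `|x - d| <= h.
  exists [seq - r + h * k%:R | k <- iota 0 (Num.truncn (2 * r / h)).+1] => x.
  rewrite ler_norml => /andP[x1 x2].
  have x0 : 0 <= (x + r) / h by rewrite divr_ge0 ?(ltW e2) //; lra.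
  set k := Num.truncn ((x + r) / h).
  have /andP[k1 k2] := truncn_itv x0.
  exists (- r + h * k%:R).
    apply/mapP; exists k => //; rewrite mem_iota /= add0n ltnS.
    apply: le_truncn; rewrite ler_pM2r ?invr_gt0 //; lra.
  move: k1 k2; rewrite -/k ler_pdivlMr // ltr_pdivrMr // -natr1 => k1 k2.
  by rewrite ler_norml; apply/andP; split; lra.
exists [seq x%:C + 'i * y%:C | x <- D, y <- D] => z hz.
have hRe : `|complex.Re z| <= r.
  rewrite ler_norml; have := Re_le_nrm z; have := Re_le_nrm (- z); rewrite nrmN.
  by case: z hz => a c /= hz h1 h2; apply/andP; split; lra.
have hIm : `|complex.Im z| <= r.
  (* The real part of iz is -Im z, so [Re_le_nrm] also bounds both signs of the imaginary part. *)
  have Ei y : nrm ('i * y) = nrm y :> R.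
    by rewrite nrmM {1}/nrm normc_def /= expr0n expr1n add0r sqrtr1 mul1r.
  rewrite ler_norml; have := Re_le_nrm ('i * z); have := Re_le_nrm (- ('i * z)).
  rewrite nrmN Ei; case: z hz {hRe} => a c hz /=.
  by rewrite !mul0r !mul1r !sub0r opprK => h1 h2; apply/andP; split; lra.
have [x xD xz] := hD _ hRe; have [y yD yz] := hD _ hIm.
exists (x%:C + 'i * y%:C); first by apply/allpairsP; exists (x, y).
have -> : z - (x%:C + 'i * y%:C) = (complex.Re z - x)%:C + 'i * (complex.Im z - y)%:C.
  by rewrite [z in LHS]complexE !rmorphB /= mulrBr opprD addrACA.
apply: le_trans (nrmD _ _) _; rewrite nrmM !nrmR.
rewrite {1}/nrm normc_def /= expr0n expr1n add0r sqrtr1 mul1r.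
by move: xz yz; rewrite /h; lra.
Qed.

Lemma totally_bounded_span (I : Type) (s : seq I) (u : I -> H) (r : R) : 0 <= r ->
  totally_bounded [set x | exists2 c : I -> R[i], (forall i, nrm (c i) <= r) &
                    x = \sum_(i <- s) c i *: u i].
Proof.
move=> r0; elim: s => [|i s IH] e e0.
  by exists [:: 0] => x [c _ ->]; exists 0; rewrite ?mem_head // big_nil subrr nrm0 ltW.
have e2 : 0 < e / 2 by rewrite divr_gt0.
have u1 : 0 < nrm (u i) + 1 by rewrite ltr_wpDl ?nrm_ge0.
have [N hN] := IH _ e2.
have [D hD] := disc_net (divr_gt0 e2 u1) r0.
exists [seq d *: u i + y | d <- D, y <- N] => x [c hc ->].
have [d dD dc] := hD _ (hc i).
have [y yN yc] := hN (\sum_(i <- s) c i *: u i) (ex_intro2 _ _ c hc erefl).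
exists (d *: u i + y); first by apply/allpairsP; exists (d, y).
rewrite big_cons opprD addrACA -scalerBl; apply: le_trans (nrmD _ _) _.
rewrite nrmZ.
have : nrm (c i - d) * nrm (u i) <= e / 2.
  apply: (@le_trans _ _ (e / 2 / (nrm (u i) + 1) * nrm (u i))).
    by rewrite ler_wpM2r ?nrm_ge0.
  by rewrite mulrAC ler_pdivrMr // ler_wpM2l ?(ltW e2) // lerDl.
by move: yc; lra.
Qed.

Variables (I : choiceType) (b : I -> H) (w : I -> R) (W : R).
Hypothesis hb : orthonormal_basis b.
Hypothesis w_ge0 : forall i, 0 <= w i.
Hypothesis w_sum : forall s : seq I, uniq s -> \sum_(i <- s) w i <= W.

(** On the unit ball T is uniformly close to its truncation to [s0], whose values lie in a finite
    span with bounded coefficients. A finite combination y near x has coordinates of modulus at most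
    2, so the part outside [s0] is controlled by the tail of the weight. *)
Lemma small_compact (T : bop H) : small b w T -> compact_op T.
Proof.
move=> [C C0 hC]; apply: totally_bounded_compact => e e0.
have e4 : 0 < e / 4 by rewrite divr_gt0.
have [M [M0 hM]] := bop_bnd T.
have C1 : 0 < 2 * (C + 1) by rewrite mulr_gt0 // ltr_wpDl.
have [s0 hs0] := weight_tail w_sum (divr_gt0 e4 C1).
have [N hN] := totally_bounded_span (undup s0) (fun i => T (b i)) (ler0n _ 2) e4.
exists N => _ [x x1 <-].
have {}x1 : nrm x <= 1 by rewrite -lecR nrmE.
pose dl := Num.min 1 (e / 4 / M).
have dl0 : 0 < dl by rewrite lt_min ltr01 divr_gt0.
have dl1 : dl <= 1 by rewrite ge_min lexx.
have dlM : M * dl <= e / 4.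
  by rewrite -ler_pdivlMl // mulrC ge_min lexx orbT.
have [s [y [us yE xy]]] := basis_dense_uniq hb x dl0.
have y2 : nrm y <= 2.
  by rewrite -[y](subKr x); apply: le_trans (nrmB _ _) _; lra.
pose c i := dot (b i) y.
have c2 i : nrm (c i) <= 2.
  by apply: le_trans (dot_le _ _) _; rewrite nrm_basis // mul1r.
have [z zN hz] := hN (\sum_(i <- undup s0) c i *: T (b i)) (ex_intro2 _ _ c c2 erefl).
exists z => //.
set V := \sum_(i <- undup s0) _ in hz.
have TyE : nrm (T y - V) <= e / 4.
  have -> : T y - V = \sum_(i <- [seq i <- s | i \notin s0]) c i *: T (b i).
    rewrite {1}yE bop_sum.
    under eq_bigr do rewrite bopZ -/(c _).
    rewrite (bigID (fun i => i \in s0)) /=.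
    have -> : V = \sum_(i <- s | i \in s0) c i *: T (b i).
      rewrite /V (bigID (fun i => i \in s)) /= [X in _ + X]big1 ?addr0; last first.
        move=> i si; rewrite /c yE dot_basis_out ?scale0r //.
      rewrite -big_filter -[RHS]big_filter; apply: perm_big; apply: uniq_perm.
      - by rewrite filter_uniq // undup_uniq.
      - by rewrite filter_uniq.
      - by move=> i; rewrite !mem_filter mem_undup andbC.
    by rewrite addrAC subrr add0r -big_filter.
  apply: le_trans (nrm_sum _ _ _) _.
  apply: (@le_trans _ _ (\sum_(i <- [seq i <- s | i \notin s0]) (2 * (C + 1)) * w i)).
    apply: ler_sum => i _; rewrite nrmZ -mulrA; apply: ler_pM; rewrite ?nrm_ge0 //.
    apply: le_trans (hC i) _; by rewrite ler_wpM2r // lerDl.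
  rewrite -mulr_sumr -ler_pdivlMl // mulrC; apply: hs0.
    by rewrite filter_uniq.
  by move=> i; rewrite mem_filter => /andP[].
have -> : T x - z = T (x - y) + (T y - V) + (V - z) by rewrite bopB !addrA !subrK.
apply: le_trans (nrmD _ _) _; have := nrmD (T (x - y)) (T y - V).
have : nrm (T (x - y)) <= M * dl.
  by apply: le_trans (hM _) _; rewrite ler_wpM2l // ltW.
by move: hz TyE; lra.
Qed.

End Compactness.

(** * Traces of operators of finite propagation *)

Section Local.
Variables (R : realType) (H : hilbertType R) (I : choiceType) (b : I -> H).
Hypothesis hb : orthonormal_basis b.
Variables (w : I -> R) (W : R).
Hypothesis w_ge0 : forall i, 0 <= w i.
Hypothesis w_sum : forall s : seq I, uniq s -> \sum_(i <- s) w i <= W.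
Variables (nb : I -> seq I) (m : nat) (C0 : R).
Hypothesis nb_uniq : forall i, uniq (nb i).
Hypothesis nb_size : forall i, (size (nb i) <= m)%N.
Hypothesis nb_sym : forall i k, k \in nb i -> i \in nb k.
Hypothesis C0_ge0 : 0 <= C0.
Hypothesis w_nb : forall i k, k \in nb i -> w k <= C0 * w i.
Implicit Types (S T U : bop H) (s : seq I) (i j k : I).

(** Locality for the fixed relation [nb] is not stable under products. It serves for [F], the
    generators and their adjoints; [traceable] carries its consequences to products. *)
Definition local T := forall i k, k \notin nb i -> dot (b k) (T (b i)) = 0.

Lemma local_expand T i : local T ->
  T (b i) = \sum_(k <- nb i) dot (b k) (T (b i)) *: b k.
Proof. by move=> lT; apply: basis_expand => // k /lT. Qed.

Lemma local_adjoint T T' : adjoint T T' -> local T -> local T'.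
Proof.
move=> adj lT i k ki; rewrite -adj dot_conj lT ?rmorph0 //.
by apply: contra ki => /nb_sym.
Qed.

Lemma dot_suml (J : Type) (r : seq J) (f : J -> H) y :
  dot (\sum_(i <- r) f i) y = \sum_(i <- r) dot (f i) y.
Proof.
rewrite dot_conj dot_sumr rmorph_sum; apply: eq_bigr => i _ /=.
by rewrite -dot_conj.
Qed.

Lemma sum_nb_le i (K : R) (f : I -> R) : (forall k, k \in nb i -> f k <= K) ->
  0 <= K -> \sum_(k <- nb i) f k <= m%:R * K.
Proof.
move=> h K0; rewrite big_seq; apply: le_trans (ler_sum _ h) _.
rewrite -big_seq big_const_seq count_predT iter_addr_0 mulr_natl.
by rewrite ler_wpMn2l.
Qed.

(** T b_i has at most m coordinates, each at most the bound M of T, and they sit at neighbours k,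
    where |S b_k| <= C w_k <= C C0 w_i. *)
Lemma smallM_local S T : small b w S -> local T -> small b w (S * T).
Proof.
move=> [C C_ge0 hC] lT; have [M [M0 hM]] := bop_bnd T.
exists (m%:R * (M * (C * C0))) => [|i]; first by rewrite !mulr_ge0 // ltW.
rewrite bop_mulE (local_expand i lT) bop_sum; apply: le_trans (nrm_sum _ _ _) _.
rewrite -!mulrA; apply: sum_nb_le => [k ki|]; last first.
  by rewrite !mulr_ge0 // ltW.
rewrite bopZ nrmZ; apply: ler_pM; rewrite ?nrm_ge0 //.
  apply: le_trans (dot_le _ _) _; rewrite (nrm_basis hb) mul1r.
  by apply: le_trans (hM _) _; rewrite (nrm_basis hb) mulr1.
by apply: le_trans (hC _) _; rewrite ler_wpM2l // w_nb.
Qed.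

(** The coordinate of S' b_i at k is conjugate to that of S b_k at i, hence at most C w_k <= C C0
    w_i, and at most m of them are non-zero. *)
Lemma small_local_adjoint S S' : adjoint S S' -> local S -> small b w S ->
  small b w S'.
Proof.
move=> adj lS [C C_ge0 hC].
exists (m%:R * (C * C0)) => [|i]; first by rewrite !mulr_ge0.
rewrite (local_expand i (local_adjoint adj lS)); apply: le_trans (nrm_sum _ _ _) _.
rewrite -!mulrA; apply: sum_nb_le => [k ki|]; last by rewrite !mulr_ge0.
rewrite nrmZ (nrm_basis hb) mulr1 -adj dot_conj nrm_conj.
apply: le_trans (dot_le _ _) _; rewrite (nrm_basis hb) mul1r.
by apply: le_trans (hC _) _; rewrite ler_wpM2l // w_nb.
Qed.

Definition has_trace T (l : R[i]) := has_sum (fun i => dot (b i) (T (b i))) l.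

Lemma has_trace_ex (i0 : I) T : small b w T -> exists l, has_trace T l.
Proof.
move=> [C C_ge0 hC]; apply: (has_sum_ex hb w_sum i0 C_ge0) => i.
by apply: le_trans (dot_le _ _) _; rewrite (nrm_basis hb) mul1r.
Qed.

Lemma has_traceE T l : has_trace T l -> trace b T = l.
Proof. exact: has_sumE. Qed.

Lemma has_trace_lin a S T l n : has_trace S l -> has_trace T n ->
  has_trace (a *: S + T) (a * l + n).
Proof.
move=> hS hT e /(has_sum_lin a hS hT)[s0 h]; exists s0 => s us ss.
rewrite (eq_bigr (fun i => a * dot (b i) (S (b i)) + dot (b i) (T (b i)))); first exact: h.
by move=> i _; rewrite bop_addE bop_scaleE dotDr dotZr.
Qed.

(* In a finite partial sum, the terms with both indices in the index set cancel;
   what remains lives outside the set, where the weight has a small sum. *)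
Lemma has_sum_boundary (a : I -> I -> R[i]) (K : R) : 0 <= K ->
  (forall i k, a k i = - a i k) -> (forall i k, k \in nb i -> nrm (a i k) <= K * w k) ->
  has_sum (fun i => \sum_(k <- nb i) a i k) 0.
Proof.
move=> K0 anti hK e e0.
have D0 : 0 < m%:R * K + 1 by rewrite ltr_wpDl ?mulr_ge0.
have [s0 hs0] := weight_tail w_sum (divr_gt0 e0 D0).
exists s0 => s us ss; rewrite sub0r nrmN.
under eq_bigr do rewrite (bigID (fun k => k \in s)) /=.
rewrite big_split /=.
have -> : \sum_(i <- s) \sum_(k <- nb i | k \in s) a i k = 0.
  pose X := \sum_(i <- s) \sum_(k <- s | k \in nb i) a i k.
  have XE : \sum_(i <- s) \sum_(k <- nb i | k \in s) a i k = X.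
    apply: eq_bigr => i _; rewrite -big_filter -[RHS]big_filter.
    apply: perm_big; apply: uniq_perm; rewrite ?filter_uniq //.
    by move=> k; rewrite !mem_filter andbC.
  have : X = - X.
    rewrite {1}/X (exchange_big_dep xpredT) //= -sumrN; apply: eq_bigr => i _.
    rewrite -sumrN (eq_bigl (fun k => k \in nb i)).
      by apply: eq_bigr => k _; rewrite anti.
    by move=> k; apply/idP/idP; apply: nb_sym.
  move/eqP; rewrite -addr_eq0 -mulr2n mulrn_eq0 /= => /eqP X0.
  by rewrite XE.
rewrite add0r.
pose t := [seq k <- undup (flatten [seq nb i | i <- s]) | k \notin s].
have ut : uniq t by rewrite filter_uniq // undup_uniq.
apply: le_trans (nrm_sum _ _ _) _.
apply: (@le_trans _ _ (\sum_(i <- s) \sum_(k <- t | k \in nb i) K * w k)).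
  rewrite big_seq [X in _ <= X]big_seq; apply: ler_sum => i si.
  apply: le_trans (nrm_sum _ _ _) _.
  have -> : \sum_(k <- t | k \in nb i) K * w k = \sum_(k <- nb i | k \notin s) K * w k.
    rewrite -big_filter -[RHS]big_filter; apply: perm_big; apply: uniq_perm.
    - exact: filter_uniq.
    - exact: filter_uniq.
    move=> k; rewrite !mem_filter mem_undup andbCA; congr (_ && _).
    apply: andb_idr => ki; apply/flattenP; exists (nb i) => //.
    by apply/mapP; exists i.
  rewrite -big_filter -[X in _ <= X]big_filter big_seq [X in _ <= X]big_seq.
  by apply: ler_sum => k; rewrite mem_filter => /andP[_ /hK].
rewrite (exchange_big_dep xpredT) //=.
apply: (@le_trans _ _ (\sum_(k <- t) (m%:R * K) * w k)).
  apply: ler_sum => k _; rewrite -big_filter.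
  rewrite big_const_seq count_predT iter_addr_0 -mulrA mulr_natl.
  apply: ler_wpMn2l; first by rewrite mulr_ge0.
  apply: leq_trans (nb_size k); apply: uniq_leq_size; first by rewrite filter_uniq.
  by move=> i; rewrite mem_filter => /andP[/nb_sym].
rewrite -mulr_sumr.
apply: (@le_trans _ _ ((m%:R * K) * (e / (m%:R * K + 1)))).
  rewrite ler_wpM2l ?mulr_ge0 //; apply: hs0 => // k.
  by rewrite mem_filter => /andP[ks _]; apply: contra ks => /ss.
by rewrite mulrCA ler_piMr ?(ltW e0) // ler_pdivrMr // mul1r lerDl.
Qed.

Lemma trace_comm_local S T T' l n : small b w S -> local T -> adjoint T T' ->
  has_trace (S * T) l -> has_trace (T * S) n -> l = n.
Proof.
move=> [C C_ge0 hC] lT adj hl hn; have [M [M0 hM]] := bop_bnd T.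
(* The sums over k of [g i k] and of [g k i] are the diagonal entries at i of S T and of T S, so
   their difference is a sum of terms antisymmetric in i and k. *)
pose g i k := dot (b k) (T (b i)) * dot (b i) (S (b k)).
have gle i k : nrm (g i k) <= M * (C * w k).
  rewrite nrmM; apply: ler_pM; rewrite ?nrm_ge0 //.
    apply: le_trans (dot_le _ _) _; rewrite (nrm_basis hb) mul1r.
    by apply: le_trans (hM _) _; rewrite (nrm_basis hb) mulr1.
  by apply: le_trans (dot_le _ _) _; rewrite (nrm_basis hb) mul1r.
have hd := has_sum_lin (-1) hn hl.
suff h0 : has_sum (fun i => -1 * dot (b i) ((T * S) (b i)) + dot (b i) ((S * T) (b i))) 0.
  apply/eqP; rewrite -subr_eq0 addrC -mulN1r; apply/eqP.
  exact: has_sum_uniq hd h0.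
have E i : -1 * dot (b i) ((T * S) (b i)) + dot (b i) ((S * T) (b i)) =
    \sum_(k <- nb i) (g i k - g k i).
  rewrite sumrB mulN1r addrC; congr (_ - _).
    rewrite bop_mulE {1}(local_expand i lT) bop_sum dot_sumr.
    by apply: eq_bigr => k _; rewrite bopZ dotZr.
  (* S b_i may have infinitely many coordinates; moving T to the left as its local adjoint turns the
     entry of T S into a finite sum. *)
  rewrite bop_mulE -(adjoint_sym adj) (local_expand i (local_adjoint adj lT)).
  rewrite dot_suml; apply: eq_bigr => k _.
  by rewrite dotZl -dot_conj (adjoint_sym adj).
move=> e /(@has_sum_boundary (fun i k => g i k - g k i) (M * C + M * C * C0)) [||i k|s0 h].
- by rewrite ?addr_ge0 ?mulr_ge0 ?(ltW M0).
- by move=> i k; rewrite opprB.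
- move=> ki; apply: le_trans (nrmB _ _) _; rewrite mulrDl; apply: lerD.
    by rewrite -mulrA.
  apply: le_trans (gle _ _) _; rewrite -!mulrA ler_wpM2l ?(ltW M0) // ler_wpM2l //.
  by rewrite w_nb // nb_sym.
exists s0 => s us ss; rewrite (eq_bigr _ (fun i _ => E i)); exact: h.
Qed.

End Local.

(** * The pairing with K-theory *)

Section Pairing.
Variables (R : realType) (A : starAlgType R) (H : hilbertType R).
Variables (I : choiceType) (b : I -> H) (i0 : I).
Hypothesis hb : orthonormal_basis b.
Variables (w : I -> R) (W : R).
Hypothesis w_ge0 : forall i, 0 <= w i.
Hypothesis w_sum : forall s : seq I, uniq s -> \sum_(i <- s) w i <= W.
Variables (pi : A -> bop H) (F gamma : bop H).
Hypothesis hpi : star_representation pi.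

(* For [T] in the algebra, [S T] is small and [Tr (S T) = Tr (T S)]; stated for
   all small [S], this passes to products of generators. *)
Definition traceable (T : bop H) := forall S, small b w S ->
  small b w (S * T) /\ trace b (S * T) = trace b (T * S).

Lemma trace_lin a S T : small b w S -> small b w T ->
  trace b (a *: S + T) = a * trace b S + trace b T.
Proof.
move=> /(has_trace_ex hb w_sum i0)[l hl] /(has_trace_ex hb w_sum i0)[n hn].
by rewrite (has_traceE hl) (has_traceE hn) (has_traceE (has_trace_lin a hl hn)).
Qed.

Lemma traceD S T : small b w S -> small b w T ->
  trace b (S + T) = trace b S + trace b T.
Proof. by move=> hS hT; rewrite -[S]scale1r trace_lin // mul1r scale1r. Qed.

Lemma traceable_lin a S T : traceable S -> traceable T -> traceable (a *: S + T).
Proof.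
move=> hS hT U hU; have [s1 t1] := hS U hU; have [s2 t2] := hT U hU.
have E1 : U * (a *: S + T) = a *: (U * S) + U * T.
  by apply: bopP => x; rewrite !(bop_addE, bop_scaleE, bop_mulE) bop_funD bopZ.
have E2 : (a *: S + T) * U = a *: (S * U) + T * U.
  by apply: bopP => x; rewrite !(bop_addE, bop_scaleE, bop_mulE).
split; first by rewrite E1; apply: smallD => //; exact: smallZ.
by rewrite E1 E2 !trace_lin ?t1 ?t2 //; exact: smallMl.
Qed.

(** Tr(U S T) = Tr(T U S) = Tr(S T U): the first step uses the small operator U S, the second the
    small operator T U, which is why the test operator is universally quantified. *)
Lemma traceableM S T : traceable S -> traceable T -> traceable (S * T).
Proof.
move=> hS hT U hU; have [s1 t1] := hS U hU; have [s2 t2] := hT _ s1.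
rewrite mulrA; split=> //; rewrite t2 mulrA.
have hTU : small b w (T * U) by exact: smallMl.
by have [_] := hS _ hTU; rewrite -!mulrA.
Qed.

Lemma traceable1 : traceable 1.
Proof. by move=> S hS; rewrite mulr1 mul1r. Qed.

Hypothesis F2 : F * F = 1.
Hypothesis gF : gamma * F + F * gamma = 0.
Hypothesis gpi : forall x, gamma * pi x = pi x * gamma.
Hypothesis F_tr : traceable F.
Hypothesis pi_tr : forall x, traceable (pi x).
Hypothesis pi_small : forall x, small b w (commutator F (pi x)).

Definition phi (x : A) : R[i] := trace b (gamma * F * commutator F (pi x)).

Let D x := pi x - F * pi x * F.

Lemma FcommE x : F * commutator F (pi x) = D x.
Proof. by rewrite /commutator mulrBr !mulrA F2 mul1r. Qed.

Lemma small_D x : small b w (gamma * D x).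
Proof. by rewrite -FcommE; do 2 apply: smallMl. Qed.

Lemma phiE x : phi x = trace b (gamma * D x).
Proof. by rewrite /phi -mulrA FcommE. Qed.

Lemma pi_lin a x y : pi (a *: x + y) = a *: pi x + pi y.
Proof. by have [h _ _ _] := hpi; rewrite h. Qed.
Lemma piM x y : pi (x * y) = pi x * pi y.
Proof. by have [_ _ h _] := hpi. Qed.

Lemma bop_scaleAl a (S T : bop H) : a *: (S * T) = (a *: S) * T.
Proof. by apply: bopP. Qed.
Lemma bop_scaleAr a (S T : bop H) : a *: (S * T) = S * (a *: T).
Proof. by apply: bopP => x; rewrite !(bop_scaleE, bop_mulE) bopZ. Qed.

Lemma phi_lin a x y : phi (a *: x + y) = a * phi x + phi y.
Proof.
rewrite !phiE -trace_lin; try exact: small_D.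
congr trace; rewrite /D pi_lin bop_scaleAr -mulrDr; congr (_ * _).
by rewrite mulrDr mulrDl -bop_scaleAr -bop_scaleAl opprD addrACA -scalerBr.
Qed.

Lemma phiD x y : phi (x + y) = phi x + phi y.
Proof. by rewrite -[x]scale1r phi_lin mul1r scale1r. Qed.

Lemma phi0 : phi 0 = 0.
Proof. by apply: (addrI (phi 0)); rewrite -phiD !addr0. Qed.

Lemma phiZ a x : phi (a *: x) = a * phi x.
Proof. by rewrite -[a *: x]addr0 phi_lin phi0 addr0. Qed.

Lemma phi_sum J (r : seq J) (P : pred J) (f : J -> A) :
  phi (\sum_(j <- r | P j) f j) = \sum_(j <- r | P j) phi (f j).
Proof. by elim/big_rec2 : _ => [|j y1 y2 _ <-]; rewrite ?phi0 ?phiD. Qed.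

(* [phi] is the functional [a |-> Tr (gamma (a - F a F))]; writing
   [a' = F a F], both [ab - a'b' = (a - a') b + a' (b - b')] and
   [ba - b'a' = b (a - a') + (b - b') a'] have the same trace. *)
Lemma phi_comm x y : phi (x * y) = phi (y * x).
Proof.
rewrite !phiE.
have [x' x'E] : exists x', x' = F * pi x * F by exists (F * pi x * F).
(* [gamma] changes sign twice on its way through the two factors [F], so F a F is even like a. *)
have gx' : gamma * x' = x' * gamma.
  have gFN : gamma * F = - (F * gamma) by apply/eqP; rewrite -addr_eq0 gF.
  rewrite x'E !mulrA gFN !mulNr -(mulrA F gamma) gpi -!mulrA gFN !mulrN opprK.
  by [].
have x'_tr : traceable x' by rewrite x'E; apply: traceableM => //; exact: traceableM.
have DM z t : D (z * t) = pi z * pi t - F * pi z * F * (F * pi t * F).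
  by rewrite /D piM !mulrA -[_ * F * F]mulrA F2 mulr1.
have -> : gamma * D (x * y) = gamma * D x * pi y + x' * (gamma * D y).
  rewrite mulrA -gx' -!mulrA -mulrDr; congr (_ * _).
  by rewrite DM /D -x'E mulrBl mulrBr addrA subrK.
have -> : gamma * D (y * x) = pi y * (gamma * D x) + gamma * D y * x'.
  rewrite mulrA -gpi -!mulrA -mulrDr; congr (_ * _).
  by rewrite DM /D -x'E mulrBr mulrBl addrA subrK.
have [s1 t1] := pi_tr y (small_D x); have [s2 t2] := x'_tr _ (small_D y).
by rewrite !traceD ?t1 ?t2 //; apply: smallMl; exact: small_D.
Qed.

Lemma half_traceE n (e : 'M[A]_n) :
  half_trace b pi F gamma e = 2^-1 * \sum_k phi (e k k).
Proof.
rewrite /half_trace /trace_mx; congr (_ * _); apply: eq_bigr => k _.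
congr trace; rewrite -scalar_mxM mul_scalar_mx mxE mul_scalar_mx; congr (_ * _).
rewrite !mxE /commutator; congr (_ - _); rewrite (bigD1 k) //= big1 => [|j jk].
  by rewrite addr0 !mxE eqxx mulr1n.
by rewrite !mxE (negbTE jk) mulr0n mulr0.
Qed.

Fixpoint K0_phi (x : K0_expr A) : R[i] :=
  match x with
  | K0_gen n e _ => half_trace b pi F gamma e
  | K0_zero => 0
  | K0_plus x y => K0_phi x + K0_phi y
  | K0_minus x => - K0_phi x
  end.

(** Beyond the group axioms there are two relations. For equivalent idempotents uv and vu the claim
    is the trace property of [phi] applied to each product of entries; for a direct sum the diagonal
    splits. *)
Lemma K0_phi_eq x y : K0_eq x y -> K0_phi x = K0_phi y.
Proof.
elim=> {x y} //=.
- by move=> x y z _ -> _ ->.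
- by move=> x x' y y' _ -> _ ->.
- by move=> x x' _ ->.
- by move=> x y z; rewrite addrA.
- by move=> x y; rewrite addrC.
- by move=> x; rewrite add0r.
- by move=> x; rewrite addNr.
- move=> m n e f _ _ [u [v [-> ->]]]; rewrite !half_traceE; congr (_ * _).
  transitivity (\sum_i \sum_j phi (u i j * v j i)).
    by apply: eq_bigr => i _; rewrite mxE phi_sum.
  rewrite exchange_big; apply: eq_bigr => j _; rewrite mxE phi_sum.
  by apply: eq_bigr => i _; rewrite phi_comm.
- move=> m n e f _ _ _; rewrite !half_traceE -mulrDr big_split_ord; congr (_ * (_ + _)).
    by apply: eq_bigr => k _; rewrite block_mxEul.
  by apply: eq_bigr => k _; rewrite block_mxEdr.
Qed.

(** [chF] selects an integer attached to some presentation of the class as a difference. The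
    presentation [e] - [0] with an empty matrix shows that there is one, and [K0_phi] shows that all
    presentations give the same value. *)
Lemma chF_class n (e : 'M[A]_n) (he : idempotent_mx e) (k : int) :
  half_trace b pi F gamma e = k%:~R -> chF b pi F gamma (K0_class he) = k.
Proof.
move=> hk; rewrite /chF; set P := [set _ | _].
have he0 : idempotent_mx (0 : 'M[A]_0) by rewrite /idempotent_mx mul0mx.
have Pk : P k.
  exists n, 0%N, e, 0, he, he0; split.
    rewrite -[LHS]addr0; congr (_ + _); rewrite -[LHS]oppr0; congr (- _).
    (* The direct sum of two empty matrices is empty, so the class c of the empty idempotent
       satisfies c = c + c and vanishes. *)
    apply: (addrI (K0_class he0)); rewrite addr0.
    have hee : idempotent_mx (block_mx (0 : 'M[A]_0) 0 0 (0 : 'M[A]_0)).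
      by rewrite /idempotent_mx [block_mx _ _ _ _]flatmx0 mul0mx.
    rewrite -[RHS]/(K0_add _ _) K0_addE; apply/to_K0P.
    apply: K0_trans (K0_dsum he0 he0 hee).
    apply: K0_mvn; exists 0, 0; split; first by rewrite mulmx0.
    by rewrite mulmx0 [LHS]flatmx0.
  by rewrite [X in _ - X]half_traceE big_ord0 mulr0 subr0.
have [m [p [e' [f' [he' [hf' [E1 E2]]]]]]] : P (xget 0 P) by apply: xgetPex; exists k.
apply/eqP; rewrite -(eqr_int R[i]) E2; apply/eqP.
have : K0_class he = to_K0 (K0_plus (K0_gen he') (K0_minus (K0_gen hf'))).
  by rewrite E1 -[RHS]K0_addE -K0_oppE.
by move=> /to_K0P/K0_phi_eq /= <-.
Qed.

End Pairing.

(** * The algebra of the quantum sphere and its idempotent *)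

(** These three cancellations close the last three diagonal entries of the squared matrix: u, v, z
    stand for x_0^2 and the products of x_1 and x_2 with their stars, and a, c, d for multiples of u
    and v by powers of q. *)
Lemma zmod_cancel1 (V : zmodType) (a c z v u : V) :
  a + (z + (v + (u - a) - c) + c) = u + v + z.
Proof.
rewrite -[z + _ + c]addrA subrK addrCA [a + _]addrCA [a + _]addrC subrK.
by rewrite addrC [v + u]addrC.
Qed.

Lemma zmod_cancel2 (V : zmodType) (a u v z : V) : a + (v + (u - a) + z) = u + v + z.
Proof. by rewrite addrA addrCA [a + _]addrC subrK [v + u]addrC. Qed.

Lemma zmod_cancel3 (V : zmodType) (a c d z v u : V) :
  a + (d + (c - a) + (z + (v + (u - c) - d))) = u + v + z.
Proof.
rewrite addrA [a + _]addrCA [a + _]addrC subrK [d + c]addrC -addrA [z + _]addrA.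
rewrite [d + _]addrC subrK [c + _]addrCA [c + _]addrCA [c + _]addrC subrK.
by rewrite addrC [v + u]addrC.
Qed.

Section QuantumSphereAlgebra.
Variables (R : realType) (q : R).
Local Notation A := (s4q q).

Lemma to_s4q_add x y : to_s4q q (s4_plus x y) = to_s4q q x + to_s4q q y.
Proof. by rewrite -s4q_addE. Qed.
Lemma to_s4q_opp x : to_s4q q (s4_minus x) = - to_s4q q x.
Proof. by rewrite -s4q_oppE. Qed.
Lemma to_s4q_mul x y : to_s4q q (s4_times x y) = to_s4q q x * to_s4q q y.
Proof. by rewrite -s4q_mulE. Qed.
Lemma to_s4q_scale c x : to_s4q q (s4_scal c x) = c *: to_s4q q x.
Proof. by rewrite -s4q_scaleE. Qed.
Lemma to_s4q_star x : to_s4q q (s4_star x) = star (to_s4q q x).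
Proof. by rewrite -s4q_starE. Qed.

Lemma starN (x : A) : star (- x) = - star x.
Proof. by rewrite -scaleN1r starZ rmorphN1 scaleN1r. Qed.

Lemma star0 : star (0 : A) = 0.
Proof. by rewrite -[0 : A](scale0r 0) starZ rmorph0 !scale0r. Qed.

Lemma star1 : star (1 : A) = 1.
Proof. by rewrite -[LHS]mul1r -[X in X * _](starK (1 : A)) -starM mul1r starK. Qed.

Lemma star_x0 : star (x0 q) = x0 q.
Proof. by rewrite -to_s4q_star; apply/to_s4qP; exact: s4_x0_star. Qed.

(** An expression may apply the star to any subterm. The induction proves P for an element and for
    its star at once, which pushes stars down to the generators. *)
Lemma s4q_generated (P : A -> Prop) :
  P (x0 q) -> P (x1 q) -> P (x2 q) -> P (star (x1 q)) -> P (star (x2 q)) ->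
  P 1 -> (forall (a : R[i]) x y, P x -> P y -> P (a *: x + y)) ->
  (forall x y, P x -> P y -> P (x * y)) -> forall x, P x.
Proof.
move=> p0 p1 p2 p1' p2' P1 Plin PM x; rewrite -(of_s4qK x).
have P0 : P 0.
  by rewrite -[0](addNr 1) -scaleN1r; exact: Plin.
have PZ a y : P y -> P (a *: y) by move=> Py; rewrite -[a *: y]addr0; exact: Plin.
have PD y z : P y -> P z -> P (y + z) by move=> Py; rewrite -[y]scale1r; exact: Plin.
have PN y : P y -> P (- y) by rewrite -scaleN1r; exact: PZ.
suff : P (to_s4q q (of_s4q x)) /\ P (star (to_s4q q (of_s4q x))) by case.
elim: (of_s4q x) => [i||| y [y1 y2] z [z1 z2]|y [y1 y2]|y [y1 y2] z [z1 z2]|a y [y1 y2]|y [y1 y2]].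
- have [->|[->|->]] : i = inord 0 \/ i = inord 1 \/ i = inord 2.
    case: i => [[|[|[|//]]] hi]; [left|right; left|right; right];
    by apply: val_inj; rewrite /= inordK.
  + by split; rewrite -/(x0 q) ?star_x0.
  + by split.
  + by split.
- by rewrite -[to_s4q q (s4_zero R)]/(0 : A) star0.
- by rewrite -[to_s4q q (s4_one R)]/(1 : A) star1.
- by rewrite to_s4q_add starD; split; exact: PD.
- by rewrite to_s4q_opp starN; split; exact: PN.
- by rewrite to_s4q_mul starM; split; exact: PM.
- by rewrite to_s4q_scale starZ; split; exact: PZ.
- by rewrite to_s4q_star starK; split.
Qed.

Lemma q_rel (i j : 'I_3) : (i < j)%N ->
  to_s4q q (s4_gen _ i) * to_s4q q (s4_gen _ j) =
  (q ^+ 2)%:C *: (to_s4q q (s4_gen _ j) * to_s4q q (s4_gen _ i)).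
Proof. by move=> ij; rewrite -!to_s4q_mul -to_s4q_scale; apply/to_s4qP; exact: s4_rel. Qed.

Lemma q_rel_star (i j : 'I_3) : i != j ->
  star (to_s4q q (s4_gen _ i)) * to_s4q q (s4_gen _ j) =
  (q ^+ 2)%:C *: (to_s4q q (s4_gen _ j) * star (to_s4q q (s4_gen _ i))).
Proof. by move=> ij; rewrite -!to_s4q_star -!to_s4q_mul -to_s4q_scale;
  apply/to_s4qP; exact: s4_rel_star. Qed.

Let ltn_inord (i j : nat) : (i < 3)%N -> (j < 3)%N -> (i < j)%N ->
  ((inord i : 'I_3) < (inord j : 'I_3))%N.
Proof. by move=> i3 j3 ij; rewrite !inordK. Qed.

Let neq_inord (i j : nat) : (i < 3)%N -> (j < 3)%N -> i != j ->
  (inord i : 'I_3) != inord j.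
Proof. by move=> i3 j3 ij; rewrite -val_eqE /= !inordK. Qed.

Lemma rel01 : x0 q * x1 q = (q ^+ 2)%:C *: (x1 q * x0 q).
Proof. exact: q_rel (ltn_inord _ _ _). Qed.
Lemma rel02 : x0 q * x2 q = (q ^+ 2)%:C *: (x2 q * x0 q).
Proof. exact: q_rel (ltn_inord _ _ _). Qed.
Lemma rel12 : x1 q * x2 q = (q ^+ 2)%:C *: (x2 q * x1 q).
Proof. exact: q_rel (ltn_inord _ _ _). Qed.
Lemma rel1s0 : star (x1 q) * x0 q = (q ^+ 2)%:C *: (x0 q * star (x1 q)).
Proof. exact: q_rel_star (neq_inord _ _ _). Qed.
Lemma rel2s0 : star (x2 q) * x0 q = (q ^+ 2)%:C *: (x0 q * star (x2 q)).
Proof. exact: q_rel_star (neq_inord _ _ _). Qed.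
Lemma rel1s2 : star (x1 q) * x2 q = (q ^+ 2)%:C *: (x2 q * star (x1 q)).
Proof. exact: q_rel_star (neq_inord _ _ _). Qed.
Lemma rel2s1 : star (x2 q) * x1 q = (q ^+ 2)%:C *: (x1 q * star (x2 q)).
Proof. exact: q_rel_star (neq_inord _ _ _). Qed.
Lemma rel2s1s : star (x2 q) * star (x1 q) = (q ^+ 2)%:C *: (star (x1 q) * star (x2 q)).
Proof. by rewrite -starM rel12 starZ starM conj_Creal //; apply/complex_realP; eexists. Qed.

Lemma rel11 : star (x1 q) * x1 q =
  x1 q * star (x1 q) + (1 - q ^+ 4)%:C *: (x0 q * x0 q).
Proof.
apply/eqP; rewrite addrC -subr_eq; apply/eqP.
by rewrite /x0 /x1 /x2 -!to_s4q_star -!to_s4q_mul -?to_s4q_scale -?to_s4q_opp -!to_s4q_add;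
  apply/to_s4qP; exact: s4_comm1.
Qed.
Lemma rel22 : star (x2 q) * x2 q =
  x2 q * star (x2 q) + (star (x1 q) * x1 q - (q ^+ 4)%:C *: (x1 q * star (x1 q))).
Proof.
apply/eqP; rewrite addrC -subr_eq; apply/eqP.
by rewrite /x0 /x1 /x2 -!to_s4q_star -!to_s4q_mul -?to_s4q_scale -?to_s4q_opp -!to_s4q_add;
  apply/to_s4qP; exact: s4_comm2.
Qed.
Lemma rel_sphere : x0 q * x0 q + x1 q * star (x1 q) + x2 q * star (x2 q) = 1.
Proof.
have /to_s4qP := s4_sphere q.
by rewrite !(to_s4q_add, to_s4q_mul, to_s4q_star).
Qed.

Lemma mulZZ (a c : R[i]) (u v : A) : (a *: u) * (c *: v) = (a * c) *: (u * v).
Proof. by rewrite -scalerAl -scalerAr scalerA. Qed.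

(** The idempotent is half of a matrix E, so the goal is E^2 = 2E. On the diagonal, the square of
    the x_0 term and the off-diagonal products z must add up to 1, a form of the sphere relation. In
    the entries treated next the x_0 terms cancel by q-commutation, and a zero entry of E is a
    cancellation of two monomials. *)
Lemma diag_entry (a : R[i]) (x z : A) : a ^+ 2 *: (x * x) + z = 1 ->
  (1 + a *: x) * (1 + a *: x) + z = 2 *: (1 + a *: x).
Proof.
move=> h; rewrite mulrDr mulr1 mulrDl mul1r -scalerAl -scalerAr scalerA -expr2.
by rewrite -!addrA h scaler_nat mulr2n !addrA addrAC -!addrA.
Qed.

Lemma left_entry (a c d : R[i]) (x y : A) : a *: (x * y) = d *: (y * x) ->
  (1 + a *: x) * (c *: y) + (c *: y) * (1 - d *: x) = 2 *: (c *: y).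
Proof.
move=> h; have -> : (1 + a *: x) * (c *: y) = c *: y + c *: (a *: (x * y)).
  by rewrite mulrDl mul1r -scalerAl -scalerAr !scalerA (mulrC a).
have -> : (c *: y) * (1 - d *: x) = c *: y - c *: (d *: (y * x)).
  by rewrite mulrBr mulr1 -scalerAl -scalerAr.
by rewrite h addrACA subrr addr0 scaler_nat mulr2n.
Qed.

Lemma right_entry (a c d : R[i]) (x y : A) : a *: (y * x) = d *: (x * y) ->
  (c *: y) * (1 + a *: x) + (1 - d *: x) * (c *: y) = 2 *: (c *: y).
Proof.
move=> h; have -> : (c *: y) * (1 + a *: x) = c *: y + c *: (a *: (y * x)).
  by rewrite mulrDr mulr1 -scalerAl -scalerAr.
have -> : (1 - d *: x) * (c *: y) = c *: y - c *: (d *: (x * y)).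
  by rewrite mulrBl mul1r -scalerAl -scalerAr !scalerA (mulrC d).
by rewrite h addrACA subrr addr0 scaler_nat mulr2n.
Qed.

Lemma off_entry (a c d k f : R[i]) (u v : A) : u * v = f *: (v * u) ->
  a * c * f + d * k = 0 -> (a *: u) * (c *: v) + (d *: v) * (k *: u) = 0.
Proof.
move=> uv h; rewrite -!scalerAl -!scalerAr uv !scalerA -scalerDl.
by rewrite h scale0r.
Qed.

Hypothesis q0 : q != 0.

(** Twice the idempotent, with signs moved into scalars and a spurious [1 *:], so that its entries
    match the patterns of the preceding lemmas. *)
Definition s4_entry (i j : nat) : A :=
  let: Q := q%:C in
  nth 0 (nth [::] [::
    [:: 1 + 1 *: x0 q; Q ^+ 3 *: x2 q; (- Q) *: x1 q; 0];
    [:: (Q ^+ 3)^-1 *: star (x2 q); 1 - Q ^+ 2 *: x0 q; 0; Q ^+ 3 *: x1 q];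
    [:: (- Q^-1) *: star (x1 q); 0; 1 - Q ^+ 2 *: x0 q; Q ^+ 3 *: x2 q];
    [:: 0; Q *: star (x1 q); (Q ^+ 3)^-1 *: star (x2 q); 1 + Q ^+ 4 *: x0 q]]
  i) j.

Lemma s4_idemE i j : s4_idem q i j = 2^-1 *: s4_entry i j.
Proof.
rewrite mxE; congr (_ *: _); rewrite /s4_entry !rmorphXn /= expr1 scale1r.
by rewrite !scaleNr.
Qed.

Lemma s4_entry_sq (i j : 'I_4) :
  s4_entry i 0 * s4_entry 0 j + s4_entry i 1 * s4_entry 1 j +
  s4_entry i 2 * s4_entry 2 j + s4_entry i 3 * s4_entry 3 j = 2 *: s4_entry i j.
Proof.
have r01 := rel01; have r02 := rel02; have r12 := rel12; have r1s0 := rel1s0.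
have r2s0 := rel2s0; have r1s2 := rel1s2; have r2s1 := rel2s1.
have r2s1s := rel2s1s; have r11 := rel11; have r22 := rel22.
have rs := rel_sphere; rewrite !rmorphXn /= in r01 r02 r12 r1s0 r2s0 r1s2 r2s1 r2s1s.
rewrite rmorphB !rmorphXn rmorph1 /= in r11 r22.
have Q0 : q%:C != 0 :> R[i] by apply: contra q0 => /eqP/complexI->.
set Q := (q%:C : R[i]) in Q0 r01 r02 r12 r1s0 r2s0 r1s2 r2s1 r2s1s r11 r22 *.
have e2 y : 1 - Q ^+ 2 *: y = 1 + (- Q ^+ 2) *: y :> A by rewrite scaleNr.
have e4 y : 1 + Q ^+ 4 *: y = 1 - (- Q ^+ 4) *: y :> A by rewrite scaleNr opprK.
have QQ : (- Q ^+ 2) ^+ 2 = Q ^+ 4 by rewrite sqrrN -exprM.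
rewrite scalerBl scale1r in r11.
case: i => [[|[|[|[|//]]]] hi]; case: j => [[|[|[|[|//]]]] hj] /=;
  rewrite /s4_entry /= -/Q ?mulr0 ?mul0r ?addr0 ?add0r ?scaler0.
- rewrite -addrA diag_entry // !mulZZ mulrNN !divff ?expf_neq0 // !scale1r.
  by rewrite expr1n scale1r [_ + x1 q * _]addrC addrA.
- by rewrite left_entry // scale1r.
- by rewrite left_entry // scale1r.
- by rewrite addrC (off_entry r12) //; ring.
- by rewrite right_entry // scale1r.
- rewrite addrAC e2 addrC diag_entry // QQ.
  rewrite !mulZZ mulVf ?expf_neq0 // scale1r r22 r11 -rs -exprSr.
  exact: zmod_cancel1.
- by rewrite (off_entry r2s1) //; field; rewrite Q0.
- rewrite e2 e4 left_entry // r01 !scalerA mulNr.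
  by rewrite -exprD.
- by rewrite right_entry // scale1r.
- by rewrite (off_entry r1s2) //; field; rewrite Q0.
- rewrite addrAC e2 addrC diag_entry // QQ.
  rewrite !mulZZ mulrNN mulVf // divff ?expf_neq0 // !scale1r r11 -rs.
  exact: zmod_cancel2.
- rewrite e2 e4 left_entry // r02 !scalerA mulNr.
  by rewrite -exprD.
- by rewrite addrC (off_entry r2s1s) //; field; rewrite Q0.
- rewrite e2 e4 right_entry // r1s0 !scalerA mulNr.
  by rewrite -exprD.
- rewrite e2 e4 right_entry // r2s0 !scalerA mulNr.
  by rewrite -exprD.
- rewrite addrC diag_entry // -exprM !mulZZ mulVf ?expf_neq0 // scale1r -exprS.
  rewrite r22 r11 -rs scalerDr scalerBr scalerA -exprD.
  exact: zmod_cancel3.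
Qed.

Lemma s4_idem_idempotent : idempotent_mx (s4_idem q).
Proof.
apply/matrixP => i j; rewrite mxE; under eq_bigr do rewrite !s4_idemE.
rewrite !big_ord_recl big_ord0 addr0 -!scalerAl -!scalerAr -!scalerDr s4_idemE.
rewrite !addrA s4_entry_sq !scalerA; congr (_ *: _).
by rewrite -mulrA mulVf ?mulr1 // pnatr_eq0.
Qed.

End QuantumSphereAlgebra.

(** * q-numbers and the telescoping sums *)

Section QNumbers.
Local Notation "[ z ]_ q" := (qnum q z) (at level 0, format "[ z ]_ q").
Variables (R : realType) (q : R).
Hypothesis q_gt0 : 0 < q.
Hypothesis q_lt1 : q < 1.

Lemma q_neq0 : q != 0. Proof. by rewrite gt_eqF. Qed.

Lemma qpowD x y : q `^ (x + y) = q `^ x * q `^ y.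
Proof. by rewrite powRD // q_neq0 implybT. Qed.
Lemma qpowN x : q `^ (- x) = (q `^ x)^-1.
Proof. by rewrite powRN. Qed.
Lemma qpowB x y : q `^ (x - y) = q `^ x / q `^ y.
Proof. by rewrite qpowD qpowN. Qed.
Lemma qpow_nat n : q `^ (n%:R) = q ^+ n.
Proof. by rewrite powR_mulrn // ltW. Qed.
Lemma qpow1 : q `^ 1 = q.
Proof. by rewrite powRr1 // ltW. Qed.
Lemma qpow0 : q `^ 0 = 1.
Proof. by rewrite powRr0. Qed.
Lemma qpowMn x n : q `^ (x *+ n) = (q `^ x) ^+ n.
Proof. by elim: n => [|n IH]; rewrite ?qpow0 // mulrS qpowD IH exprS. Qed.
Lemma qpow_le x y : x <= y -> q `^ y <= q `^ x.
Proof. by move=> xy; apply: ger_powR => //; rewrite q_gt0 ltW. Qed.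

Lemma qnumE z t : q `^ z = t -> [z]_q = (t - t^-1) / (q - q^-1).
Proof. by move=> <-; rewrite /qnum qpowN. Qed.

Lemma qqV_neq0 : q - q^-1 != 0.
Proof. by rewrite subr_eq0 lt_eqF // (lt_trans q_lt1) // invf_gt1. Qed.

Lemma qnat_neq0 (n : nat) : (0 < n)%N -> 1 - q ^+ n != 0.
Proof. by move=> n0; rewrite subr_eq0 eq_sym lt_eqF // exprn_ilt1 // ?ltW // -lt0n. Qed.

Definition kappa : R := (1 - q ^+ 2)^-1.

Lemma geom_sum (x : R) n : x != 1 -> \sum_(i < n) x ^+ i = (1 - x ^+ n) / (1 - x).
Proof.
move=> x1; have h : 1 - x != 0 by rewrite subr_eq0 eq_sym.
by apply/(canRL (mulfK h)); rewrite mulrC -opprB -[1 - _]opprB mulNr -subrX1.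
Qed.

(** Primitive of the coefficient A^0 summed over m1: for j = a + 1/2 the denominators [2j] and
    [2j + 2] of A^0 are those of [qlin] at 2a + 1 and 2a + 3. It is 1 at n = 1 and tends to 0, so
    the whole series is -[kappa]. *)
Definition qlin (n : nat) : R := n%:R / [n%:R]_q.

Lemma sum_coefA0 (a : nat) :
  \sum_(c < (2 * a + 2)%N) coefA0 q (a%:R + 2^-1) (c%:R - a%:R - 2^-1) =
  kappa * (qlin (2 * a + 3) - qlin (2 * a + 1)).
Proof.
set u := q ^+ a; pose den := [ (2 * a + 1)%:R ]_q * [ (2 * a + 3)%:R ]_q.
have u0 : u != 0 by rewrite expf_neq0 // q_neq0.
have q0 := q_neq0; have qq := qqV_neq0.
have q2 : 1 - q ^+ 2 != 0 by exact: qnat_neq0.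
have f2 : q * q - 1 != 0 by rewrite -oppr_eq0 opprB -expr2.
have E1 : [ (2 * a + 1)%:R ]_q = (u ^+ 2 * q - (u ^+ 2 * q)^-1) / (q - q^-1).
  by apply: qnumE; rewrite qpow_nat exprD mulnC exprM expr1.
have E3 : [ (2 * a + 3)%:R ]_q = (u ^+ 2 * q ^+ 3 - (u ^+ 2 * q ^+ 3)^-1) / (q - q^-1).
  by apply: qnumE; rewrite qpow_nat exprD mulnC exprM.
have E2 : [2]_q = (q ^+ 2 - (q ^+ 2)^-1) / (q - q^-1).
  by apply: qnumE; rewrite qpow_nat.
(* With c = j + m1, the product q^(c + 1) [j - m1] depends on c only through q^(2c), so the sum is a
   constant part plus a geometric series. *)
have term (c : nat) : coefA0 q (a%:R + 2^-1) (c%:R - a%:R - 2^-1) =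
  ((u ^+ 2 * q ^+ 2 / (q - q^-1) * [2]_q - [(2 * a + 1)%:R]_q)
    - [2]_q / (u ^+ 2 * (q - q^-1)) * (q ^+ 2) ^+ c) / (q ^+ 2 * den).
  rewrite /coefA0.
  have -> : 2 * (a%:R + 2^-1) = (2 * a + 1)%:R :> R by rewrite natrD natrM; field.
  have -> : (2 * a + 1)%:R + 2 = (2 * a + 3)%:R :> R by rewrite !natrD; ring.
  have -> : a%:R + 2^-1 + (c%:R - a%:R - 2^-1) + 1 = c.+1%:R :> R by rewrite -natr1; ring.
  have -> : a%:R + 2^-1 - (c%:R - a%:R - 2^-1) = (2 * a + 1)%:R - c%:R :> R.
    by rewrite natrD natrM; field.
  rewrite -/den qpowN !qpow_nat.
  have -> : [ (2 * a + 1)%:R - c%:R]_q =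
     (u ^+ 2 * q / q ^+ c - (u ^+ 2 * q / q ^+ c)^-1) / (q - q^-1).
    by apply: qnumE; rewrite qpowB !qpow_nat exprD mulnC exprM expr1.
  have -> : (q ^+ 2) ^+ c = (q ^+ c) ^+ 2 by rewrite -!exprM mulnC.
  rewrite (exprS q c); set y := q ^+ c; have y0 : y != 0 by rewrite expf_neq0.
  rewrite (invfM (q ^+ 2) den); set p2 := [2]_q; set p1 := [ (2 * a + 1)%:R ]_q.
  by move: (den^-1) => iden; field; rewrite y0 u0 f2 q0.
under eq_bigr do rewrite term.
rewrite -mulr_suml sumrB sumr_const card_ord -mulr_sumr.
rewrite geom_sum; last by rewrite -subr_eq0 -opprB oppr_eq0.
have -> : (q ^+ 2) ^+ (2 * a + 2) = u ^+ 4 * q ^+ 4.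
  by rewrite /u -!exprM -exprD; congr (_ ^+ _); lia.
have n1 : 1 - u ^+ 4 * q ^+ 2 != 0.
  by rewrite -exprM -exprD; apply: qnat_neq0; rewrite addn2.
have n3 : 1 - u ^+ 4 * q ^+ 6 != 0.
  by rewrite -exprM -exprD; apply: qnat_neq0; rewrite addnS.
rewrite /kappa /qlin /den -(mulr_natl _ (2 * a + 2)) E1 E2 E3.
have -> k : (2 * a + k)%:R = 2 * a%:R + k%:R :> R by rewrite natrD natrM.
have f1 : u ^+ 2 * q * (u ^+ 2 * q) - 1 != 0.
  by rewrite -oppr_eq0; move: n1; congr (_ != _); ring.
have f3 : u ^+ 2 * q ^+ 3 * (u ^+ 2 * q ^+ 3) - 1 != 0.
  by rewrite -oppr_eq0; move: n3; congr (_ != _); ring.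
by field; rewrite q0 f2 u0 f1 f3 q2.
Qed.

Lemma sum_pairs (f : nat -> R) n :
  \sum_(e < (2 * n)%N) f e = \sum_(i < n) (f (2 * i)%N + f (2 * i).+1).
Proof.
elim: n => [|n IH]; first by rewrite muln0 !big_ord0.
by rewrite mulnS add2n !big_ord_recr /= IH addrA.
Qed.

(** The exponent l + 1/2 - j - m2 is 2d + 1 - e, of parity opposite to that of e, so the sign
    alternates along the sum over m2. *)
Lemma epsE (a d e : nat) : (e <= 2 * d + 1)%N ->
  eps (a%:R + d%:R + 2^-1) (a%:R + 2^-1) (e%:R - d%:R - 2^-1) =
  2^-1 * (-1) ^+ e.+1 :> R.
Proof.
move=> ed; rewrite /eps.
have -> : a%:R + d%:R + 2^-1 + 2^-1 - (a%:R + 2^-1) - (e%:R - d%:R - 2^-1) =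
    ((2 * d + 1 - e)%N%:Z)%:~R :> R.
  by rewrite -[RHS]/((2 * d + 1 - e)%N%:R) (natrB _ ed) natrD natrM; field.
rewrite intrKfloor -[_ ^ _]/((-1) ^+ (2 * d + 1 - e)); congr (_ * _).
by rewrite -signr_odd -[RHS]signr_odd; congr (_ ^+ _); lia.
Qed.

(* The summand telescopes: the sum over [m2] of [H^0] is a difference of two
   values of [qU], and the sum over [m1] of [A^0] one of values of [qlin]. *)
Definition qU (a n : nat) : R :=
  ((q ^+ (2 * a + 2) + (q ^+ (2 * a + 2))^-1) / 2 * (n%:R - (2 * a + 2)%:R)
   + [2]_q * [ (2 * a + 2)%:R ]_q / 2) / [n%:R]_q.

Lemma sum_coefH0 (a d : nat) :
  \sum_(e < (2 * d + 2)%N)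
     coefH0 q (a%:R + d%:R + 2^-1) (a%:R + 2^-1) (e%:R - d%:R - 2^-1) =
  kappa * (qU a (2 * a + 2 * d + 5) - qU a (2 * a + 2 * d + 3)).
Proof.
set u := q ^+ a; set v := q ^+ d.
pose den := [ (2 * a + 2 * d + 3)%:R ]_q * [ (2 * a + 2 * d + 5)%:R ]_q.
have u0 : u != 0 by rewrite expf_neq0 // q_neq0.
have v0 : v != 0 by rewrite expf_neq0 // q_neq0.
have q0 := q_neq0; have qq := qqV_neq0.
have q2 : 1 - q ^+ 2 != 0 by exact: qnat_neq0.
have q4 : 1 - q ^+ 4 != 0 by exact: qnat_neq0.
have f2 : q * q - 1 != 0 by rewrite -oppr_eq0 opprB -expr2.
have pw (k l m : nat) : q ^+ (2 * k + 2 * l + m) = (q ^+ k) ^+ 2 * (q ^+ l) ^+ 2 * q ^+ m.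
  by rewrite -!exprM -!exprD; congr (_ ^+ _); lia.
have qn (n : nat) t : q ^+ n = t -> [n%:R]_q = (t - t^-1) / (q - q^-1).
  by move=> h; apply: qnumE; rewrite qpow_nat.
have E3 := qn _ _ (pw a d 3%N); have E5 := qn _ _ (pw a d 5%N).
have E2 := qn 2%N _ erefl; rewrite -/u -/v in E3 E5.
have Ea : [ (2 * a + 2)%:R ]_q = (u ^+ 2 * q ^+ 2 - (u ^+ 2 * q ^+ 2)^-1) / (q - q^-1).
  by apply: qn; rewrite -exprM -exprD; congr (_ ^+ _); lia.
have natM k : (2 * k)%:R = 2 * k%:R :> R by rewrite natrM.
have natE k l m : (2 * k + 2 * l + m)%:R = 2 * k%:R + 2 * l%:R + m%:R :> R.
  by rewrite natrD natrD !natM.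
(* Two consecutive values of m2 carry opposite signs of [eps]. In the sum of the two terms only
   q^(4i) depends on i, which leaves a geometric series again. *)
have pair (i : nat) : (i <= d)%N ->
  coefH0 q (a%:R + d%:R + 2^-1) (a%:R + 2^-1) ((2 * i)%:R - d%:R - 2^-1) +
  coefH0 q (a%:R + d%:R + 2^-1) (a%:R + 2^-1) ((2 * i).+1%:R - d%:R - 2^-1) =
  ((1 - (q ^+ 2)^-1) * (u ^+ 2 * v ^+ 2 * q ^+ 4 + (u ^+ 2 * v ^+ 2 * q ^+ 4)^-1)
       * (u ^+ 2 * q ^+ 2 + (u ^+ 2 * q ^+ 2)^-1)
   + ((q ^+ 3)^-1 - q) * (1 + q ^+ 2) / (v ^+ 2 * q) * (q ^+ 4) ^+ i)
  / (q - q^-1) ^+ 2 / den.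
  move=> id; have sg0 : (-1) ^+ (2 * i).+1 = -1 :> R by rewrite -signr_odd /= oddM.
  have sg1 : (-1) ^+ (2 * i).+2 = 1 :> R by rewrite -signr_odd /= oddM.
  rewrite /coefH0 !epsE ?sg0 ?sg1; try lia.
  have -> : 2 * (a%:R + d%:R + 2^-1) + 2 = (2 * a + 2 * d + 3)%:R :> R.
    by rewrite !natE ?natM; field.
  have -> : 2 * (a%:R + d%:R + 2^-1) + 4 = (2 * a + 2 * d + 5)%:R :> R.
    by rewrite !natE ?natM; field.
  rewrite -/den -mulrDl.
  (* All arguments are brought to the shape [2 * k + 2 * l + m], with zeros where necessary, so that
     the single formula [qi] evaluates them. *)
  have z1 : a%:R + d%:R + 2^-1 - 2^-1 * -1 * (2 * (a%:R + 2^-1) + 1) -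
     ((2 * i)%:R - d%:R - 2^-1) + 1 = (2 * a + 2 * (d - i) + 3)%:R :> R.
    by rewrite !natE ?natM natrB //; field.
  have z2 : a%:R + d%:R + 2^-1 - 2^-1 * -1 * (2 * (a%:R + 2^-1) + 1) +
     ((2 * i)%:R - d%:R - 2^-1) + 2 = (2 * a + 2 * i + 3)%:R :> R.
    by rewrite !natE ?natM; field.
  have z3 : a%:R + d%:R + 2^-1 + 2^-1 * -1 * (2 * (a%:R + 2^-1) + 1) -
     ((2 * i)%:R - d%:R - 2^-1) + 2 = (2 * 0 + 2 * (d - i) + 2)%:R :> R.
    by rewrite !natE ?natM natrB //; field.
  have z4 : a%:R + d%:R + 2^-1 + 2^-1 * -1 * (2 * (a%:R + 2^-1) + 1) +
     ((2 * i)%:R - d%:R - 2^-1) + 1 = (2 * 0 + 2 * i + 0)%:R :> R.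
    by rewrite !natE ?natM; field.
  have y1 : a%:R + d%:R + 2^-1 - 2^-1 * 1 * (2 * (a%:R + 2^-1) + 1) -
     ((2 * i).+1%:R - d%:R - 2^-1) + 1 = (2 * 0 + 2 * (d - i) + 0)%:R :> R.
    by rewrite -natr1 !natE ?natM natrB //; field.
  have y2 : a%:R + d%:R + 2^-1 - 2^-1 * 1 * (2 * (a%:R + 2^-1) + 1) +
     ((2 * i).+1%:R - d%:R - 2^-1) + 2 = (2 * 0 + 2 * i + 2)%:R :> R.
    by rewrite -natr1 !natE ?natM; field.
  have y3 : a%:R + d%:R + 2^-1 + 2^-1 * 1 * (2 * (a%:R + 2^-1) + 1) -
     ((2 * i).+1%:R - d%:R - 2^-1) + 2 = (2 * a + 2 * (d - i) + 3)%:R :> R.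
    by rewrite -natr1 !natE ?natM natrB //; field.
  have y4 : a%:R + d%:R + 2^-1 + 2^-1 * 1 * (2 * (a%:R + 2^-1) + 1) +
     ((2 * i).+1%:R - d%:R - 2^-1) + 1 = (2 * a + 2 * i + 3)%:R :> R.
    by rewrite -natr1 !natE ?natM; field.
  rewrite z1 z2 z3 z4 y1 y2 y3 y4.
  have qi k l m := qn _ _ (pw k l m); rewrite !qi qpowN qpow_nat.
  have -> : q ^+ (d - i) = v / q ^+ i.
    by rewrite /v -{2}(subnK id) exprD mulfK // expf_neq0.
  have -> : (q ^+ 4) ^+ i = (q ^+ i) ^+ 4 by rewrite -!exprM mulnC.
  have y0 : q ^+ i != 0 by rewrite expf_neq0.
  rewrite -/u !expr0 ; move: (q ^+ i) y0 (den^-1) => y y0 iden.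
  by field; rewrite ?q0 ?f2 ?u0 ?v0 ?y0.
rewrite (_ : 2 * d + 2 = 2 * d.+1)%N; last lia.
rewrite (sum_pairs (fun e => coefH0 q _ _ (e%:R - _ - _))).
under eq_bigr => i _ do rewrite (pair i (ltn_ord i)).
rewrite -!mulr_suml big_split /= sumr_const card_ord -mulr_sumr.
rewrite geom_sum; last by rewrite -subr_eq0 -opprB oppr_eq0.
have -> : (q ^+ 4) ^+ d.+1 = v ^+ 4 * q ^+ 4.
  by rewrite /v -!exprM -exprD; congr (_ ^+ _); lia.
rewrite /kappa /qU /den -(mulr_natl _ d.+1) E2 E3 E5 Ea.
rewrite !natE.
have -> : (2 * a + 2)%:R = 2 * a%:R + 2 :> R by rewrite natrD natrM.
have -> : q ^+ (2 * a + 2) = u ^+ 2 * q ^+ 2.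
  by rewrite -exprM -exprD; congr (_ ^+ _); lia.
have -> : d.+1%:R = d%:R + 1 :> R by rewrite natr1.
have n3 : 1 - q ^+ (4 * a + 4 * d + 6) != 0 by apply: qnat_neq0; rewrite addnS.
have n5 : 1 - q ^+ (4 * a + 4 * d + 10) != 0 by apply: qnat_neq0; rewrite addnS.
have uv4 : q ^+ (4 * a + 4 * d) = (u * v) ^+ 4.
  by rewrite -exprD -exprM; congr (_ ^+ _); lia.
have f3 : (u * v) ^+ 2 * q ^+ 3 * ((u * v) ^+ 2 * q ^+ 3) - 1 != 0.
  by rewrite -oppr_eq0; move: n3; rewrite exprD uv4; congr (_ != _); ring.
have f5 : (u * v) ^+ 2 * q ^+ 5 * ((u * v) ^+ 2 * q ^+ 5) - 1 != 0.
  by rewrite -oppr_eq0; move: n5; rewrite exprD uv4; congr (_ != _); ring.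
by field; rewrite q0 f2 v0 u0 f3 f5 q2 q4.
Qed.

Lemma qnum1 : [1]_q = 1.
Proof. by rewrite (qnumE qpow1) divff // qqV_neq0. Qed.

Lemma qlin1 : qlin 1 = 1.
Proof. by rewrite /qlin qnum1 divr1. Qed.

(** The argument 2a + 3 is 2l + 2 at l = j, where the sum over l begins. That the value does not
    depend on a makes the sum over l at fixed j tend to -[kappa] for every j. *)
Lemma qU_start a : qU a (2 * a + 3) = 1.
Proof.
have q0 := q_neq0; have qq := qqV_neq0.
have f2 : q * q - 1 != 0.
  by rewrite -oppr_eq0 opprB -expr2; exact: qnat_neq0.
have u0 : q ^+ a != 0 by rewrite expf_neq0.
have qn (n m : nat) : [(2 * a + m)%:R]_q =
    ((q ^+ a) ^+ 2 * q ^+ m - ((q ^+ a) ^+ 2 * q ^+ m)^-1) / (q - q^-1).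
  apply: qnumE; rewrite qpow_nat -exprM -exprD; congr (_ ^+ _); lia.
have E2 : [2]_q = (q ^+ 2 - (q ^+ 2)^-1) / (q - q^-1).
  by apply: qnumE; rewrite qpow_nat.
rewrite /qU !(qn 0%N) E2 -natrB; last lia.
have -> : (2 * a + 3 - (2 * a + 2) = 1)%N by lia.
have -> : q ^+ (2 * a + 2) = (q ^+ a) ^+ 2 * q ^+ 2.
  by rewrite -exprM -exprD; congr (_ ^+ _); lia.
have n3 : 1 - q ^+ (4 * a + 6) != 0 by apply: qnat_neq0; rewrite addnS.
set u := q ^+ a in u0 *.
have f3 : u ^+ 2 * q ^+ 3 * (u ^+ 2 * q ^+ 3) - 1 != 0.
  rewrite -oppr_eq0; move: n3; rewrite exprD mulnC exprM -/u; congr (_ != _); ring.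
by field; rewrite q0 f2 u0 f3.
Qed.

Lemma sum_SA N : \sum_(a < N) \sum_(c < (2 * a + 2)%N)
    coefA0 q (a%:R + 2^-1) (c%:R - a%:R - 2^-1) = kappa * (qlin (2 * N + 1) - 1).
Proof.
under eq_bigr do rewrite sum_coefA0.
elim: N => [|N IH]; first by rewrite big_ord0 qlin1 subrr mulr0.
rewrite big_ord_recr /= IH -mulrDr; congr (_ * _).
by rewrite (_ : 2 * N.+1 + 1 = 2 * N + 3)%N; [ring | lia].
Qed.

Lemma sum_SH a N : \sum_(d < N) \sum_(e < (2 * d + 2)%N)
    coefH0 q (a%:R + d%:R + 2^-1) (a%:R + 2^-1) (e%:R - d%:R - 2^-1) =
  kappa * (qU a (2 * a + 2 * N + 3) - 1).
Proof.
under eq_bigr do rewrite sum_coefH0.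
elim: N => [|N IH]; first by rewrite big_ord0 muln0 addn0 qU_start subrr mulr0.
rewrite big_ord_recr /= IH -mulrDr; congr (_ * _).
by rewrite (_ : 2 * a + 2 * N.+1 + 3 = 2 * a + 2 * N + 5)%N; [ring | lia].
Qed.

Lemma qnumN z : [z]_q = (q `^ (- z) - q `^ z) / (q^-1 - q).
Proof. by rewrite /qnum -[q^-1 - q]opprB invrN mulrN -mulNr opprB. Qed.

Lemma qVq_gt0 : 0 < q^-1 - q.
Proof. by rewrite subr_gt0 (lt_trans q_lt1) // invf_gt1. Qed.

Lemma qnum_ge0 z : 0 <= z -> 0 <= [z]_q.
Proof.
move=> z0; rewrite qnumN divr_ge0 ?(ltW qVq_gt0) // subr_ge0 qpow_le //.
by rewrite (le_trans _ z0) // oppr_le0.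
Qed.

Lemma qlin_ge0 n : 0 <= qlin n.
Proof. by rewrite divr_ge0 ?qnum_ge0. Qed.

(** Each of the n powers x^i with i < n is at least x^n, and their sum is at most 1/(1 - x). *)
Lemma natr_expr_le (x : R) n : 0 <= x -> x < 1 -> n%:R * x ^+ n <= (1 - x)^-1.
Proof.
move=> x0 x1; have h : 0 < 1 - x by rewrite subr_gt0.
apply: (@le_trans _ _ (\sum_(i < n) x ^+ i)).
  rewrite mulr_natl -[X in _ *+ X]card_ord -sumr_const; apply: ler_sum => i _.
  by apply: ler_wiXn2l => //; [exact: ltW | exact: ltnW].
rewrite geom_sum ?lt_eqF // ler_pdivrMr // mulVf ?gt_eqF //.
by rewrite gerBl exprn_ge0.
Qed.

(** 1/[n] is q^(n - 1) times (1 - q^2)/(1 - q^(2n)), and the last quotient is at most 1. *)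
Lemma qlin_le n : qlin n <= n%:R * q ^+ n / q.
Proof.
case: n => [|n]; first by rewrite /qlin !mul0r.
rewrite /qlin -mulrA ler_wpM2l // /qnum.
have q0 := q_neq0; have n0 : q ^+ n.+1 != 0 by rewrite expf_neq0.
have f2 : 1 - q * q != 0 by rewrite -expr2; exact: qnat_neq0.
have fn : 1 - (q ^+ n.+1) ^+ 2 != 0 by rewrite -exprM; apply: qnat_neq0; rewrite muln_gt0.
have f2' : q * q - 1 != 0 by rewrite -oppr_eq0 opprB.
have fn' : q ^+ n.+1 * q ^+ n.+1 - 1 != 0 by rewrite -oppr_eq0 opprB -expr2.
have -> : ((q `^ n.+1%:R - q `^ (- n.+1%:R)) / (q - q^-1))^-1 =
    q ^+ n.+1 / q * ((1 - q ^+ 2) / (1 - (q ^+ n.+1) ^+ 2)).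
  rewrite qpowN qpow_nat; move: (q ^+ n.+1) n0 fn fn' => y y0 fn fn'.
  by field; rewrite ?q0 ?y0 ?fn ?fn' ?f2'.
apply: ler_piMr; first by rewrite divr_ge0 ?exprn_ge0 // ltW.
have yle : (q ^+ n.+1) ^+ 2 <= q ^+ 2.
  rewrite -exprM mulSn exprD ler_piMr ?exprn_ge0 ?exprn_ile1 // ltW //.
rewrite ler_pdivrMr; first by rewrite mul1r lerD2l lerN2.
by rewrite lt_def fn subr_ge0 -exprM exprn_ile1 // ltW.
Qed.

(** With s the square root of q, n^2 q^n = (n s^n)^2 is bounded by c^2, so [qlin n] is at most
    c^2/(q n). *)
Lemma qlin_lim (X e : R) : 0 <= X -> 0 < e ->
  exists n0, forall n, (n0 <= n)%N -> X * qlin n <= e.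
Proof.
move=> X0 e0; pose s := Num.sqrt q.
have s0 : 0 <= s by rewrite sqrtr_ge0.
have s1 : s < 1 by rewrite -sqrtr1 ltr_sqrt.
have ss : s ^+ 2 = q by rewrite sqr_sqrtr // ltW.
pose c := (1 - s)^-1; have c0 : 0 <= c by rewrite invr_ge0 subr_ge0 ltW.
exists (Num.truncn (X * (c ^+ 2 / q) / e)).+1 => n hn.
have n0 : 0 < n%:R :> R by rewrite ltr0n; exact: leq_trans hn.
have h1 : n%:R * s ^+ n <= c by exact: natr_expr_le.
have h2 : qlin n * n%:R <= c ^+ 2 / q.
  apply: (@le_trans _ _ (n%:R * q ^+ n / q * n%:R)).
    by rewrite ler_wpM2r // qlin_le.
  rewrite mulrAC ler_wpM2r ?invr_ge0 ?(ltW q_gt0) //.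
  rewrite -ss -exprM mulnC exprM.
  have -> : n%:R * (s ^+ n) ^+ 2 * n%:R = (n%:R * s ^+ n) ^+ 2 by ring.
  by rewrite ler_sqr ?nnegrE // mulr_ge0 // exprn_ge0.
have h3 : X * (c ^+ 2 / q) / e <= n%:R.
  apply: le_trans (ltW (truncnS_gt _)) _; by rewrite ler_nat.
rewrite -(ler_pM2r n0) -mulrA; apply: le_trans (ler_wpM2l X0 h2) _.
by rewrite -ler_pdivrMl // mulrC.
Qed.

(** For n >= 2a + 2 the factor n - (2a + 2) lies between 0 and n. The constant contains q^(-(2a +
    2)), so the decay is not uniform in a. *)
Lemma qU_le a : exists2 K : R, 0 <= K & forall n, (2 * a + 2 <= n)%N ->
  `|qU a n| <= K * qlin n.
Proof.
set c := (q ^+ (2 * a + 2) + (q ^+ (2 * a + 2))^-1) / 2.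
set D := [2]_q * [ (2 * a + 2)%:R ]_q / 2.
have c0 : 0 <= c.
  by rewrite divr_ge0 // addr_ge0 ?invr_ge0 ?exprn_ge0 // ltW.
exists (c + `|D|) => [|n hn]; first by rewrite addr_ge0.
have n0 : 0 < n%:R :> R by rewrite ltr0n (leq_trans _ hn) // addn2.
have nq : 0 <= [n%:R]_q^-1.
  by have := qlin_ge0 n; rewrite /qlin pmulr_rge0.
rewrite /qU -/c -/D normrM (ger0_norm nq) /qlin mulrA ler_wpM2r //.
apply: le_trans (ler_normD _ _) _; rewrite mulrDl; apply: lerD.
  rewrite -natrB // normrM (ger0_norm c0) ler_wpM2l // ger0_norm //.
  by rewrite ler_nat leq_subr.
by rewrite ler_peMr // ler1n -(ltr0n R).
Qed.

(** The cut-off N in j is chosen first and makes the remainder [kappa ^+ 2 * qlin (2 * N + 1)]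
    small. The cut-off M in l - j is chosen afterwards and beats the N boundary terms with their
    constants [K a]. The lower bound [n0] lets the range contain any prescribed finite set of
    labels. *)
Lemma double_sum_near (e : R) n0 : 0 < e -> exists N M, [/\ (n0 <= N)%N, (n0 <= M)%N &
  `|\sum_(a < N) \sum_(d < M) (\sum_(c < (2 * a + 2)%N)
      coefA0 q (a%:R + 2^-1) (c%:R - a%:R - 2^-1)) *
    (\sum_(e < (2 * d + 2)%N)
      coefH0 q (a%:R + d%:R + 2^-1) (a%:R + 2^-1) (e%:R - d%:R - 2^-1))
   - kappa ^+ 2| <= e].
Proof.
move=> e0; have e2 : 0 < e / 2 by rewrite divr_gt0.
have k0 : 0 <= kappa by rewrite invr_ge0 subr_ge0 exprn_ile1 // ltW.
have [n1 h1] := qlin_lim (sqr_ge0 kappa) e2.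
pose N := maxn n0 n1.
pose SA (a : nat) := \sum_(c < (2 * a + 2)%N)
      coefA0 q (a%:R + 2^-1) (c%:R - a%:R - 2^-1).
pose K a := s2val (cid2 (qU_le a)).
have K0 a : 0 <= K a by rewrite /K; case: cid2.
have hK a n : (2 * a + 2 <= n)%N -> `|qU a n| <= K a * qlin n.
  by rewrite /K; case: cid2 => ? ? /= h; exact: h.
pose X := \sum_(a < N) `|SA a * kappa| * K a.
have X0 : 0 <= X by apply: sumr_ge0 => a _; rewrite mulr_ge0.
have d0 : 0 < e / 2 / (X + 1) by rewrite divr_gt0 // ltr_wpDl.
have [n2 h2] := qlin_lim ler01 d0.
exists N, (maxn n0 n2); split; rewrite ?leq_maxl //.
set M := maxn n0 n2.
have -> : \sum_(a < N) \sum_(d < M) SA a * (\sum_(e < (2 * d + 2)%N)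
      coefH0 q (a%:R + d%:R + 2^-1) (a%:R + 2^-1) (e%:R - d%:R - 2^-1)) - kappa ^+ 2
   = \sum_(a < N) SA a * kappa * qU a (2 * a + 2 * M + 3)
     - kappa ^+ 2 * qlin (2 * N + 1).
  under eq_bigr do rewrite -mulr_sumr sum_SH mulrA mulrBr mulr1.
  rewrite sumrB -mulr_suml sum_SA; ring.
apply: le_trans (ler_normB _ _) _.
have : `|kappa ^+ 2 * qlin (2 * N + 1)| <= e / 2.
  rewrite ger0_norm; last by apply: mulr_ge0; [exact: sqr_ge0 | exact: qlin_ge0].
  apply: h1.
  by rewrite (leq_trans (leq_maxr n0 n1)) // -/N; lia.
have : `|\sum_(a < N) SA a * kappa * qU a (2 * a + 2 * M + 3)| <= e / 2.
  have : X * (e / 2 / (X + 1)) <= e / 2.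
    by rewrite mulrCA ler_piMr ?(ltW e2) // ler_pdivrMr ?ltr_wpDl // mul1r lerDl.
  apply: le_trans; apply: le_trans (ler_norm_sum _ _ _) _.
  rewrite /X mulr_suml; apply: ler_sum => a _; rewrite normrM -mulrA.
  rewrite ler_wpM2l //; apply: le_trans (hK _ _ _) _; first by lia.
  rewrite ler_wpM2l //; rewrite -[qlin _]mul1r; apply: h2.
  by rewrite (leq_trans (leq_maxr n0 n2)) // -/M; lia.
by lra.
Qed.
End QNumbers.

(** * Bounds on the coefficients *)

Section Bounds.
Local Notation "[ z ]_ q" := (qnum q z) (at level 0, format "[ z ]_ q").
Variables (R : realType) (q : R).
Hypothesis q_gt0 : 0 < q.
Hypothesis q_lt1 : q < 1.

(* [x = O(q^e)] with an explicit constant. *)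
Definition bd (C e x : R) := 0 <= C /\ `|x| <= C * q `^ e.

Lemma bdM C D e f x y : bd C e x -> bd D f y -> bd (C * D) (e + f) (x * y).
Proof.
move=> [C0 h] [D0 k]; split; first exact: mulr_ge0.
by rewrite normrM qpowD // mulrACA; apply: ler_pM.
Qed.

(** Only the part of an exponent that is linear in the labels matters. The margin 20 is generous
    enough to absorb all constant offsets, so that a linear inequality for [lra] remains. *)
Lemma bd_slack C e f x : f <= e + 20 -> bd C e x -> bd (C * q `^ (- 20)) f x.
Proof.
move=> fe [C0 h]; split; first by rewrite mulr_ge0 // powR_ge0.
apply: le_trans h _; rewrite -mulrA -qpowD // ler_wpM2l // qpow_le //.
by lra.
Qed.

Lemma bd_weaken C e f x : f <= e -> bd C e x -> bd C f x.
Proof.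
by move=> fe [C0 h]; split=> //; apply: le_trans h _; rewrite ler_wpM2l // qpow_le.
Qed.

Lemma bdD C D e f g x y : g <= e -> g <= f -> bd C e x -> bd D f y -> bd (C + D) g (x + y).
Proof.
move=> ge gf /(bd_weaken ge)[C0 h] /(bd_weaken gf)[D0 k]; split; first exact: addr_ge0.
by rewrite mulrDl; apply: le_trans (ler_normD _ _) _; apply: lerD.
Qed.

Lemma bdN C e x : bd C e x -> bd C e (- x).
Proof. by case=> C0 h; split=> //; rewrite normrN. Qed.

Lemma bd_pow e : bd 1 e (q `^ e).
Proof. by split=> //; rewrite mul1r ger0_norm // powR_ge0. Qed.

Lemma bd_cst c : bd `|c| 0 c.
Proof. by split=> //; rewrite powRr0 mulr1. Qed.

Lemma bd_qnum z : 0 <= z -> bd (q^-1 - q)^-1 (- z) [z]_q.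
Proof.
move=> z0; split; first by rewrite invr_ge0 ltW // qVq_gt0.
rewrite ger0_norm ?qnum_ge0 // qnumN mulrC ler_wpM2l //.
  by rewrite invr_ge0 ltW // qVq_gt0.
by rewrite gerBl powR_ge0.
Qed.

(** For z >= 1 one has q^(2z) <= q^2, hence [z] = q^(1 - z) (1 - q^(2z))/(1 - q^2) >= q^(1 - z). *)
Lemma bd_qnumV z : 1 <= z -> bd q^-1 z [z]_q^-1.
Proof.
move=> z1; split; first by rewrite invr_ge0 ltW.
have z0 : 0 <= z by lra.
have K := qVq_gt0 q_gt0 q_lt1.
have P : 0 < q `^ (- z) - q `^ z.
  have h1 : q `^ z <= q by rewrite -[X in _ <= X]qpow1 // qpow_le.
  have h2 : 1 <= q `^ (- z) by rewrite -(qpow0 q) qpow_le // oppr_le0.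
  by rewrite subr_gt0 (lt_le_trans _ h2) // (le_lt_trans h1).
rewrite ger0_norm ?invr_ge0 ?qnum_ge0 // qnumN invf_div.
rewrite ler_pdivrMr // -mulrA mulrBr -qpowD // subrr powRr0.
have h : q `^ z * q `^ z <= q ^+ 2.
  by rewrite -qpowD // -qpow_nat // qpow_le //; lra.
have -> : q^-1 - q = q^-1 * (1 - q ^+ 2) by field; rewrite gt_eqF.
by rewrite ler_wpM2l ?invr_ge0 ?(ltW q_gt0) // lerD2l lerN2.
Qed.

Lemma bd_sqrt C D e f x y : bd C e x -> bd D f y ->
  bd (Num.sqrt (C * D)) ((e + f) / 2) (Num.sqrt (x * y)).
Proof.
move=> hx hy; have [C0 h] := bdM hx hy; split; first by rewrite sqrtr_ge0.
rewrite ger0_norm ?sqrtr_ge0 //.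
have -> : q `^ ((e + f) / 2) = Num.sqrt (q `^ (e + f)).
  have -> : q `^ (e + f) = q `^ ((e + f) / 2) ^+ 2.
    by rewrite -qpowMn //; congr (_ `^ _); rewrite mulr2n; field.
  by rewrite sqrtr_sqr ger0_norm // powR_ge0.
by rewrite -sqrtrM // ler_wsqrtr // (le_trans (ler_norm _)).
Qed.

Lemma eps_cases (l j m : R) : eps l j m = 2^-1 \/ eps l j m = - 2^-1.
Proof.
rewrite /eps; case: (Num.floor _) => n.
  rewrite -[_ ^ _]/((-1) ^+ n) -signr_odd; case: (odd n); rewrite ?expr0 ?expr1;
  by [right; rewrite mulrN1 | left; rewrite mulr1].
rewrite -[_ ^ _]/(((-1) ^+ n.+1)^-1) -signr_odd; case: (odd n.+1); rewrite ?expr0 ?expr1.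
  by right; rewrite invrN1 mulrN1.
by left; rewrite invr1 mulr1.
Qed.

Lemma admissible_bounds (l m1 m2 j : R) : admissible (l, m1, m2, j) ->
  [/\ 2^-1 <= j, j <= l, - j <= m1 <= j & - (l + 2^-1 - j) <= m2 <= l + 2^-1 - j].
Proof.
move=> /and5P[_ /natrP[a ha] /natrP[d hd] /natrP[k hk] /natrP[n hn]].
have a0 : 0 <= j - 2^-1 by rewrite ha.
have d0 : 0 <= l - j by rewrite hd.
have k0 : 0 <= j - `|m1| by rewrite hk.
have n0 : 0 <= l + 2^-1 - j - `|m2| by rewrite hn.
split; rewrite -?ler_norml; lra.
Qed.

Definition bound_cond (P : R -> R -> R -> R -> Prop) (f : R -> R -> R -> R -> R) :=
  exists C, forall l m1 m2 j, P l m1 m2 j -> bd C (2 * l) (f l m1 m2 j).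

Notation adm := (fun l m1 m2 j => admissible (l, m1, m2, j)).

Lemma bd_qnum4 (e : R) : e = 2^-1 \/ e = - 2^-1 -> bd `|[2]_q| 0 [4 * e]_q.
Proof.
move=> he; have -> : `|[2]_q| = `|[4 * e]_q|; last exact: bd_cst.
case: he => ->; first by congr (`|[_]_q|); field.
have -> : 4 * - 2^-1 = - 2 :> R by field.
by rewrite /qnum opprK -[q `^ (- 2) - _]opprB mulNr normrN.
Qed.

Lemma bd_C0 : bound_cond adm (fun l m1 m2 j => coefC0 q l j m2).
Proof.
eexists=> l m1 m2 j /admissible_bounds[j1 jl /andP[m1a m1b] /andP[m2a m2b]].
have he := eps_cases l j m2; rewrite /coefC0.
move: (eps l j m2) he => e he; apply: bd_slack; last first.
  apply: bdM; last by rewrite invfM; apply: bdM; apply: bd_qnumV; lra.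
  apply: bdM; first by apply: bdM; [exact: bd_qnum4 | exact: bd_pow].
  by apply: bd_sqrt; apply: bd_qnum; case: he => ->; lra.
by case: he => ->; lra.
Qed.

(** The loss of q^(-2j) comes from the product of two q-numbers that involve l + j; it is made up
    for by the factor q^(2j) in A^0 and B^0. *)
Lemma bd_H0 : exists C, forall l m1 m2 j, admissible (l, m1, m2, j) ->
  bd C (2 * l - 2 * j - 10) (coefH0 q l j m2).
Proof.
eexists=> l m1 m2 j /admissible_bounds[j1 jl /andP[m1a m1b] /andP[m2a m2b]].
have he := eps_cases l j m2; rewrite /coefH0.
move: (eps l j m2) he => e he; apply: bd_weaken; last first.
  apply: bdM; last by rewrite invfM; apply: bdM; apply: bd_qnumV; lra.
  apply: (@bdD _ _ _ _ (- 2 * l - 2 * j - 10)); last first.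
  - apply: bdN; apply: bdM; last by apply: bd_qnum; case: he => ->; lra.
    by apply: bdM; [exact: bd_pow | apply: bd_qnum; case: he => ->; lra].
  - by apply: bdM; apply: bd_qnum; case: he => ->; lra.
  - by case: he => ->; lra.
  - by case: he => ->; lra.
by lra.
Qed.

Lemma bound_A0H0 : bound_cond adm (fun l m1 m2 j => coefA0 q j m1 * coefH0 q l j m2).
Proof.
have [C hC] := bd_H0.
eexists=> l m1 m2 j hadm; have hH := hC _ _ _ _ hadm.
move: hadm => /admissible_bounds[j1 jl /andP[m1a m1b] /andP[m2a m2b]].
apply: bd_slack; last first.
  apply: bdM; last exact: hH.
  apply: bdM; last by rewrite invfM; apply: bdM; apply: bd_qnumV; lra.
  apply: bdM; first exact: bd_pow.
  apply: (@bdD _ _ _ _ (- 2 * j - 1)); last first.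
  - by apply: bdN; apply: bd_qnum; lra.
  - by apply: bdM; [apply: bdM; [exact: bd_pow|exact: bd_cst] | apply: bd_qnum; lra].
  - by lra.
  - by lra.
by lra.
Qed.

Lemma bound_B0H0 : bound_cond adm (fun l m1 m2 j => coefB0 q j m1 * coefH0 q l j m2).
Proof.
have [C hC] := bd_H0.
eexists=> l m1 m2 j hadm; have hH := hC _ _ _ _ hadm.
move: hadm => /admissible_bounds[j1 jl /andP[m1a m1b] /andP[m2a m2b]].
apply: bd_slack; last first.
  apply: bdM; last exact: hH.
  apply: bdM; last by rewrite invfM; apply: bdM; apply: bd_qnumV; lra.
  apply: bdM; first by apply: bdM; [exact: bd_cst | exact: bd_pow].
  by apply: bd_sqrt; apply: bd_qnum; lra.
by lra.
Qed.

Lemma bound_ApC0 : bound_cond adm (fun l m1 m2 j => coefAp q j m1 * coefC0 q l j m2).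
Proof.
have [C hC] := bd_C0.
eexists=> l m1 m2 j hadm; have hc := hC _ _ _ _ hadm.
move: hadm => /admissible_bounds[j1 jl /andP[m1a m1b] /andP[m2a m2b]].
apply: bd_slack; last first.
  apply: bdM; last exact: hc.
  apply: bdM; last by apply: bd_qnumV; lra.
  by apply: bdM; [exact: bd_pow | apply: bd_sqrt; apply: bd_qnum; lra].
by lra.
Qed.

Lemma bound_BpC0 : bound_cond adm (fun l m1 m2 j => coefBp q j m1 * coefC0 q l j m2).
Proof.
have [C hC] := bd_C0.
eexists=> l m1 m2 j hadm; have hc := hC _ _ _ _ hadm.
move: hadm => /admissible_bounds[j1 jl /andP[m1a m1b] /andP[m2a m2b]].
apply: bd_slack; last first.
  apply: bdM; last exact: hc.
  apply: bdM; last by apply: bd_qnumV; lra.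
  by apply: bdM; [exact: bd_pow | apply: bd_sqrt; apply: bd_qnum; lra].
by lra.
Qed.

(** Here the admissible label is that of the target ket, since C^0 is taken at j - 1 and its
    estimate asks for an admissible label there. For other targets the ket is zero. *)
Lemma bound_BmC0 : bound_cond (fun l m1 m2 j => admissible (l, m1 + 1, m2, j - 1))
  (fun l m1 m2 j => coefBm q j m1 * coefC0 q l (j - 1) m2).
Proof.
have [C hC] := bd_C0.
eexists=> l m1 m2 j hadm; have hc := hC _ _ _ _ hadm.
move: hadm => /admissible_bounds[j1 jl /andP[m1a m1b] /andP[m2a m2b]].
apply: bd_slack; last first.
  apply: bdM; last exact: hc.
  apply: bdM; last by apply: bd_qnumV; lra.
  by apply: bdM; [apply: bdN; exact: bd_pow | apply: bd_sqrt; apply: bd_qnum; lra].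
by lra.
Qed.

Lemma bound_D0 : bound_cond adm (fun l m1 m2 j => coefD0 q l j m2).
Proof.
eexists=> l m1 m2 j /admissible_bounds[j1 jl /andP[m1a m1b] /andP[m2a m2b]].
have he := eps_cases l j m2; rewrite /coefD0.
move: (eps l j m2) he => e he; apply: bd_slack; last first.
  apply: bdM; last by rewrite invfM; apply: bdM; apply: bd_qnumV; lra.
  apply: bdM; first by apply: bdM; [exact: bd_cst | exact: bd_pow].
  by apply: bd_sqrt; apply: bd_qnum; case: he => ->; lra.
by case: he => ->; lra.
Qed.

End Bounds.

(** * Labels and weights *)

Section BoundedSums.
Variable R : realType.

Definition bounded_sum (I : eqType) (f : I -> R) (M : R) :=
  forall s : seq I, uniq s -> \sum_(i <- s) f i <= M.

Lemma ler_sum_subseq (I : eqType) (f : I -> R) (s t : seq I) : (forall i, 0 <= f i) ->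
  uniq s -> {subset s <= t} -> \sum_(i <- s) f i <= \sum_(i <- t) f i.
Proof.
move=> f0 us st.
apply: (@le_trans _ _ (\sum_(i <- undup t) f i)).
  rewrite [leRHS](perm_big (s ++ [seq i <- undup t | i \notin s])) /=.
    by rewrite big_cat /= lerDl sumr_ge0.
  apply: uniq_perm; first exact: undup_uniq.
    rewrite cat_uniq us filter_uniq ?undup_uniq // andbT /=.
    by apply/hasPn => i; rewrite mem_filter => /andP[].
  move=> i; rewrite mem_cat mem_filter mem_undup.
  by have [/st ->|] := boolP (i \in s).
elim: t {st} => [|i t IH] /=; first by rewrite big_nil.
case: ifP => _; rewrite !big_cons ?lerD2l //.
by apply: le_trans IH _; rewrite lerDr.
Qed.

Lemma bounded_sum_prod (I J : eqType) (f : I -> R) (g : J -> R) M N :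
  (forall i, 0 <= f i) -> (forall j, 0 <= g j) ->
  bounded_sum f M -> bounded_sum g N ->
  bounded_sum (fun p : I * J => f p.1 * g p.2) (M * N).
Proof.
move=> f0 g0 hf hg s us.
pose s1 := undup (map fst s); pose s2 := undup (map snd s).
apply: (@le_trans _ _ (\sum_(p <- [seq (i, j) | i <- s1, j <- s2]) f p.1 * g p.2)).
  apply: ler_sum_subseq => // [p|[i j] ij]; first exact: mulr_ge0.
  apply/allpairsP; exists (i, j); rewrite !mem_undup /=; split=> //.
    by apply/mapP; exists (i, j).
  by apply/mapP; exists (i, j).
rewrite big_allpairs /=; under eq_bigr do rewrite -mulr_sumr.
rewrite -mulr_suml; apply: ler_pM; rewrite ?sumr_ge0 //.
  by apply: hf; exact: undup_uniq.
by apply: hg; exact: undup_uniq.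
Qed.

Lemma bounded_sum_inj (I J : eqType) (h : I -> J) (f : I -> R) (g : J -> R) M :
  injective h -> (forall i, f i <= g (h i)) -> bounded_sum g M -> bounded_sum f M.
Proof.
move=> hi fg hg s us; apply: (@le_trans _ _ (\sum_(j <- map h s) g j)).
  by rewrite big_map; apply: ler_sum.
by apply: hg; rewrite map_inj_uniq.
Qed.

Lemma bounded_sum_geom (r : R) : 0 <= r -> r < 1 ->
  bounded_sum (fun n : nat => r ^+ n) (1 - r)^-1.
Proof.
move=> r0 r1 s us; pose N := (\max_(i <- s) i).+1.
apply: (@le_trans _ _ (\sum_(i <- iota 0 N) r ^+ i)).
  apply: ler_sum_subseq => // [i|i si]; first exact: exprn_ge0.
  by rewrite mem_iota /= add0n ltnS; apply: leq_bigmax_seq.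
rewrite -[iota 0 N]/(index_iota 0 N) big_mkord geom_sum ?lt_eqF //.
by rewrite ler_piMl ?invr_ge0 ?subr_ge0 ?(ltW r1) // gerBl exprn_ge0.
Qed.

Lemma bounded_sum_bool : bounded_sum (fun _ : bool => 1 : R) 2.
Proof.
move=> s us; have : \sum_(i <- s) (1 : R) <= \sum_(i <- [:: true; false]) 1.
  by apply: ler_sum_subseq => // -[].
by rewrite !big_cons big_nil addr0.
Qed.

End BoundedSums.

Section Labels.
Variable R : realType.

(* [(a, d, c, e)] encodes [j = a + 1/2], [l = j + d], [m1 = c - j] and
   [m2 = e - (d + 1/2)]. *)
Definition quad (t : nat * nat * nat * nat) : R * R * R * R :=
  let: (a, d, c, e) := t in
  (a%:R + d%:R + 2^-1, c%:R - a%:R - 2^-1, e%:R - d%:R - 2^-1, a%:R + 2^-1).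

Definition quad_ok (t : nat * nat * nat * nat) : bool :=
  let: (a, d, c, e) := t in (c <= 2 * a + 1)%N && (e <= 2 * d + 1)%N.

Lemma nat_sub_norm (x : R) (n c : nat) : x = c%:R - n%:R - 2^-1 -> (c <= 2 * n + 1)%N ->
  n%:R + 2^-1 - `|x| \is a Num.nat.
Proof.
move=> -> cn; have [cn'|cn'] := leqP c n.
  have h : c%:R <= n%:R :> R by rewrite ler_nat.
  rewrite ler0_norm; last by lra.
  by apply/natrP; exists c; field.
have h : n%:R + 1 <= c%:R :> R by rewrite natr1 ler_nat.
rewrite ger0_norm; last by lra.
by apply/natrP; exists (2 * n + 1 - c)%N; rewrite natrB // natrD natrM; field.
Qed.

Lemma sub_norm_nat (x : R) (n : nat) : n%:R + 2^-1 - `|x| \is a Num.nat ->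
  exists2 c, (c <= 2 * n + 1)%N & x = c%:R - n%:R - 2^-1.
Proof.
move=> /natrP[k hk].
have kn : (k <= n)%N.
  rewrite -ltnS -(ltr_nat R) -natr1 -hk; have := normr_ge0 x; lra.
have [x0|x0] := leP 0 x.
  exists (2 * n + 1 - k)%N; first by lia.
  rewrite natrB ?natrD ?natrM; last by lia.
  by move: hk; rewrite ger0_norm // => <-; field.
exists k; first by lia.
by move: hk; rewrite ltr0_norm // => <-; field.
Qed.

Lemma quad_admissible t : quad_ok t -> admissible (quad t).
Proof.
case: t => [[[a d] c] e] /andP[ca ed] /=; apply/and5P; split.
- by apply/natrP; exists (a + d)%N; rewrite natrD; field.
- by apply/natrP; exists a; field.
- by apply/natrP; exists d; field.
- exact: (nat_sub_norm erefl).
- have -> : a%:R + d%:R + 2^-1 + 2^-1 - (a%:R + 2^-1) = d%:R + 2^-1 :> R by ring.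
  exact: (nat_sub_norm erefl).
Qed.

Lemma admissible_quad v : admissible v -> exists2 t, quad_ok t & v = quad t.
Proof.
case: v => [[[l m1] m2] j] /and5P[_ /natrP[a ha] /natrP[d hd] hm1 hm2].
have ja : j = a%:R + 2^-1 by rewrite -ha; field.
have ld : l = a%:R + d%:R + 2^-1 by rewrite -ha -hd; ring.
move: hm1 hm2; rewrite ld ja.
have -> : a%:R + d%:R + 2^-1 + 2^-1 - (a%:R + 2^-1) = d%:R + 2^-1 :> R by ring.
move=> /sub_norm_nat[c hc ->] /sub_norm_nat[e he ->].
by exists (a, d, c, e) => //=; rewrite hc he.
Qed.

Definition label_quad (v : label R) := s2val (cid2 (admissible_quad (valP v))).

Lemma label_quad_ok v : quad_ok (label_quad v).
Proof. by rewrite /label_quad; case: cid2. Qed.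

Lemma label_quadE v : val v = quad (label_quad v).
Proof. by rewrite /label_quad; case: cid2. Qed.

Lemma label_quad_inj : injective label_quad.
Proof. by move=> v v' h; apply: val_inj; rewrite !label_quadE h. Qed.

Lemma quad_inj : injective quad.
Proof.
move=> [[[a d] c] e] [[[a' d'] c'] e'] /= [h1 h2 h3 h4].
have /eqP : a%:R = a'%:R :> R by lra.
rewrite eqr_nat => /eqP aa; subst a'.
have /eqP : d%:R = d'%:R :> R by lra.
rewrite eqr_nat => /eqP aa; subst d'.
have /eqP : c%:R = c'%:R :> R by lra.
rewrite eqr_nat => /eqP ->.
have /eqP : e%:R = e'%:R :> R by lra.
by rewrite eqr_nat => /eqP ->.
Qed.

Definition steps : seq R := [:: -1; 0; 1].
Arguments steps : simpl never.

Definition step_seq : seq (R * R * R * R) :=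
  [seq (x, y) | x <- [seq (x, y) | x <- [seq (x, y) | x <- steps, y <- steps], y <- steps],
                y <- steps].

Arguments step_seq : simpl never.

Definition shift (v t : R * R * R * R) : R * R * R * R :=
  let: (l, m1, m2, j) := v in let: (a, c, d, e) := t in (l + a, m1 + c, m2 + d, j + e).

(** One step in each of the four labels, and both chiralities, so that the relation is symmetric and
    accommodates [F]; hence at most 2 * 3^4 = 162 elements. *)
Definition neighbours (i : bool * label R) : seq (bool * label R) :=
  undup [seq (s, v) | s <- [:: true; false],
                      v <- pmap insub [seq shift (val i.2) t | t <- step_seq]].

Lemma neighbours_uniq i : uniq (neighbours i).
Proof. exact: undup_uniq. Qed.

Lemma neighbours_size i : (size (neighbours i) <= 162)%N.
Proof.
apply: leq_trans (size_undup _) _; rewrite size_allpairs size_pmap.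
apply: (@leq_mul _ _ 2 81) => //; apply: leq_trans (count_size _ _) _.
by rewrite size_map !size_allpairs.
Qed.

Lemma step_seqP (a c d e : R) :
  ((a, c, d, e) \in step_seq) = [&& a \in steps, c \in steps, d \in steps & e \in steps].
Proof.
rewrite /step_seq; move: steps => S; apply/idP/idP.
  case/allpairsP => -[x y] /= [hx he [ex ey]]; subst x y.
  case/allpairsP: hx => -[x y] /= [hx hd [ex ey]]; subst x y.
  case/allpairsP: hx => -[x y] /= [hx hc [ex ey]]; subst x y.
  by rewrite hx hc hd he.
move=> /and4P[h1 h2 h3 h4]; apply/allpairsP; exists ((a, c, d), e); split=> //=.
apply/allpairsP; exists ((a, c), d); split=> //=.
by apply/allpairsP; exists (a, c).
Qed.

Lemma neighboursP i k : reflect (exists2 t, t \in step_seq & val k.2 = shift (val i.2) t)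
  (k \in neighbours i).
Proof.
rewrite /neighbours mem_undup; move: step_seq => Q.
apply: (iffP idP) => [/allpairsP[[s v] /= [_ + ->]] /=|].
  by rewrite mem_pmap_sub => /mapP[t ts vt]; exists t.
case: k => s v [t ts vt]; apply/allpairsP; exists (s, v); split=> //.
  by rewrite !inE; case: (s).
by rewrite mem_pmap_sub; apply/mapP; exists t.
Qed.

Lemma steps_opp a : a \in steps -> - a \in steps.
Proof.
rewrite !inE => /or3P[]/eqP->; rewrite ?opprK ?oppr0 ?eqxx ?orbT //.
Qed.

Lemma neighbours_sym i k : k \in neighbours i -> i \in neighbours k.
Proof.
move=> /neighboursP[[[[a c] d] e] ts h]; apply/neighboursP.
exists (- a, - c, - d, - e).
  by move: ts; rewrite !step_seqP => /and4P[h1 h2 h3 h4]; rewrite !steps_opp.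
rewrite h; case: (val i.2) => [[[l m1] m2] j] /=.
by rewrite !addrK.
Qed.

Variable q : R.
Hypothesis q_gt0 : 0 < q.
Hypothesis q_lt1 : q < 1.

Definition weight (i : bool * label R) : R := let: (l, _, _, _) := val i.2 in q `^ (2 * l).

Lemma weight_ge0 i : 0 <= weight i.
Proof. by rewrite /weight; case: (val _) => [[[l _] _] _]; exact: powR_ge0. Qed.

Lemma weight_neighbours i k : k \in neighbours i -> weight k <= q `^ (- 2) * weight i.
Proof.
move=> /neighboursP[[[[a c] d] e] + h]; rewrite step_seqP => /and4P[h1 _ _ _].
rewrite /weight h; case: (val i.2) => [[[l m1] m2] j] /=.
rewrite -qpowD // qpow_le //.
by move: h1; rewrite !inE => /or3P[]/eqP->; lra.
Qed.

Lemma weight_sum : exists W, bounded_sum weight W.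
Proof.
(* Since 2l = 2a + 2d + 1, c <= 2a + 1 and e <= 2d + 1, the weight q^(2l) = r^(8l) is at most r^(a +
   d + c + e), a product of four geometric sequences. *)
pose r := q `^ (4^-1).
have r0 : 0 <= r by exact: powR_ge0.
have r4 : r ^+ 4 = q.
  by rewrite /r -qpowMn // -[4^-1 *+ 4]mulr_natr mulVf ?pnatr_eq0 // qpow1.
have r1 : r < 1.
  by rewrite -(@ltr_pXn2r _ 4) ?nnegrE // r4 expr1n.
have G := bounded_sum_geom r0 r1.
have P (n : nat) : 0 <= r ^+ n by exact: exprn_ge0.
have S2 := bounded_sum_prod P P G G.
have S3 := bounded_sum_prod (fun p => mulr_ge0 (P p.1) (P p.2)) P S2 G.
have S4 := bounded_sum_prod (fun p => mulr_ge0 (mulr_ge0 (P p.1.1) (P p.1.2)) (P p.2)) P S3 G.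
have S5 := bounded_sum_prod (fun _ => ler01)
  (fun p => mulr_ge0 (mulr_ge0 (mulr_ge0 (P p.1.1.1) (P p.1.1.2)) (P p.1.2)) (P p.2))
  (bounded_sum_bool R) S4.
eexists; apply: (bounded_sum_inj (h := fun i => (i.1, label_quad i.2))) S5.
  by move=> [s v] [s' v'] /= [-> /label_quad_inj ->].
move=> [s v]; rewrite /weight /= label_quadE mul1r.
have := label_quad_ok v; case: (label_quad v) => [[[a d] c] e] /= /andP[ca ed].
have -> : 2 * (a%:R + d%:R + 2^-1) = (2 * a + 2 * d + 1)%:R :> R.
  by rewrite natrD natrD !natrM; field.
rewrite qpow_nat // -r4 -exprM -!exprD; apply: ler_wiXn2l; rewrite ?(ltW r1) //.
by lia.
Qed.

End Labels.

(** * The spinor representations *)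

Section SpinorTerms.
Variables (R : realType) (q : R).
Hypothesis q_gt0 : 0 < q.
Hypothesis q_lt1 : q < 1.
Variables (H : hilbertType R) (b : bool * label R -> H).
Hypothesis hb : orthonormal_basis b.
Variables (pi : s4q q -> bop H) (gamma F : bop H).
Hypothesis hpi : chiral_spinor_representation b pi.
Hypothesis hgamma : forall s l m1 m2 j,
  gamma (ket b s l m1 m2 j) = (chi R s)%:C *: ket b s l m1 m2 j.
Hypothesis hF : forall s l m1 m2 j,
  F (ket b s l m1 m2 j) = ket b (~~ s) l m1 m2 j.
Local Notation K := (ket b).
Local Notation "a '**' v" := (a%:C *: v) (at level 40, left associativity).
Local Notation wt := (weight q).
Local Notation small := (small b wt).
Local Notation local := (local b (@neighbours R)).
Local Notation adm l m1 m2 j := (admissible (l, m1, m2, j)).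

Lemma ketE s l m1 m2 j (h : adm l m1 m2 j) : K s l m1 m2 j = b (s, Sub (l, m1, m2, j) h).
Proof. by rewrite /ket insubT. Qed.

Lemma ket_out s l m1 m2 j : ~~ adm l m1 m2 j -> K s l m1 m2 j = 0.
Proof. by move=> h; rewrite /ket insubN. Qed.

Lemma basis_ket i : exists l m1 m2 j, [/\ adm l m1 m2 j, val i.2 = (l, m1, m2, j) &
  b i = K i.1 l m1 m2 j].
Proof.
case: i => s [[[[l m1] m2] j] h]; exists l, m1, m2, j; split=> //.
by rewrite (ketE _ h).
Qed.

Lemma nrm_ket s l m1 m2 j : nrm (K s l m1 m2 j) <= 1.
Proof.
have [h|/ket_out->] := boolP (adm l m1 m2 j); first by rewrite (ketE _ h) (nrm_basis hb).
by rewrite nrm0.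
Qed.

Lemma nrm_term s l m1 m2 j (c M : R) : 0 <= M -> (adm l m1 m2 j -> `|c| <= M) ->
  nrm (c ** K s l m1 m2 j) <= M.
Proof.
move=> M0 hM; rewrite nrmZ nrmR.
have [/hM h|/ket_out->] := boolP (adm l m1 m2 j); last by rewrite nrm0 mulr0.
by rewrite -[M]mulr1; apply: ler_pM => //; [exact: nrm_ge0 | exact: nrm_ket].
Qed.

Lemma dot_ket s v s' l m1 m2 j :
  dot (b (s, v)) (K s' l m1 m2 j) = ((s == s') && ((l, m1, m2, j) == val v))%:R.
Proof.
have [h|h] := boolP (adm l m1 m2 j).
  by rewrite (ketE _ h) basis_dot // xpair_eqE; congr (_ && _)%:R; rewrite eq_sym -val_eqE.
rewrite ket_out // dot0r andbC; case: eqP => // E.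
by move: h; rewrite E (valP v).
Qed.

Definition near_vec i (x : H) := forall k, k \notin neighbours i -> dot (b k) x = 0.

Lemma near_vecD i x y : near_vec i x -> near_vec i y -> near_vec i (x + y).
Proof. by move=> hx hy k kn; rewrite dotDr hx // hy // addr0. Qed.

Lemma near_vecZ i c x : near_vec i x -> near_vec i (c *: x).
Proof. by move=> hx k kn; rewrite dotZr hx // mulr0. Qed.

Lemma mem_steps (x : R) : (x \in steps R) = [|| x == -1, x == 0 | x == 1].
Proof. by rewrite !inE. Qed.

Lemma near_ket i s (l m1 m2 j l' m1' m2' j' : R) : val i.2 = (l, m1, m2, j) ->
  l' - l \in steps R -> m1' - m1 \in steps R -> m2' - m2 \in steps R -> j' - j \in steps R ->
  near_vec i (K s l' m1' m2' j').
Proof.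
move=> iE h1 h2 h3 h4 [s' v] kn; rewrite dot_ket; case: eqP => [_|] //=.
case: eqP => // E; case/neighboursP: kn.
exists (l' - l, m1' - m1, m2' - m2, j' - j); first by rewrite step_seqP h1 h2 h3 h4.
by rewrite iE /= -E; congr (_, _, _, _); rewrite addrC subrK.
Qed.

Lemma step0 (x : R) : x - x \in steps R.
Proof. by rewrite mem_steps subrr eqxx orbT. Qed.
Lemma step1 (x : R) : x + 1 - x \in steps R.
Proof. by rewrite mem_steps addrAC subrr add0r eqxx !orbT. Qed.
Lemma stepN1 (x : R) : x - 1 - x \in steps R.
Proof. by rewrite mem_steps addrAC subrr add0r eqxx. Qed.

Lemma local_F : local F.
Proof.
move=> i; have [l [m1 [m2 [j [h iE ->]]]]] := basis_ket i; rewrite hF.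
by apply: (near_ket _ iE); exact: step0.
Qed.

(* The common shape of the actions of [x0] and [x1]; [nine_even] and [nine_odd]
   are the parts without and with the chirality sign. *)
Definition nine_terms s l m m2 j (P Z M : R) : H :=
    (P * coefCp q l j m2) ** K s (l + 1) m m2 (j + 1)
  + (- chi R s * P * coefC0 q l j m2) ** K s l m m2 (j + 1)
  + (P * coefCm q l j m2) ** K s (l - 1) m m2 (j + 1)
  + (Z * coefHp q l j m2) ** K s (l + 1) m m2 j
  + (chi R s * Z * coefH0 q l j m2) ** K s l m m2 j
  + (Z * coefHp q (l - 1) j m2) ** K s (l - 1) m m2 j
  + (M * coefCm q (l + 1) (j - 1) m2) ** K s (l + 1) m m2 (j - 1)
  + (- chi R s * M * coefC0 q l (j - 1) m2) ** K s l m m2 (j - 1)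
  + (M * coefCp q (l - 1) (j - 1) m2) ** K s (l - 1) m m2 (j - 1).

Definition nine_even s l m m2 j (P Z M : R) : H :=
    (P * coefCp q l j m2) ** K s (l + 1) m m2 (j + 1)
  + (P * coefCm q l j m2) ** K s (l - 1) m m2 (j + 1)
  + (Z * coefHp q l j m2) ** K s (l + 1) m m2 j
  + (Z * coefHp q (l - 1) j m2) ** K s (l - 1) m m2 j
  + (M * coefCm q (l + 1) (j - 1) m2) ** K s (l + 1) m m2 (j - 1)
  + (M * coefCp q (l - 1) (j - 1) m2) ** K s (l - 1) m m2 (j - 1).

Definition nine_odd s l m m2 j (P Z M : R) : H :=
    (- (P * coefC0 q l j m2)) ** K s l m m2 (j + 1)
  + (Z * coefH0 q l j m2) ** K s l m m2 j
  + (- (M * coefC0 q l (j - 1) m2)) ** K s l m m2 (j - 1).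

Lemma nine_near i s l m1 m2 j m P Z M : val i.2 = (l, m1, m2, j) -> m - m1 \in steps R ->
  near_vec i (nine_terms s l m m2 j P Z M).
Proof.
move=> iE hm; rewrite /nine_terms.
by repeat apply: near_vecD; apply: near_vecZ; apply: (near_ket _ iE);
  first [exact: hm | exact: step0 | exact: step1 | exact: stepN1].
Qed.

Lemma nine_split s l m m2 j P Z M :
  nine_terms s l m m2 j P Z M =
  nine_even s l m m2 j P Z M + (chi R s)%:C *: nine_odd s l m m2 j P Z M.
Proof.
rewrite /nine_terms /nine_even /nine_odd !scalerDr !scalerA -!rmorphM.
by rewrite !mulrN !mulrA -!mulNr [LHS](ACl (1*3*4*6*7*9*(2*5*8))).
Qed.

Lemma F_nine_even s l m m2 j P Z M :
  F (nine_even s l m m2 j P Z M) = nine_even (~~ s) l m m2 j P Z M.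
Proof. by rewrite /nine_even !bop_funD !bopZ !hF. Qed.

Lemma F_nine_odd s l m m2 j P Z M :
  F (nine_odd s l m m2 j P Z M) = nine_odd (~~ s) l m m2 j P Z M.
Proof. by rewrite /nine_odd !bop_funD !bopZ !hF. Qed.

Lemma gamma_nine_odd s l m m2 j P Z M :
  gamma (nine_odd s l m m2 j P Z M) = (chi R s)%:C *: nine_odd s l m m2 j P Z M.
Proof.
rewrite /nine_odd !bop_funD !bopZ !hgamma !scalerDr !scalerA.
by rewrite ![_ * (chi R s)%:C]mulrC.
Qed.

Lemma nrm_nine_odd s l m m2 j P Z M (C1 C2 C3 : R) :
  0 <= C1 -> 0 <= C2 -> 0 <= C3 ->
  (adm l m m2 (j + 1) -> `|P * coefC0 q l j m2| <= C1) ->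
  (adm l m m2 j -> `|Z * coefH0 q l j m2| <= C2) ->
  (adm l m m2 (j - 1) -> `|M * coefC0 q l (j - 1) m2| <= C3) ->
  nrm (nine_odd s l m m2 j P Z M) <= C1 + C2 + C3.
Proof.
move=> c1 c2 c3 h1 h2 h3; apply: le_trans (nrmD _ _) _; apply: lerD; last first.
  by apply: nrm_term => // /h3; rewrite normrN.
apply: le_trans (nrmD _ _) _; apply: lerD; last exact: nrm_term.
by apply: nrm_term => // /h1; rewrite normrN.
Qed.

Lemma x0_nine s l m1 m2 j : adm l m1 m2 j -> pi (x0 q) (K s l m1 m2 j) =
  nine_terms s l m1 m2 j (coefAp q j m1) (coefA0 q j m1) (coefAp q (j - 1) m1).
Proof. by have [_ h _ _] := hpi; exact: h. Qed.

Lemma x1_nine s l m1 m2 j : adm l m1 m2 j -> pi (x1 q) (K s l m1 m2 j) =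
  nine_terms s l (m1 + 1) m2 j (coefBp q j m1) (coefB0 q j m1) (coefBm q j m1).
Proof. by have [_ _ h _] := hpi; exact: h. Qed.

Lemma local_x0 : local (pi (x0 q)).
Proof.
move=> i; have [l [m1 [m2 [j [h iE ->]]]]] := basis_ket i; rewrite x0_nine //.
by apply: (nine_near _ _ _ _ iE); exact: step0.
Qed.

Lemma local_x1 : local (pi (x1 q)).
Proof.
move=> i; have [l [m1 [m2 [j [h iE ->]]]]] := basis_ket i; rewrite x1_nine //.
by apply: (nine_near _ _ _ _ iE); exact: step1.
Qed.

Lemma local_x2 : local (pi (x2 q)).
Proof.
have [_ _ _ h0] := hpi.
move=> i; have [l [m1 [m2 [j [h iE ->]]]]] := basis_ket i; rewrite h0 //.
by repeat apply: near_vecD; apply: near_vecZ; apply: (near_ket _ iE);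
  first [exact: step0 | exact: step1 | exact: stepN1].
Qed.

(** The parts E without chirality sign cancel between F T and T F; the parts O occur with the factor
    chi(s) - chi(-s) = 2 chi(s). *)
Lemma commutator_split s (E O x : bool -> H) (T : bop H) :
  (forall s, F (x s) = x (~~ s)) ->
  (forall s, T (x s) = E s + (chi R s)%:C *: O s) ->
  (forall s, F (E s) = E (~~ s)) -> (forall s, F (O s) = O (~~ s)) ->
  commutator F T (x s) = (2 * chi R s)%:C *: O (~~ s).
Proof.
move=> Fx hT FE FO; rewrite /commutator bop_subE !bop_mulE Fx !hT.
rewrite bop_funD bopZ FE FO opprD addrACA subrr add0r.
rewrite -scalerBl -rmorphB; congr (_%:C *: _).
by case: s; rewrite /chi /=; ring.
Qed.

Lemma commutator_x0 s l m1 m2 j : adm l m1 m2 j ->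
  commutator F (pi (x0 q)) (K s l m1 m2 j) = (2 * chi R s)%:C *:
    nine_odd (~~ s) l m1 m2 j (coefAp q j m1) (coefA0 q j m1) (coefAp q (j - 1) m1).
Proof.
move=> h; apply: (commutator_split s (x := fun s => K s l m1 m2 j)
  (O := fun s => nine_odd s l m1 m2 j _ _ _)) => s'; first by rewrite hF.
- by rewrite x0_nine // nine_split.
- exact: F_nine_even.
- exact: F_nine_odd.
Qed.

Lemma commutator_x1 s l m1 m2 j : adm l m1 m2 j ->
  commutator F (pi (x1 q)) (K s l m1 m2 j) = (2 * chi R s)%:C *:
    nine_odd (~~ s) l (m1 + 1) m2 j (coefBp q j m1) (coefB0 q j m1) (coefBm q j m1).
Proof.
move=> h; apply: (commutator_split s (x := fun s => K s l m1 m2 j)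
  (O := fun s => nine_odd s l (m1 + 1) m2 j _ _ _)) => s'; first by rewrite hF.
- by rewrite x1_nine // nine_split.
- exact: F_nine_even.
- exact: F_nine_odd.
Qed.

Lemma commutator_x2 s l m1 m2 j : adm l m1 m2 j ->
  commutator F (pi (x2 q)) (K s l m1 m2 j) =
  (2 * chi R s)%:C *: (coefD0 q l j m2 ** K (~~ s) l m1 (m2 + 1) j).
Proof.
have [_ _ _ h0] := hpi => h.
apply: (commutator_split s (x := fun s => K s l m1 m2 j)
  (E := fun s => coefDp q l j m2 ** K s (l + 1) m1 (m2 + 1) j
               + coefDm q l j m2 ** K s (l - 1) m1 (m2 + 1) j)
  (O := fun s => coefD0 q l j m2 ** K s l m1 (m2 + 1) j)) => s'; first by rewrite hF.
- by rewrite h0 // scalerA -rmorphM addrAC.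
- by rewrite !bop_funD !bopZ !hF.
- by rewrite !bopZ !hF.
Qed.

Lemma small_split (T : bop H) (C : R) : 0 <= C ->
  (forall s l m1 m2 j, adm l m1 m2 j -> exists2 y,
    T (K s l m1 m2 j) = (2 * chi R s)%:C *: y & nrm y <= C * q `^ (2 * l)) -> small T.
Proof.
move=> C0 h; exists (2 * C) => [|i]; first by rewrite mulr_ge0.
have [l [m1 [m2 [j [hadm iE ->]]]]] := basis_ket i.
have [y -> hy] := h i.1 _ _ _ _ hadm; rewrite nrmZ nrmR normrM.
have -> : wt i = q `^ (2 * l) by rewrite /weight iE.
have -> : `|2 : R| * `|chi R i.1| = 2.
  by rewrite /chi; case: i.1; rewrite ?normrN normr1 mulr1 ger0_norm.
by rewrite -mulrA ler_wpM2l.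
Qed.

Lemma bound_condE P f : bound_cond q P f ->
  exists2 C, 0 <= C & forall l m1 m2 j, P l m1 m2 j -> `|f l m1 m2 j| <= C * q `^ (2 * l).
Proof.
move=> [C hC]; exists `|C| => // l m1 m2 j /hC[C0 h].
by rewrite (ger0_norm C0).
Qed.

Lemma small_x0 : small (commutator F (pi (x0 q))).
Proof.
have [C1 c1 h1] := bound_condE (bound_ApC0 q_gt0 q_lt1).
have [C2 c2 h2] := bound_condE (bound_A0H0 q_gt0 q_lt1).
apply: (@small_split _ (C1 + C2 + C1)) => [|s l m1 m2 j hadm]; first by rewrite !addr_ge0.
eexists; first exact: commutator_x0.
have Q0 : 0 <= q `^ (2 * l) by exact: powR_ge0.
rewrite (mulrDl (C1 + C2)) (mulrDl C1); apply: nrm_nine_odd => [|||_|_|h]; rewrite ?mulr_ge0 //.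
- exact: (h1 _ _ _ _ hadm).
- exact: (h2 _ _ _ _ hadm).
(* The term of x_0 that lowers j has the coefficient of the raising term at the label of its target,
   whence the same constant. *)
- exact: (h1 _ _ _ _ h).
Qed.

Lemma small_x1 : small (commutator F (pi (x1 q))).
Proof.
have [C1 c1 h1] := bound_condE (bound_BpC0 q_gt0 q_lt1).
have [C2 c2 h2] := bound_condE (bound_B0H0 q_gt0 q_lt1).
have [C3 c3 h3] := bound_condE (bound_BmC0 q_gt0 q_lt1).
apply: (@small_split _ (C1 + C2 + C3)) => [|s l m1 m2 j hadm]; first by rewrite !addr_ge0.
eexists; first exact: commutator_x1.
have Q0 : 0 <= q `^ (2 * l) by exact: powR_ge0.
rewrite (mulrDl (C1 + C2)) (mulrDl C1); apply: nrm_nine_odd => [|||_|_|h]; rewrite ?mulr_ge0 //.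
- exact: (h1 _ _ _ _ hadm).
- exact: (h2 _ _ _ _ hadm).
- exact: (h3 _ _ _ _ h).
Qed.

Lemma small_x2 : small (commutator F (pi (x2 q))).
Proof.
have [C c h0] := bound_condE (bound_D0 q_gt0 q_lt1).
apply: (@small_split _ C) => // s l m1 m2 j hadm.
eexists; first exact: commutator_x2.
apply: nrm_term => [|_]; first by rewrite mulr_ge0 // powR_ge0.
exact: h0 hadm.
Qed.

End SpinorTerms.

(** * The axioms of the Fredholm module and the smallness of all commutators *)

Section SpinorFredholmModule.
Variables (R : realType) (q : R).
Hypothesis q_gt0 : 0 < q.
Hypothesis q_lt1 : q < 1.
Variables (H : hilbertType R) (b : bool * label R -> H).
Hypothesis hb : orthonormal_basis b.
Variables (pi : s4q q -> bop H) (gamma F : bop H).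
Hypothesis hpi : chiral_spinor_representation b pi.
Hypothesis hgamma : forall s l m1 m2 j,
  gamma (ket b s l m1 m2 j) = (chi R s)%:C *: ket b s l m1 m2 j.
Hypothesis hF : forall s l m1 m2 j,
  F (ket b s l m1 m2 j) = ket b (~~ s) l m1 m2 j.
Local Notation K := (ket b).
Local Notation "a '**' v" := (a%:C *: v) (at level 40, left associativity).
Local Notation wt := (weight q).
Local Notation small := (small b wt).
Local Notation local := (local b (@neighbours R)).
Local Notation adm l m1 m2 j := (admissible (l, m1, m2, j)).


Lemma F_adjoint : self_adjoint F.
Proof.
apply: (adjoint_basis hb) => [[s v] [s' v']].
have [l [m1 [m2 [j [_ _ ->]]]]] := basis_ket b (s, v).
have [l' [m1' [m2' [j' [_ _ ->]]]]] := basis_ket b (s', v').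
rewrite !hF /=.
have E t (l0 n1 n2 j0 l1 p1 p2 j1 : R) : dot (K (~~ s) l0 n1 n2 j0) (K t l1 p1 p2 j1) =
    dot (K s l0 n1 n2 j0) (K (~~ t) l1 p1 p2 j1).
  have [h|h] := boolP (adm l0 n1 n2 j0); last first.
    by rewrite !(ket_out _ _ h) dot_conj dot0r rmorph0 dot_conj dot0r rmorph0.
  by rewrite !(ketE _ _ h) !dot_ket //; congr (_ && _)%:R; case: (s); case: t.
exact: E.
Qed.

Lemma F_square : F * F = 1.
Proof.
apply: (bop_ext_basis hb) => i; have [l [m1 [m2 [j [_ _ ->]]]]] := basis_ket b i.
by rewrite bop_mulE !hF negbK.
Qed.

Lemma chi_sq s : chi R s * chi R s = 1.
Proof. by rewrite /chi; case: s; rewrite ?mulrNN mulr1. Qed.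

Lemma gamma_adjoint : self_adjoint gamma.
Proof.
apply: (adjoint_basis hb) => [[s v] [s' v']].
have [l [m1 [m2 [j [_ _ E1]]]]] := basis_ket b (s, v).
have [l' [m1' [m2' [j' [_ _ E2]]]]] := basis_ket b (s', v').
rewrite [in gamma (b (s, v))]E1 [in gamma (b (s', v'))]E2 !hgamma -E1 -E2 /=.
rewrite dotZl dotZr conjR basis_dot // xpair_eqE.
by case: eqP => [->|] //=; rewrite !mulr0.
Qed.

Lemma gamma_square : gamma * gamma = 1.
Proof.
apply: (bop_ext_basis hb) => i; have [l [m1 [m2 [j [_ _ ->]]]]] := basis_ket b i.
by rewrite bop_mulE hgamma bopZ hgamma scalerA -rmorphM chi_sq scale1r.
Qed.

Lemma gamma_F : gamma * F + F * gamma = 0.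
Proof.
apply: (bop_ext_basis hb) => i; have [l [m1 [m2 [j [_ _ ->]]]]] := basis_ket b i.
rewrite bop_addE !bop_mulE hF !hgamma bopZ hF -scalerDl -rmorphD /chi.
by case: i.1; rewrite /= ?addNr ?subrr scale0r.
Qed.

Lemma pi_star x : adjoint (pi x) (pi (star x)).
Proof. by have [[_ _ _ h] _ _ _] := hpi; exact: h. Qed.

Lemma star_rep : star_representation pi.
Proof. by have [h _ _ _] := hpi. Qed.

(** Both sides are adjoints of T gamma = gamma T. This reaches the stars of the generators, for
    which no explicit action is given. *)
Lemma gamma_comm_star T T' : adjoint T T' -> gamma * T = T * gamma -> gamma * T' = T' * gamma.
Proof.
move=> adj h; apply: (@adjoint_uniq _ _ (T * gamma)).
  exact: adjointM adj gamma_adjoint.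
by rewrite -h; exact: adjointM gamma_adjoint adj.
Qed.

Lemma gamma_nine s l m m2 j P Z M :
  gamma (nine_terms q b s l m m2 j P Z M) = (chi R s)%:C *: nine_terms q b s l m m2 j P Z M.
Proof.
rewrite /nine_terms !bop_funD !bopZ !hgamma !scalerDr !scalerA.
by rewrite ![_ * (chi R s)%:C]mulrC.
Qed.

Lemma gamma_pi x : gamma * pi x = pi x * gamma.
Proof.
have g0 : gamma * pi (x0 q) = pi (x0 q) * gamma.
  apply: (bop_ext_basis hb) => i; have [l [m1 [m2 [j [h _ ->]]]]] := basis_ket b i.
  by rewrite !bop_mulE hgamma bopZ (x0_nine hpi) // gamma_nine.
have g1 : gamma * pi (x1 q) = pi (x1 q) * gamma.
  apply: (bop_ext_basis hb) => i; have [l [m1 [m2 [j [h _ ->]]]]] := basis_ket b i.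
  by rewrite !bop_mulE hgamma bopZ (x1_nine hpi) // gamma_nine.
have g2 : gamma * pi (x2 q) = pi (x2 q) * gamma.
  apply: (bop_ext_basis hb) => i; have [l [m1 [m2 [j [h _ ->]]]]] := basis_ket b i.
  have [_ _ _ h0] := hpi.
  rewrite !bop_mulE hgamma bopZ h0 // !bop_funD !bopZ !hgamma !scalerDr !scalerA.
  by rewrite ![_ * (chi R _)%:C]mulrC.
elim/s4q_generated: x => //.
- exact: gamma_comm_star (pi_star _) g1.
- exact: gamma_comm_star (pi_star _) g2.
- by have [_ -> _ _] := star_rep; rewrite mulr1 mul1r.
- move=> a x y hx hy; have [-> _ _ _] := star_rep.
  by rewrite mulrDr mulrDl hy -bop_scaleAr -bop_scaleAl hx.
- move=> x y hx hy; have [_ _ -> _] := star_rep.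
  by rewrite mulrA hx -mulrA hy mulrA.
Qed.

Lemma weight_summable : exists W, forall s : seq (bool * label R), uniq s ->
  \sum_(i <- s) wt i <= W.
Proof. exact: weight_sum. Qed.

Lemma label_inhabited : inhabited (bool * label R).
Proof.
split; split; first exact: true.
by exists (quad R (0%N, 0%N, 0%N, 0%N)); exact: quad_admissible.
Qed.

Let C0_ge0 : 0 <= q `^ (- 2). Proof. exact: powR_ge0. Qed.
Let nbw := @weight_neighbours R q q_gt0 q_lt1.

Lemma local_traceable T T' : adjoint T T' -> local T -> traceable b wt T.
Proof.
have [W hW] := weight_summable; have [i0] := label_inhabited.
move=> adj lT S sS.
have s1 : small (S * T).
  exact: (smallM_local hb (@weight_ge0 R q) (@neighbours_uniq R) (@neighbours_size R) C0_ge0 nbw).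
split=> //; have s2 : small (T * S) by exact: smallMl.
have [l hl] := has_trace_ex hb hW i0 s1; have [n hn] := has_trace_ex hb hW i0 s2.
rewrite (has_traceE hl) (has_traceE hn).
exact: (trace_comm_local hb (@weight_ge0 R q) hW (@neighbours_uniq R) (@neighbours_size R)
  (@neighbours_sym R) C0_ge0 nbw sS lT adj hl hn).
Qed.

Lemma F_traceable : traceable b wt F.
Proof. exact: local_traceable F_adjoint (local_F hb hF). Qed.

Lemma commutator_adjoint x :
  adjoint (commutator F (pi x)) (- commutator F (pi (star x))).
Proof.
rewrite /commutator opprB; apply: adjointB; apply: adjointM;
  by [exact: F_adjoint | exact: pi_star].
Qed.

Lemma F_basis i : F (b i) = b (~~ i.1, i.2).
Proof.
have [l [m1 [m2 [j [h iE ->]]]]] := basis_ket b i; rewrite hF (ketE _ _ h).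
by congr (b (_, _)); apply: val_inj.
Qed.

Lemma local_F_mul T : local T -> local (F * T).
Proof.
move=> lT i k kn; rewrite bop_mulE -F_adjoint F_basis lT //.
by apply: contra kn => /neighboursP h; apply/neighboursP.
Qed.

Lemma local_mul_F T : local T -> local (T * F).
Proof. by move=> lT i k kn; rewrite bop_mulE F_basis lT. Qed.

(** [F, x^*] is the negative of the adjoint of [F, x]. The latter is local because [F] only flips
    the chirality, to which [neighbours] is insensitive. *)
Lemma small_star x : local (pi x) -> small (commutator F (pi x)) ->
  small (commutator F (pi (star x))).
Proof.
move=> lx sx; rewrite -[commutator _ _]opprK; apply: smallN.
apply: (small_local_adjoint hb (@weight_ge0 R q) (@neighbours_uniq R)
  (@neighbours_size R) (@neighbours_sym R) C0_ge0 nbw (commutator_adjoint x)) => //.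
move=> i k kn; rewrite /commutator bop_subE dotBr local_F_mul // local_mul_F //.
by rewrite subrr.
Qed.

(** The two properties are proved together: in [F, xy] = [F, x] y + x [F, y] the first summand is
    small because y is traceable. *)
Lemma pi_traceable_small x : traceable b wt (pi x) /\ small (commutator F (pi x)).
Proof.
have lx0 := local_x0 hb hpi; have lx1 := local_x1 hb hpi; have lx2 := local_x2 hb hpi.
have sx0 := small_x0 q_gt0 q_lt1 hb hpi hF; have sx1 := small_x1 q_gt0 q_lt1 hb hpi hF.
have sx2 := small_x2 q_gt0 q_lt1 hb hpi hF.
have ls T : local (pi T) -> local (pi (star T)).
  exact: local_adjoint (@neighbours_sym R) _ _ (pi_star T).
elim/s4q_generated: x.
- by split=> //; exact: local_traceable (pi_star _) lx0.
- by split=> //; exact: local_traceable (pi_star _) lx1.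
- by split=> //; exact: local_traceable (pi_star _) lx2.
- split; last exact: small_star.
  exact: local_traceable (adjoint_sym (pi_star _)) (ls _ lx1).
- split; last exact: small_star.
  exact: local_traceable (adjoint_sym (pi_star _)) (ls _ lx2).
- have [_ -> _ _] := star_rep; split; first exact: traceable1.
  by rewrite /commutator mulr1 mul1r subrr; exact: small0.
- move=> a x y [tx sx] [ty sy]; have [-> _ _ _] := star_rep.
  have [W hW] := weight_summable; have [i0] := label_inhabited.
  split; first exact: (traceable_lin i0 hb hW).
  have -> : commutator F (a *: pi x + pi y) =
      a *: commutator F (pi x) + commutator F (pi y).
    rewrite /commutator mulrDr mulrDl -bop_scaleAr -bop_scaleAl opprD addrACA.
    by rewrite -scalerBr.
  by apply: smallD => //; exact: smallZ.
- move=> x y [tx sx] [ty sy]; have [_ _ -> _] := star_rep.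
  split; first exact: traceableM.
  have -> : commutator F (pi x * pi y) =
      commutator F (pi x) * pi y + pi x * commutator F (pi y).
    by rewrite /commutator mulrBl mulrBr !mulrA addrA subrK.
  by apply: smallD; [exact: (ty _ sx).1 | exact: smallMl].
Qed.

(** The chirality sign of the commutator and that of [gamma] multiply to 1, so H_+ and H_-
    contribute equally; the terms that change j are orthogonal to b_i. *)
Lemma diagonal_x0 i l m1 m2 j : val i.2 = (l, m1, m2, j) ->
  dot (b i) ((gamma * F * commutator F (pi (x0 q))) (b i)) =
  (2 * (coefA0 q j m1 * coefH0 q l j m2))%:C.
Proof.
case: i => s v vE; have {}vE : val v = (l, m1, m2, j) by [].
have h : adm l m1 m2 j by rewrite -vE (valP v).
have bE : b (s, v) = K s l m1 m2 j.
  by rewrite (ketE _ _ h); congr (b (_, _)); apply: val_inj; exact: vE.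
rewrite [in X in dot _ X]bE bop_mulE (commutator_x0 hpi hF _ h).
rewrite bopZ bop_mulE (F_nine_odd _ hF) negbK (gamma_nine_odd _ hgamma).
rewrite scalerA -rmorphM -mulrA chi_sq mulr1 dotZr rmorphM; congr (_ * _).
rewrite /nine_odd !dotDr !dotZr !dot_ket // vE eqxx /= eqxx mulr1.
have n1 : ((l, m1, m2, j + 1) == (l, m1, m2, j)) = false.
  by apply/eqP => -[] /eqP; rewrite -subr_eq0 addrAC subrr add0r oner_eq0.
have n2 : ((l, m1, m2, j - 1) == (l, m1, m2, j)) = false.
  by apply/eqP => -[] /eqP; rewrite -subr_eq0 addrAC subrr add0r oppr_eq0 oner_eq0.
by rewrite n1 n2 !mulr0 add0r addr0.
Qed.

End SpinorFredholmModule.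

(** * Evaluation of the trace at x_0 over boxes of labels *)

Section SpinorTrace.
Variables (R : realType) (q : R).
Hypothesis q_gt0 : 0 < q.
Hypothesis q_lt1 : q < 1.
Variables (H : hilbertType R) (b : bool * label R -> H).
Hypothesis hb : orthonormal_basis b.
Variables (pi : s4q q -> bop H) (gamma F : bop H).
Hypothesis hpi : chiral_spinor_representation b pi.
Hypothesis hgamma : forall s l m1 m2 j,
  gamma (ket b s l m1 m2 j) = (chi R s)%:C *: ket b s l m1 m2 j.
Hypothesis hF : forall s l m1 m2 j,
  F (ket b s l m1 m2 j) = ket b (~~ s) l m1 m2 j.
Local Notation K := (ket b).
Local Notation "a '**' v" := (a%:C *: v) (at level 40, left associativity).
Local Notation wt := (weight q).
Local Notation small := (small b wt).
Local Notation local := (local b (@neighbours R)).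
Local Notation adm l m1 m2 j := (admissible (l, m1, m2, j)).


(** The ranges of c and e are uniform in a and d, which makes this a plain product; a < N and d < M
    force c < 2N and e < 2M for the quadruples that [quads] retains. *)
Definition cube (N M : nat) : seq (nat * nat * nat * nat) :=
  [seq (x, e) | x <- [seq (x, c) | x <- [seq (a, d) | a <- index_iota 0 N, d <- index_iota 0 M],
                                   c <- index_iota 0 (2 * N)],
                e <- index_iota 0 (2 * M)].

Lemma cube_uniq N M : uniq (cube N M).
Proof.
do 3 (apply: allpairs_uniq; [| exact: iota_uniq | by move=> [? ?] [? ?] _ _ [-> ->]]).
exact: iota_uniq.
Qed.

Lemma mem_cube N M a d c e :
  ((a, d, c, e) \in cube N M) = [&& a < N, d < M, c < 2 * N & e < 2 * M]%N.
Proof.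
apply/idP/idP.
  case/allpairsP => -[x y] /= [hx he [ex ey]]; subst x y.
  case/allpairsP: hx => -[x y] /= [hx hc [ex ey]]; subst x y.
  case/allpairsP: hx => -[x y] /= [hx hd [ex ey]]; subst x y.
  by move: hx hc hd he; rewrite !mem_index_iota /= => -> -> -> ->.
move=> /and4P[h1 h2 h3 h4]; apply/allpairsP; exists ((a, d, c), e).
rewrite mem_index_iota; split=> //; apply/allpairsP; exists ((a, d), c).
rewrite mem_index_iota; split=> //; apply/allpairsP; exists (a, d).
by rewrite !mem_index_iota.
Qed.

Definition quads (N M : nat) := [seq t <- cube N M | quad_ok t].

Lemma sum_quads (f : nat -> nat -> nat -> nat -> R) N M :
  \sum_(t <- quads N M) f t.1.1.1 t.1.1.2 t.1.2 t.2 =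
  \sum_(a < N) \sum_(d < M) \sum_(c < (2 * a + 2)%N) \sum_(e < (2 * d + 2)%N) f a d c e.
Proof.
rewrite /quads big_filter big_mkcond /cube !big_allpairs big_mkord.
apply: eq_bigr => a _; rewrite big_mkord; apply: eq_bigr => d _.
rewrite big_mkord.
rewrite (big_ord_widen (2 * N)%N (fun c => \sum_(e < (2 * d + 2)%N) f a d c e)); last first.
  by have := ltn_ord a; lia.
rewrite [RHS]big_mkcond; apply: eq_bigr => c _.
rewrite big_mkord (big_ord_widen (2 * M)%N (fun e => f a d c e)); last first.
  by have := ltn_ord d; lia.
have qok e : quad_ok (nat_of_ord a, nat_of_ord d, nat_of_ord c, e) =
    (c < 2 * a + 2)%N && (e < 2 * d + 2)%N.
  by rewrite /quad_ok; congr andb; apply/idP/idP; lia.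
case: ifP => hc; last by rewrite big1 // => e _; rewrite qok hc.
by rewrite [RHS]big_mkcond; apply: eq_bigr => e _; rewrite qok hc.
Qed.

(** The label of (0, 0, 0, 0) is a default for inadmissible quadruples; values are used only under
    [quad_ok]. *)
Definition label_of (t : nat * nat * nat * nat) : label R :=
  insubd (Sub (quad R (0%N, 0%N, 0%N, 0%N))
              (quad_admissible R (isT : quad_ok (0, 0, 0, 0)%N)) : label R)
    (quad R t).

Lemma label_ofE t : quad_ok t -> val (label_of t) = quad R t.
Proof. by move=> h; rewrite insubdK //; exact: quad_admissible. Qed.

Definition box (N M : nat) : seq (bool * label R) :=
  [seq (s, label_of t) | s <- [:: true; false], t <- quads N M].

Lemma box_uniq N M : uniq (box N M).
Proof.
apply: allpairs_uniq => //; first by rewrite filter_uniq // cube_uniq.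
have ok u : u \in [seq (s, t) | s <- [:: true; false], t <- quads N M] -> quad_ok u.2.
  by case/allpairsP => -[s t] [_ + ->]; rewrite mem_filter => /andP[].
move=> [s t] [s' t'] /ok h /ok h' [-> /(congr1 val)].
by rewrite !label_ofE // => /quad_inj ->.
Qed.

Lemma box_sub (s0 : seq (bool * label R)) : exists n0, forall N M, (n0 <= N)%N -> (n0 <= M)%N ->
  {subset s0 <= box N M}.
Proof.
pose m (i : bool * label R) := (let: (a, d, _, _) := label_quad i.2 in a + d)%N.
exists (\max_(i <- s0) m i).+1 => N M hN hM [s v] iv.
have : (m (s, v) <= \max_(i <- s0) m i)%N by exact: leq_bigmax_seq.
move: hN hM; move: (\max_(i <- s0) m i)%N => X hN hM.
rewrite /m /= => hm; apply/allpairsP; exists (s, label_quad v); split=> /=.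
- by rewrite !inE; case: (s).
- rewrite mem_filter label_quad_ok; move: (label_quad_ok v) hm.
  case: (label_quad v) => [[[a d] c] e] /= /andP[h1 h2] hm.
  by rewrite mem_cube; apply/and4P; split; lia.
- congr (_, _); apply: val_inj; rewrite label_ofE ?label_quad_ok //.
  exact: label_quadE.
Qed.

(** The trace is an unconditional sum, so it can be evaluated on finite sets that contain any
    prescribed one. Boxes have this property, and for fixed j and l the sum over a box factors into
    a sum over m1 and a sum over m2. *)
Lemma phi_x0 : phi b pi F gamma (x0 q) = (4 * kappa q ^+ 2)%:C.
Proof.
have [W hW] := weight_summable q_gt0 q_lt1; have [i0] := label_inhabited R.
have [_ sT] := pi_traceable_small q_gt0 q_lt1 hb hpi hF (x0 q).
have {}sT : small (gamma * F * commutator F (pi (x0 q))) by exact: smallMl.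
have [l hl] := has_trace_ex hb hW i0 sT.
rewrite /phi (has_traceE hl); apply/eqP; rewrite -subr_eq0; apply/eqP; apply: nrm0P.
apply: le_anti; rewrite nrm_ge0 andbT; apply: le_of_eps => e e0; rewrite add0r.
(* One fifth is for the tail of the trace, four fifths for 4 times the error of the double sum. *)
have e5 : 0 < e / 5 by rewrite divr_gt0.
have [s0 hs0] := hl _ e5; have [n0 hn0] := box_sub s0.
have [N [M [hN hM near]]] := double_sum_near q_gt0 q_lt1 n0 e5.
have {hs0} := hs0 _ (box_uniq N M) (hn0 N M hN hM).
pose D := \sum_(a < N) \sum_(d < M) (\sum_(c < (2 * a + 2)%N)
      coefA0 q (a%:R + 2^-1) (c%:R - a%:R - 2^-1)) *
    (\sum_(e < (2 * d + 2)%N)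
      coefH0 q (a%:R + d%:R + 2^-1) (a%:R + 2^-1) (e%:R - d%:R - 2^-1)).
have -> : \sum_(i <- box N M) dot (b i) ((gamma * F * commutator F (pi (x0 q))) (b i)) =
    (4 * D)%:C.
  rewrite /box big_allpairs_dep !big_cons big_nil Monoid.mulm1 /=.
  have E s : \sum_(t <- quads N M) dot (b (s, label_of t))
      ((gamma * F * commutator F (pi (x0 q))) (b (s, label_of t))) = (2 * D)%:C.
    pose f (a d c e : nat) : R := coefA0 q (a%:R + 2^-1) (c%:R - a%:R - 2^-1) *
      coefH0 q (a%:R + d%:R + 2^-1) (a%:R + 2^-1) (e%:R - d%:R - 2^-1).
    transitivity (\sum_(t <- quads N M) (2 * f t.1.1.1 t.1.1.2 t.1.2 t.2)%:C).
      rewrite big_seq [RHS]big_seq; apply: eq_bigr => t; rewrite mem_filter => /andP[ht _].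
      case: t ht => [[[a d] c] e'] ht.
      have vE : val (s, label_of (a, d, c, e')).2 = (a%:R + d%:R + 2^-1,
        c%:R - a%:R - 2^-1, e'%:R - d%:R - 2^-1, a%:R + 2^-1) := label_ofE ht.
      by rewrite (diagonal_x0 hb hpi hgamma hF vE).
    rewrite -rmorph_sum -mulr_sumr (sum_quads f); congr (2 * _)%:C.
    apply: eq_bigr => a _; apply: eq_bigr => d _; rewrite mulr_suml.
    by apply: eq_bigr => c _; rewrite mulr_sumr.
  transitivity ((2 * D)%:C + (2 * D)%:C : R[i]); first by congr (_ + _); exact: E.
  by rewrite -rmorphD; congr (_%:C); ring.
move: near; rewrite -/D => near hlD.
have -> : l - (4 * kappa q ^+ 2)%:C = (l - (4 * D)%:C) + (4 * (D - kappa q ^+ 2))%:C.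
  by rewrite mulrBr rmorphB addrA subrK.
apply: le_trans (nrmD _ _) _; rewrite nrmR normrM ger0_norm //.
by move: hlD near; move: (nrm _) `|D - _| => u v; lra.
Qed.

End SpinorTrace.

Theorem proposition7p1 (R : realType) (q : R) (hq0 : 0 < q) (hq1 : q < 1)
    (H : hilbertType R) (b : bool * label R -> H) (hb : orthonormal_basis b)
    (pi : s4q q -> bop H) (hpi : chiral_spinor_representation b pi)
    (gamma F : bop H)
    (hgamma : forall s l m1 m2 j,
       gamma (ket b s l m1 m2 j) = (chi R s)%:C *: ket b s l m1 m2 j)
    (hF : forall s l m1 m2 j,
       F (ket b s l m1 m2 j) = ket b (~~ s) l m1 m2 j) :
  [/\ even_fredholm_module pi F gamma,
      one_summable pi F,
      nontrivial_fredholm b pi F gamma,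
      half_trace b pi F gamma (s4_idem q) = 1 &
      exists e_idem : idempotent_mx (s4_idem q),
        chF b pi F gamma (K0_class e_idem) = 1].
Proof.
have [W hW] := weight_summable hq0 hq1; have [i0] := label_inhabited R.
have good := pi_traceable_small hq0 hq1 hb hpi hF.
have srep := star_rep hpi.
have FF := F_square hb hF; have gF := gamma_F hb hgamma hF.
have gpi := gamma_pi hb hpi hgamma.
have Ftr := F_traceable hq0 hq1 hb hF.
have pi_tr x := (good x).1; have pi_sm x := (good x).2.
have q0 : q != 0 by rewrite gt_eqF.
have q2 : 1 - q ^+ 2 != 0 by exact: qnat_neq0.
have eidem : idempotent_mx (s4_idem q) by exact: s4_idem_idempotent.
have phi1 : phi b pi F gamma 1 = 0.
  have [_ p1 _ _] := srep; rewrite /phi p1 /commutator mulr1 mul1r subrr mulr0.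
  have p0 : pi 0 = 0.
    have [h _ _ _] := srep; apply: (addrI (pi 0)).
    by rewrite -[X in X + pi 0]scale1r -h scale1r !addr0.
  (* The trace of the zero operator is recognised as the value of [phi] at 0. *)
  rewrite -(phi0 i0 hb hW gamma srep FF pi_sm) /phi.
  by rewrite p0 /commutator mulr0 mul0r subrr mulr0.
have ht : half_trace b pi F gamma (s4_idem q) = 1.
  rewrite half_traceE.
  have E (a : R[i]) : phi b pi F gamma (1 + a *: x0 q) = a * (4 * kappa q ^+ 2)%:C.
    rewrite (phiD i0 hb hW gamma srep FF pi_sm) (phiZ i0 hb hW gamma srep FF pi_sm).
    by rewrite phi1 add0r (phi_x0 hq0 hq1 hb hpi hgamma hF).
  rewrite !big_ord_recl big_ord0 addr0 !s4_idemE.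
  rewrite !(phiZ i0 hb hW gamma srep FF pi_sm) /s4_entry /= -scaleNr !E.
  have Q2 : 1 - (q%:C : R[i]) ^+ 2 != 0.
    by rewrite -rmorphXn -(rmorph1 (real_complex R)) -rmorphB fmorph_eq0.
  have -> : (4 * kappa q ^+ 2)%:C = 4 / (1 - (q%:C : R[i]) ^+ 2) ^+ 2.
    by rewrite /kappa exprVn rmorphM fmorphV rmorphXn rmorphB rmorph1 rmorphXn rmorph_nat.
  by field; rewrite Q2.
split=> //.
- split=> //.
  + exact: (F_adjoint hb hF).
  + by move=> x; exact: (small_compact hb (@weight_ge0 R q) hW).
  + exact: (gamma_adjoint hb hgamma).
  + exact: (gamma_square hb hgamma).
- move=> x; apply: (small_trace_class hb hW _ (pi_sm x)).
  exact: (commutator_adjoint hb hpi hF x).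
- exists (K0_class eidem).
  by rewrite (chF_class i0 hb hW srep FF gF gpi Ftr pi_tr pi_sm eidem (k := 1)).
- exists eidem.
  by rewrite (chF_class i0 hb hW srep FF gF gpi Ftr pi_tr pi_sm eidem (k := 1)).
Qed.
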